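(* Let $G$ be a finite group and let $\rho$ be a representation of $G$. Assume that the McKay graph $\Gamma(G,\rho)$ is an (undirected) tree. Then the pair $(G,\rho)$ is isomorphic to one of the following pairs: (1) $G$ is a dihedral group of order divisible by $4$, and $\rho$ is the complexification of its natural $2$-dimensional real representation. (2) $G\subset SU(2)$ is a binary polyhedral group of type $D$ or $E$, and $\rho$ is the natural $2$-dimensional representation of $G$. (3) $G$ is an extra special $2$-group of order $2^{1+2n}$ for some $n\ge 0$, and $\rho$ is the unique irreducible representation of $G$ of dimension $2^n$ on which the center $Z(G)$ acts non-trivially.
   Context: All representations are finite-dimensional over $\mathbb C$. $\mathrm{Irr}(G)$ is the set of isomorphism classes of irreducible representations of $G$. The McKay graph $\Gamma(G,\rho)$ is the directed graph (multiple edges and loops allowed) with vertex set $\mathrm{Irr}(G)$ in which the number of edges from $\pi$ to $\tau$ is $\dim \mathrm{Hom}_G(\pi\otimes\rho,\tau)$. A directed graph is called undirected if its adjacency matrix is symmetric; then each pair of opposite directed edges is regarded as one undirected edge. An undirected tree is a connected undirected graph with no closed paths (a path does not repeat edges); in particular it has no loops and at most one undirected edge between any two vertices. Pairs $(G,\rho)$ and $(G',\rho')$ are isomorphic if there is a group isomorphism $\varphi:G\to G'$ with $\rho\cong\rho'\circ\varphi$. For $m\ge3$, $\mathrm{Dih}_m$ is the dihedral group of order $2m$, the symmetry group of the regular $m$-gon, and its natural real representation is its action on $\mathbb R^2$; $\mathrm{Dih}_2=C_2\times C_2$, acting on $\mathbb R^2$ as the symmetry group of a digon, i.e. by the matrices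 $\mathrm{diag}(\pm1,\pm1)$. The binary polyhedral groups of type $D$ or $E$ are the preimages, under the double cover $SU(2)\to SO(3,\mathbb R)$, of the dihedral groups $\mathrm{Dih}_m\subset SO(3,\mathbb R)$, $m\ge2$ (type $D$), and of the rotation groups of the regular tetrahedron, octahedron and icosahedron (type $E$); the natural representation is the inclusion into $SU(2)\subset GL_2(\mathbb C)$. A finite group $G$ is an extra special $2$-group if $Z(G)\cong C_2$ and $G/Z(G)\cong (C_2)^N$ for some $N\ge0$ (here $C_2$ is the cyclic group of order $2$). It is known that $N=2n$ is then even, and that $G$ has exactly one irreducible representation on which $Z(G)$ acts non-trivially, of dimension $2^n$.
   Formalization: The representation is assumed nonzero: for the trivial group with the zero representation the McKay graph is a single vertex, hence a tree, yet the pair lies in none of the three families. *)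

(* Defs.v *)
From HB Require Import structures.
From mathcomp Require Import all_boot all_order all_algebra all_fingroup.
From mathcomp Require Import all_solvable all_field all_character.
From mathcomp Require Import complex.

Set Implicit Arguments.
Unset Strict Implicit.
Unset Printing Implicit Defensive.
Import Order.TTheory GRing.Theory Num.Theory.
Local Open Scope ring_scope.

(* A directed multigraph on the finite vertex set V is given by its adjacency
   matrix A : V -> V -> nat.  When A is symmetric, the undirected edges between
   x and y are indexed by k < A x y.  A step is a triple (x, k, y), meaning that
   the k-th edge between x and y is traversed from x to y; (x, k, y) and
   (y, k, x) are the two orientations of one and the same undirected edge. *)
Section Multigraph.

Variables (V : finType) (A : V -> V -> nat).

Definition step : eqType := (V * nat * V)%type.

Definition step_src (e : step) : V := e.1.1.
Definition step_tgt (e : step) : V := e.2.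
Definition is_step (e : step) : bool :=
  (e.1.2 < A (step_src e) (step_tgt e))%N.
Definition step_edge (e : step) : {set V} * nat :=
  ([set step_src e; step_tgt e], e.1.2).

Definition closed_path (s : seq step) : bool :=
  [&& s != [::], all is_step s,
      path.cycle (fun e f => step_tgt e == step_src f) s
    & uniq (map step_edge s)].

Definition undirected : Prop := forall x y, A x y = A y x.

Definition connected_graph : Prop :=
  forall x y, connect (fun u v => (0 < A u v)%N) x y.

Definition is_tree : Prop :=
  [/\ undirected, connected_graph & forall s, ~~ closed_path s].

End Multigraph.

Section McKay.

Variables (F : fieldType) (gT : finGroupType) (G : {group gT}).

(* Hom_G(r1, r2); intertwiners act on row vectors, as in mx_rsim. *)
Definition hom_space n1 n2 (r1 : mx_representation F G n1)
    (r2 : mx_representation F G n2) : {vspace 'M[F]_(n1, n2)} :=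
  (\bigcap_(g in G) lker (linfun (fun M => r1 g *m M - M *m r2 g)))%VS.

Lemma hom_spaceP n1 n2 (r1 : mx_representation F G n1)
    (r2 : mx_representation F G n2) (M : 'M[F]_(n1, n2)) :
  reflect (forall g, g \in G -> r1 g *m M = M *m r2 g) (M \in hom_space r1 r2).
Proof.
have linE g : linear (fun M : 'M[F]_(n1, n2) => r1 g *m M - M *m r2 g).
  move=> a B C; rewrite mulmxDr mulmxDl -scalemxAr -scalemxAl scalerBr.
  by rewrite opprD addrACA.
have kerE g : (M \in lker (linfun (fun M => r1 g *m M - M *m r2 g)))
    = (r1 g *m M == M *m r2 g).
  pose L : {linear 'M[F]_(n1, n2) -> 'M[F]_(n1, n2)} :=
    HB.pack (fun M : 'M[F]_(n1, n2) => r1 g *m M - M *m r2 g)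
      (GRing.isLinear.Build _ _ _ _ _ (linE g)).
  by rewrite memv_ker -[X in linfun X]/(L : _ -> _) lfunE /= subr_eq0.
rewrite memvE; apply: (iffP subv_bigcapP) => homM g Gg.
  by apply/eqP; rewrite -kerE memvE homM.
by rewrite -memvE kerE homM.
Qed.

End McKay.

(* Irr(G): the elements of an irrType index the isomorphism classes of
   irreducible representations, irr_repr i being a representative. *)
Definition Irr (F : decFieldType) (gT : finGroupType) (G : {group gT}) :
  irrType F G := DecSocleType (regular_repr F G).

Definition mckay (F : decFieldType) (gT : finGroupType) (G : {group gT}) d
    (rho : mx_representation F G d) (i j : Irr F G) : nat :=
  \dim (hom_space (prod_repr (irr_repr i) rho) (irr_repr j)).

Definition extra_special_2group (gT : finGroupType) (G : {group gT}) : Prop :=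
  'Z(G)%g \isog [set: 'Z_2] /\
  exists N : nat, (G / 'Z(G))%g \isog [set: 'rV['Z_2]_N].

Definition center_acts_nontrivially (F : fieldType) (gT : finGroupType)
    (G : {group gT}) d (rho : mx_representation F G d) : Prop :=
  exists2 z, z \in 'Z(G)%g & rho z != 1%:M.

Definition unique_center_nontrivial_irr (F : fieldType) (gT : finGroupType)
    (G : {group gT}) d (rho : mx_representation F G d) : Prop :=
  [/\ mx_irreducible rho, center_acts_nontrivially rho
    & forall d' (rho' : mx_representation F G d'),
        mx_irreducible rho' -> center_acts_nontrivially rho' ->
        mx_rsim rho' rho].

From mathcomp Require Import all_classical all_reals all_analysis.
Local Open Scope classical_set_scope.
Local Open Scope complex_scope.
Local Open Scope sesquilinear_scope.

(* The pair (G, rho) is isomorphic to (H, inclusion), where H is a subgroup of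
   GL_k(F) given as a set of matrices: a group isomorphism G -> H followed by
   the inclusion of H is a faithful representation of G with image H. *)
Definition iso_linear_group (F : fieldType) (gT : finGroupType)
    (G : {group gT}) d (rho : mx_representation F G d)
    k (H : set 'M[F]_k) : Prop :=
  exists phi : mx_representation F G k,
    [/\ mx_faithful phi, [set phi g | g in [set` G]] = H & mx_rsim rho phi].

Section PolyhedralGroups.

Variable R : realType.

Definition symmetry_group n (V : set 'cV[R]_n) : set 'M[R]_n :=
  [set A | A *m A^T = 1%:M /\ [set A *m v | v in V] = V].

Definition rotation_group n (V : set 'cV[R]_n) : set 'M[R]_n :=
  [set A | symmetry_group V A /\ \det A = 1].

Definition polygon (m : nat) : set 'cV[R]_2 :=
  [set v | exists2 k : nat, (k < m)%N &
     v = cos (2 * pi * k%:R / m%:R) *: delta_mx 0 0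
         + sin (2 * pi * k%:R / m%:R) *: delta_mx 1 0].

(* For m = 2 the polygon is the digon {e_0, - e_0}, whose symmetry group
   consists of the four matrices diag(+-1, +-1). *)
Definition Dih (m : nat) : set 'M[R]_2 := symmetry_group (polygon m).

Definition Dih_complexified (m : nat) : set 'M[R[i]]_2 :=
  [set map_mx (real_complex R) A | A in Dih m].

(* Dih_m inside SO(3): reflections of the plane become half-turns of space. *)
Definition Dih_SO3 (m : nat) : set 'M[R]_3 :=
  [set (block_mx A 0 0 (\det A)%:M : 'M[R]_(2 + 1)) | A in Dih m].

Definition tetrahedron : set 'cV[R]_3 :=
  [set v | (forall i, v i 0 = 1 \/ v i 0 = -1) /\ \prod_i v i 0 = 1].

Definition octahedron : set 'cV[R]_3 :=
  [set v | exists i : 'I_3, v = delta_mx i 0 \/ v = - delta_mx i 0].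

(* The cyclic permutations of (0, +-1, +-golden); i + 1 and i + 2 are
   taken modulo 3. *)
Definition icosahedron : set 'cV[R]_3 :=
  let golden : R := (1 + Num.sqrt 5) / 2 in
  [set v | exists (i : 'I_3) (s t : bool),
     v = (-1) ^+ s *: delta_mx (i + 1) 0
         + ((-1) ^+ t * golden) *: delta_mx (i + 2) 0].

Definition SU2 : set 'M[R[i]]_2 :=
  [set U | U \is unitarymx /\ \det U = 1].

Definition pauli (k : 'I_3) : 'M[R[i]]_2 :=
  match val k with
  | 0%N => delta_mx 0 1 + delta_mx 1 0
  | 1%N => 'i%C *: (delta_mx 1 0 - delta_mx 0 1)
  | _ => delta_mx 0 0 - delta_mx 1 1
  end.

(* SU(2) acts by X |-> U X U^* on the traceless Hermitian matrices, a real
   Euclidean space with orthonormal basis the Pauli matrices for the inner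
   product <X, Y> = tr(X Y) / 2; this is the matrix of that action. *)
Definition double_cover (U : 'M[R[i]]_2) : 'M[R]_3 :=
  \matrix_(i, j) (complex.Re (\tr (pauli i *m (U *m pauli j *m U ^t*))) / 2).

Definition binary_group (H : set 'M[R]_3) : set 'M[R[i]]_2 :=
  [set U | SU2 U /\ H (double_cover U)].

Definition binary_polyhedral_DE (B : set 'M[R[i]]_2) : Prop :=
  [\/ exists2 m : nat, (2 <= m)%N & B = binary_group (Dih_SO3 m),
      B = binary_group (rotation_group tetrahedron),
      B = binary_group (rotation_group octahedron)
    | B = binary_group (rotation_group icosahedron)].

End PolyhedralGroups.

(* Main.v *)
(** A tree has an end vertex and is 2-colourable.  Connectedness makes rho faithful, symmetry makes
    it self-dual, an end vertex makes it irreducible, and the colouring produces z in G with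
    rho z = -1.  Take a leaf l whose neighbour p has at most one neighbour m that is not a leaf.  The
    leaves x at p satisfy x rho = p, so all have the same character at any g with p(g) <> 0, and
    l rho^2 = p rho is the sum of the neighbours of p.  Of Sym^2 rho and Alt^2 rho choose one, X,
    such that m does not occur in l X; then X(g) = X(1) when p(g) <> 0, which for d >= 3 forces
    rho(g) = +1 or -1.  So p is supported on {1, z} and vanishes elsewhere, hence p = rho,
    |G| = 2 d^2, rho^2 is the sum of all the characters of G / {1, z}, and G is extra special.

    For d = 2 there is a nonzero invariant bilinear form, symmetric or skew.  In a hyperbolic basis
    for a symmetric form, G consists of matrices diag(a, 1/a) and antidiag(b, 1/b), and is
    dihedral.  A skew form puts G in SU(2).  An element of SU(2) other than +1 and -1 is a unit
    quaternion with a vector part, whose direction is the axis of a rotation; counting elements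
    of G by conjugacy classes of axes, as Klein did, leaves the dihedral case and three numerical
    cases, in which the orbit of axes of maximal order has 4, 6 or 12 elements.  The inner products
    within the orbit are then determined, so some rotation carries it to the vertices of the
    tetrahedron, octahedron or icosahedron. *)

(* The values of the irreducible characters at a fixed g form an eigenvector of the adjacency
   matrix, with eigenvalue the trace of rho(g); at g = 1 it is the vector of degrees, with
   eigenvalue d. Alternating its signs along the colouring gives the eigenvalue -d, which must then
   be a trace as well, and in unitary coordinates a trace -d forces rho(z) = -1. Degree 2 escapes
   the leaf argument because the alternating square of a plane is the determinant, whose triviality
   at g only says det rho(g) = 1. In degree at least 3 an element fixing all symmetric forms, or all
   alternating ones, is +1 or -1. Klein's count is made with elements of G in place of points of the
   sphere. Of the two lifts of a nontrivial rotation, each belongs to one orientation of its axis;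
   the stabiliser of an oriented axis is a centraliser; and irreducibility excludes the cyclic
   groups, where all of G fixes an axis. *)
Require Import Defs.
From HB Require Import structures.
From mathcomp Require Import all_boot all_order all_algebra all_fingroup.
From mathcomp Require Import all_solvable all_field all_character.
From mathcomp Require Import complex.
From mathcomp Require Import all_classical all_reals all_analysis.
From mathcomp Require Import ring lra zify.

Set Implicit Arguments.
Unset Strict Implicit.
Unset Printing Implicit Defensive.
Import Order.TTheory GRing.Theory Num.Theory.
Local Open Scope ring_scope.
Local Open Scope sesquilinear_scope.

(** * Acyclic graphs *)

Section Acyclic.

Variables (V : finType) (e : rel V).
Hypothesis e_sym : symmetric e.
Hypothesis e_irr : irreflexive e.
Hypothesis e_acyclic : forall c, uniq c -> (2 < size c)%N -> ~~ path.cycle e c.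

(** An edge from w back to x would close the initial segment of the path ending at w; as w lies
    beyond y, that cycle has at least three vertices. *)
Lemma acyclic_path_chord x y p w :
  path e x (y :: p) -> uniq (x :: y :: p) -> w \in p -> ~~ e w x.
Proof.
move=> epath uniqp wp; case/splitPr: wp epath uniqp => p1 p2 epath uniqp.
have pE : y :: p1 ++ w :: p2 = (y :: rcons p1 w) ++ p2 by rewrite /= cat_rcons.
rewrite pE in epath uniqp; move: epath; rewrite cat_path => /andP[epath _].
move: uniqp; rewrite -cat_cons cat_uniq => /andP[uniqc _].
apply/negP => ewx; have /negP[] := e_acyclic uniqc ltac:(by rewrite /= size_rcons).
by rewrite /path.cycle rcons_path epath /= last_rcons.
Qed.

Definition longest_path (S : {set V}) x p :=
  [/\ {subset x :: p <= S}, path e x p, uniq (x :: p) &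
    forall y q, {subset y :: q <= S} -> path e y q -> uniq (y :: q) ->
      (size q <= size p)%N].

Lemma longest_pathP (S : {set V}) x0 p0 :
    {subset x0 :: p0 <= S} -> path e x0 p0 -> uniq (x0 :: p0) ->
  exists x p, longest_path S x p /\ (size p0 <= size p)%N.
Proof.
move=> S0 path0 uniq0.
pose P n := `[< exists x p, [/\ {subset x :: p <= S}, path e x p,
                                uniq (x :: p) & size p = n] >].
have exP : exists n, P n by exists (size p0); apply/asboolP; exists x0, p0.
have ubP n : P n -> (n <= #|V|)%N.
  case/asboolP=> x [p [_ _ /card_uniqP uniqp <-]].
  by have := max_card (mem (x :: p)); rewrite uniqp => /ltnW.
case: (ex_maxnP exP ubP) => n /asboolP[x [p [Sp pathp uniqp <-]]] maxp.
exists x, p; split; last by apply: maxp; apply/asboolP; exists x0, p0.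
by split=> // y q Sq pathq uniqq; apply: maxp; apply/asboolP; exists y, q.
Qed.

(** A neighbour off the path could be put in front of it, against maximality; one on the path other
    than its second vertex would give a chord. *)
Lemma longest_path_end (S : {set V}) x p w :
  longest_path S x p -> w \in S -> e x w -> w = head x p.
Proof.
case=> Sp pathp uniqp maxp Sw exw.
have wp : w \in p.
  apply: contraT => wNp; have := maxp w (x :: p); rewrite ltnn; apply.
  - by move=> z; rewrite inE => /predU1P[->|/Sp].
  - by rewrite /= e_sym exw.
  rewrite cons_uniq uniqp inE negb_or wNp !andbT.
  by apply: contraTneq exw => ->; rewrite e_irr.
case: p => // y p in pathp uniqp wp {Sp maxp} *.
move: wp; rewrite inE => /predU1P[//|wp].
by have := acyclic_path_chord pathp uniqp wp; rewrite e_sym exw.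
Qed.

(** Induction on the size of a vertex set: an end of a longest path has at most one neighbour in the
    set, so it can be coloured last. *)
Lemma acyclic_coloring :
  exists c : V -> bool, forall x y, e x y -> c x != c y.
Proof.
suff colS n (S : {set V}) : #|S| = n ->
    exists c : V -> bool, forall x y, x \in S -> y \in S -> e x y -> c x != c y.
  by have [c cP] := colS _ [set: V] erefl; exists c => x y; apply: cP.
elim: n S => [|n IHn] S cardS.
  by exists xpredT => x y; rewrite (cards0_eq cardS) inE.
have /card_gt0P[x0 Sx0] : (0 < #|S|)%N by rewrite cardS.
have [|//|//|x [p [maxp _]]] := @longest_pathP S x0 [::].
  by move=> z; rewrite inE => /eqP->.
have Sx : x \in S by case: maxp => Sp _ _ _; apply: Sp; rewrite mem_head.
have [c cP] : exists c : V -> bool,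
    forall a b, a \in S :\ x -> b \in S :\ x -> e a b -> c a != c b.
  by apply: IHn; apply/eqP; rewrite -eqSS -cardS (cardsD1 x S) Sx.
exists (fun z => if z == x then ~~ c (head x p) else c z) => a b Sa Sb eab.
have nbr w : w \in S -> e x w -> w = head x p by apply: longest_path_end.
have [ax|ax] := eqVneq a x; have [bx|bx] := eqVneq b x.
- by rewrite ax bx e_irr in eab.
- by rewrite ax in eab; rewrite (nbr b) //; case: (c _).
- by rewrite bx e_sym in eab; rewrite (nbr a) //; case: (c _).
by apply: cP => //; rewrite !inE ?ax ?bx.
Qed.

(** Take a longest path l, p, m, ... Any other neighbour w of p can replace l at its end; the new
    path is again longest, so w is a leaf too. *)
Lemma acyclic_pendant a b : e a b ->
  exists l p m, [/\ e l p, forall w, e l w -> w = p &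
    forall w, e p w -> w != m -> forall u, e w u -> u = p].
Proof.
move=> eab; have [|||x [[|y p] [maxp //]]] := @longest_pathP [set: V] a [:: b].
- by move=> z _; rewrite inE.
- by rewrite /= eab.
- by rewrite /= inE !andbT; apply: contraTneq eab => ->; rewrite e_irr.
(* If the path is the single edge from x to y, the default of [head] makes m = y, which is never its
   own neighbour. *)
move=> _; exists x, y, (head y p); have [_ pathp uniqp maxs] := maxp.
split=> [|w exw|w eyw wm u ewu]; first by case/andP: pathp.
  by rewrite (longest_path_end maxp _ exw) ?inE.
have {}pathp : path e y p by case/andP: pathp.
have {}uniqp : uniq (y :: p) by case/andP: uniqp.
have wNp : w \notin y :: p.
  rewrite inE negb_or; apply/andP; split.
    by apply: contraTneq eyw => ->; rewrite e_irr.
  case: p => // z p in wm pathp uniqp {maxp maxs} *.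
  rewrite inE negb_or wm /=; apply/negP => wp.
  by have := acyclic_path_chord pathp uniqp wp; rewrite e_sym eyw.
have lw : longest_path [set: V] w (y :: p).
  split=> //; first by move=> z _; rewrite inE.
    by rewrite /= e_sym eyw.
  by rewrite cons_uniq wNp.
by rewrite (longest_path_end lw _ ewu) ?inE.
Qed.

End Acyclic.

Section Tree.

Variables (V : finType) (A : V -> V -> nat).
Hypothesis treeA : is_tree A.

Lemma tree_sym x y : A x y = A y x.
Proof. by have [symA _ _] := treeA. Qed.

Lemma tree_loop x : A x x = 0%N.
Proof.
have [_ _ noc] := treeA; apply/eqP; rewrite -leqn0 leqNgt; apply/negP => Axx.
have := noc [:: (x, 0%N, x)].
by rewrite /closed_path /= /is_step /= Axx /step_tgt /step_src /= eqxx.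
Qed.

Lemma tree_simple x y : (A x y <= 1)%N.
Proof.
have [symA _ noc] := treeA; rewrite leqNgt; apply/negP => Axy.
have := noc [:: (x, 0%N, y); (y, 1%N, x)].
rewrite /closed_path /= /is_step /= /step_tgt /step_src /=.
by rewrite (symA y x) Axy (ltnW Axy) !eqxx /step_edge /= inE xpair_eqE andbF.
Qed.

(** A cycle of vertices becomes a closed path through the edges of index 0. An edge used twice would
    be traversed back and forth, so [next c (next c z)] would be z and the cycle would have length
    at most 2. *)
Lemma tree_acyclic c : uniq c -> (2 < size c)%N ->
  ~~ path.cycle (fun x y => 0 < A x y)%N c.
Proof.
have [symA _ noc] := treeA; move=> uc sc; apply/negP => cyc.
pose f x : step V := (x, 0%N, next c x).
have := noc (map f c); rewrite /closed_path; case/negP; apply/and4P; split.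
- by case: (c) sc.
- by apply/allP => _ /mapP[x cx ->]; apply: (next_cycle cyc).
- by rewrite cycle_map; apply: cycle_next.
rewrite -map_comp map_inj_in_uniq // => x y cx cy /= [] exy.
apply/eqP; apply: contraT => nxy.
have next2 z : z \in c -> next c (next c z) != z.
  move=> cz; have [i p cE] := rot_to cz; rewrite -!(next_rot i uc) cE.
  have : uniq (z :: p) by rewrite -cE rot_uniq.
  have : (2 < size (z :: p))%N by rewrite -cE size_rot.
  case: p {cE} => [|u [|v p]] //= _; rewrite !inE !negb_or eqxx.
  case/and3P=> /and3P[zu zv _] _ _.
  by rewrite (eq_sym u) (negPf zu) eqxx eq_sym.
have : x \in [set y; next c y] by rewrite -exy !inE eqxx.
have : y \in [set x; next c x] by rewrite exy !inE eqxx.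
rewrite !inE (negPf nxy) eq_sym (negPf nxy) /= => /eqP yx /eqP xy.
by have := next2 x cx; rewrite -yx -xy eqxx.
Qed.

End Tree.

(** * Characters *)

Section Characters.

Variables (C : numClosedFieldType) (gT : finGroupType) (G : {group gT}).

Local Notation reprG := (mx_representation C G).
Local Notation irrG := (Irr C G).

Definition chr n (r : reprG n) (g : gT) : C := \tr (r g).

(** The inner product of class functions with f (g^-1) in place of the complex conjugate: it is
    bilinear, and conjugation only enters with [chrV]. *)
Definition cdot (f h : gT -> C) : C :=
  #|G|%:R^-1 * \sum_(g in G) f g^-1%g * h g.

Lemma cardG_neq0 : #|G|%:R != 0 :> C.
Proof. by rewrite pnatr_eq0 -lt0n cardG_gt0. Qed.

Lemma pchar'G : ([pchar C]^'.-group G)%g.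
Proof. by apply/pgroupP=> p _; rewrite inE /= pchar_num. Qed.

Lemma splittingG : group_splitting_field C G.
Proof. exact: group_closure_closed_field. Qed.

Lemma chr1 n (r : reprG n) : chr r 1%g = n%:R.
Proof. by rewrite /chr repr_mx1 mxtrace1. Qed.

Lemma chr_rsim n1 n2 (r1 : reprG n1) (r2 : reprG n2) :
  mx_rsim r1 r2 -> {in G, chr r1 =1 chr r2}.
Proof. exact: mxtrace_rsim. Qed.

Lemma eq_cdot f f' h h' :
  {in G, f =1 f'} -> {in G, h =1 h'} -> cdot f h = cdot f' h'.
Proof.
move=> ff hh; rewrite /cdot; congr (_ * _); apply: eq_bigr => g Gg.
by rewrite ff ?groupV // hh.
Qed.

Lemma cdotDr f h1 h2 : cdot f (fun g => h1 g + h2 g) = cdot f h1 + cdot f h2.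
Proof.
by rewrite /cdot -mulrDr -big_split /=; under eq_bigr do rewrite mulrDr.
Qed.

Lemma cdot_sumr (I : finType) (P : pred I) (a : I -> C) (h : I -> gT -> C) f :
  cdot f (fun g => \sum_(i | P i) a i * h i g)
    = \sum_(i | P i) a i * cdot f (h i).
Proof.
rewrite /cdot; under eq_bigr do rewrite mulr_sumr.
rewrite exchange_big mulr_sumr; apply: eq_bigr => i _ /=.
rewrite [RHS]mulrCA; congr (_ * _); rewrite mulr_sumr; apply: eq_bigr => g _.
by rewrite mulrCA.
Qed.

Lemma cdotC f h : cdot f h = cdot h f.
Proof.
rewrite /cdot; congr (_ * _); rewrite (reindex_inj invg_inj) /=.
by apply: eq_big => g; rewrite ?groupV // invgK mulrC.
Qed.

(** For a full-rank factorisation E = A B, the equation A B A B = A B can be cancelled by A on the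
    left and by B on the right. *)
Lemma mulmx_base_idem n (E : 'M[C]_n) :
  E *m E = E -> row_base E *m col_base E = 1%:M.
Proof.
move=> EE; have fr : row_free (col_base E)^T.
  by rewrite /row_free mxrank_tr; apply: col_base_full.
apply: (row_free_inj (row_base_free E)); apply: trmx_inj.
apply: (row_free_inj fr); rewrite /= -!trmx_mul mul1mx; congr trmx.
move: (mulmx_base E); move: (col_base E) (row_base E) => A B AB.
by rewrite !mulmxA AB -mulmxA AB EE.
Qed.

Lemma mxtrace_idem n (E : 'M[C]_n) : E *m E = E -> \tr E = (\rank E)%:R.
Proof.
move=> EE; rewrite -{1}(mulmx_base E) mxtrace_mulC.
by rewrite mulmx_base_idem // mxtrace1.
Qed.

Lemma mxtrace_lin_mx m n (f : {linear 'M[C]_(m, n) -> 'M[C]_(m, n)}) :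
  \tr (lin_mx f) = \sum_i \sum_j f (delta_mx i j) i j.
Proof.
rewrite /mxtrace (reindex (uncurry (@mxvec_index m n))) /=; last first.
  exact: curry_mxvec_bij.
rewrite pair_bigA; apply: eq_bigr => -[i j] _ /=.
by rewrite !mxE /= vec_mx_delta mxvecE.
Qed.

Section HomDim.

Variables (n1 n2 : nat) (r1 : reprG n1) (r2 : reprG n2).

Definition hom_proj (M : 'M[C]_(n1, n2)) : 'M[C]_(n1, n2) :=
  #|G|%:R^-1 *: \sum_(g in G) r1 g^-1%g *m M *m r2 g.

Fact hom_proj_linear : linear hom_proj.
Proof.
move=> a A B; rewrite /hom_proj scalerA mulrC -scalerA -scalerDr; congr (_ *: _).
rewrite scaler_sumr -big_split; apply: eq_bigr => g _ /=.
by rewrite mulmxDr mulmxDl -scalemxAr -scalemxAl.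
Qed.

HB.instance Definition _ :=
  GRing.isSemilinear.Build C _ _ _ hom_proj
    (GRing.semilinear_linear hom_proj_linear).

Lemma hom_proj_mem M : hom_proj M \in hom_space r1 r2.
Proof.
apply/hom_spaceP => h Gh; rewrite -scalemxAr -scalemxAl; congr (_ *: _).
rewrite mulmx_sumr mulmx_suml.
rewrite (reindex_inj (mulIg h)) /=; apply: eq_big => [g | g Gg].
  by rewrite groupMr.
rewrite groupMr // in Gg; rewrite invMg !repr_mxM ?groupV // !mulmxA.
by rewrite -(repr_mxM r1 Gh) ?groupV // mulgV repr_mx1 mul1mx.
Qed.

Lemma hom_proj_id M : M \in hom_space r1 r2 -> hom_proj M = M.
Proof.
move/hom_spaceP=> homM; rewrite /hom_proj (eq_bigr (fun=> M)) => [|g Gg].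
  by rewrite sumr_const -scaler_nat scalerA mulVf ?scale1r ?cardG_neq0.
by rewrite -mulmxA -homM // mulmxA -repr_mxM ?groupV // mulVg repr_mx1 mul1mx.
Qed.

(** The averaging operator [hom_proj] is idempotent with the intertwiners as image, so their
    dimension is its trace; on elementary matrices that trace splits, for each g, into a product of
    two traces. *)
Lemma cdot_hom : cdot (chr r1) (chr r2) = (\dim (hom_space r1 r2))%:R.
Proof.
have idP M : hom_proj (hom_proj M) = hom_proj M.
  by rewrite hom_proj_id ?hom_proj_mem.
have rkP : \rank (lin_mx hom_proj) = \dim (hom_space r1 r2).
  (* [L] identifies the row space of the matrix of [hom_proj], measured by a matrix rank, with the
     subspace [hom_space]. *)
  pose E := lin_mx hom_proj; pose L u : 'M[C]_(n1, n2) := vec_mx (u *m row_base E).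
  have Llin : linear L by move=> a u v; rewrite /L mulmxDl linearD -scalemxAl linearZ.
  pose L' : {linear 'rV[C]_(\rank E) -> 'M[C]_(n1, n2)} :=
    HB.pack L (GRing.isSemilinear.Build C _ _ _ L (GRing.semilinear_linear Llin)).
  have L0 : lker (linfun L') = 0%VS.
    apply/eqP/lker0P => u v; rewrite !lfunE /= /L.
    by move/(can_inj vec_mxK)/(row_free_inj (row_base_free E)).
  have -> : hom_space r1 r2 = limg (linfun L').
    apply/eqP; rewrite eqEsubv; apply/andP; split; apply/subvP => M.
      move=> hM; have -> : M = linfun L' (mxvec M *m col_base E).
        by rewrite lfunE /= /L -mulmxA mulmx_base mul_rV_lin !mxvecK /= hom_proj_id.
      by rewrite memv_img ?memvf.
    case/memv_imgP=> u _ ->; rewrite lfunE /= /L; have /submxP[w ->] : (u *m row_base E <= E)%MS.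
      by rewrite (submx_trans (submxMl _ _)) ?eq_row_base.
    by rewrite -(vec_mxK w) mul_rV_lin !mxvecK /= hom_proj_mem.
  by rewrite limg_dim_eq ?L0 ?capv0 // dimvf /dim /= mul1n.
rewrite -rkP -mxtrace_idem; last first.
  by apply/row_matrixP=> i; rewrite !rowE mulmxA !mul_rV_lin /= mxvecK idP.
have projE i j : hom_proj (delta_mx i j) i j
    = #|G|%:R^-1 * \sum_(g in G) r1 g^-1%g i i * r2 g j j.
  rewrite mxE summxE; congr (_ * _); apply: eq_bigr => g _.
  rewrite -(mul_delta_mx (0 : 'I_1)) mulmxA -colE -mulmxA -rowE mxE big_ord1.
  by rewrite !mxE.
rewrite mxtrace_lin_mx; under [RHS]eq_bigr => i _ do under eq_bigr => j _ do rewrite projE.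
rewrite pair_bigA -mulr_sumr exchange_big; congr (_ * _); apply: eq_bigr => g _ /=.
by rewrite /chr /mxtrace big_distrlr pair_bigA.
Qed.

End HomDim.
End Characters.

Section IrreducibleCharacters.

Variables (C : numClosedFieldType) (gT : finGroupType) (G : {group gT}).

Local Notation reprG := (mx_representation C G).
Local Notation irrG := (Irr C G).
Local Notation irrchr i := (chr (irr_repr (i : irrG))).

(** Schur's lemma: the row space of M is a submodule for r2 and its left kernel one for r1. *)
Lemma hom_irr_full n1 n2 (r1 : reprG n1) (r2 : reprG n2) M :
    mx_irreducible r1 -> mx_irreducible r2 -> M \in hom_space r1 r2 -> M != 0 ->
  mx_rsim r1 r2.
Proof.
move=> /mx_irrP[_ irr1] /mx_irrP[_ irr2] /hom_spaceP homM nzM.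
have fullM : row_full M.
  suff: row_full (genmx M) by rewrite /row_full genmxE.
  apply: irr2; last by rewrite -mxrank_eq0 genmxE mxrank_eq0.
  apply/mxmoduleP => g Gg; rewrite (eqmxMr _ (genmxE M)) genmxE -homM //.
  exact: submxMl.
have freeM : row_free M.
  rewrite -kermx_eq0; apply: contraT => nzK.
  have: row_full (kermx M).
    apply: irr1 nzK; apply/mxmoduleP => g Gg; apply/sub_kermxP.
    by rewrite -mulmxA homM // mulmxA mulmx_ker mul0mx.
  rewrite -sub1mx => /sub_kermxP; rewrite mul1mx => M0.
  by rewrite M0 eqxx in nzM.
have n12 : n1 = n2 by rewrite -(eqP fullM) (eqP freeM).
by exists M.
Qed.

Lemma irr_repr_rsim n (r : reprG n) :
  mx_irreducible r -> exists i : irrG, mx_rsim r (irr_repr i).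
Proof. by move=> irr_r; exists (irr_comp (Irr C G) r); exact: (rsim_irr_comp_pchar (Irr C G) (@pchar'G C gT G) irr_r). Qed.

Lemma irr_repr_inj (i j : irrG) : mx_rsim (irr_repr i) (irr_repr j) -> i = j.
Proof.
move/(irr_comp_rsim_pchar (Irr C G) (@pchar'G C gT G)).
by rewrite !(irr_reprK_pchar (@pchar'G C gT G)).
Qed.

Lemma irr_cent_scalar n (r : reprG n) A :
  mx_irreducible r -> (forall g, g \in G -> A *m r g = r g *m A) -> is_scalar_mx A.
Proof.
move=> irr_r cA; apply: (mx_abs_irr_cent_scalar (splittingG irr_r)).
by apply/centgmxP.
Qed.

Lemma cdot_irr (i j : irrG) : cdot G (irrchr i) (irrchr j) = (i == j)%:R.
Proof.
rewrite cdot_hom; have [->|ne_ij] := eqVneq i j; last first.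
  suff -> : hom_space (irr_repr i) (irr_repr j) = 0%VS by rewrite dimv0.
  apply/eqP; rewrite -subv0; apply/subvP => M homM; rewrite memv0.
  apply: contraR ne_ij => nzM; apply/eqP/irr_repr_inj.
  by apply: hom_irr_full homM nzM; apply: socle_irr.
suff -> : hom_space (irr_repr j) (irr_repr j) = <[1%:M]>%VS.
  rewrite dim_vline -mxrank_eq0 mxrank1.
  by have /mx_irrP[] := socle_irr j; rewrite lt0n => ->.
apply/eqP; rewrite eqEsubv; apply/andP; split; apply/subvP => M.
  move=> /hom_spaceP homM; have /is_scalar_mxP[a ->] : is_scalar_mx M.
    by apply: irr_cent_scalar (socle_irr j) _ => g Gg; rewrite -homM.
  by apply/vlineP; exists a; rewrite scalemx1.
case/vlineP=> a ->; apply/hom_spaceP => g _.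
by rewrite -scalemxAr -scalemxAl mulmx1 mul1mx.
Qed.

(** Induction on the degree: the trace is additive over a proper submodule and its quotient. *)
Lemma chr_decomp n (r : reprG n) : exists m : irrG -> nat,
  {in G, forall g, chr r g = \sum_i (m i)%:R * (irrchr i) g}.
Proof.
elim/ltn_ind: n => n IHn in r *.
have [irr_r|nirr] := pselect (mx_irreducible r).
  have [i sim] := irr_repr_rsim irr_r; exists (fun j => (i == j)%N) => g Gg.
  rewrite (chr_rsim sim Gg) (bigD1 i) //= eqxx mul1r big1 ?addr0 // => j.
  by rewrite eq_sym => /negPf->; rewrite mul0r.
have [n0|n_gt0] := posnP n.
  exists (fun=> 0%N) => g _; rewrite big1 => [|i _]; last by rewrite mul0r.
  by rewrite /chr; move: (r g); rewrite n0 => A; rewrite (flatmx0 A) mxtrace0.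
have [U [modU nzU nfullU]] : exists U : 'M[C]_n, [/\ mxmodule r U, U != 0 & ~~ row_full U].
  apply: contrapT => noU; apply: nirr; apply/mx_irrP; split=> // U modU nzU.
  by apply: contraT => nfU; case: noU; exists U.
have ltU : (\rank U < n)%N by rewrite ltn_neqAle rank_leq_row andbT.
have ltcU : (\rank (cokermx U) < n)%N.
  by rewrite mxrank_coker ltn_subrL n_gt0 lt0n mxrank_eq0 nzU.
have [m1 e1] := IHn _ ltU (submod_repr modU).
have [m2 e2] := IHn _ ltcU (factmod_repr modU).
exists (fun i => m1 i + m2 i)%N => g Gg; rewrite /chr -(mxtrace_sub_fact_mod modU).
rewrite -/(chr _ g) -/(chr (factmod_repr modU) g) e1 // e2 // -big_split /=.
by apply: eq_bigr => i _; rewrite natrD mulrDl.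
Qed.

Definition mult n (r : reprG n) (i : irrG) : nat := \dim (hom_space r (irr_repr i)).

Lemma chr_mult n (r : reprG n) :
  {in G, forall g, chr r g = \sum_i (mult r i)%:R * (irrchr i) g}.
Proof.
have [m rE] := chr_decomp r => g Gg; rewrite rE //; apply: eq_bigr => i _.
congr (_ * _); rewrite /mult -cdot_hom cdotC.
rewrite (@eq_cdot _ _ _ _ (irrchr i) _ _ (fun _ _ => erefl) rE).
rewrite cdot_sumr (bigD1 i) //= cdot_irr eqxx mulr1 big1 ?addr0 // => j.
by rewrite cdot_irr eq_sym => /negPf->; rewrite mulr0.
Qed.

(** The trace of the regular representation, computed from its decomposition into irreducibles and
    from the fixed points of translation by g. *)
Lemma sum_irr_chr g : g \in G ->
  \sum_(i : irrG) (irrchr i) 1%g * (irrchr i) g = #|G|%:R * (g == 1%g)%:R.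
Proof.
move=> Gg; transitivity (\tr (regular_repr C G g)).
  rewrite (mxtrace_regular_pchar (Irr C G) (@pchar'G C gT G) (@splittingG C gT G)) //.
  by apply: eq_bigr => i _; rewrite chr1 mulr_natl.
rewrite /mxtrace (eq_bigr (fun=> (g == 1%g)%:R)) => [|i _].
  by rewrite sumr_const card_ord mulr_natl.
have Gi : enum_val i \in G by apply: enum_valP.
rewrite !mxE eqxx /=; congr ((nat_of_bool _)%:R); apply/eqP/eqP => [/(congr1 enum_val)|->].
  by rewrite gring_indexK ?groupM // -{1}[enum_val i]mulg1 => /mulgI.
by rewrite mulg1 gring_valK.
Qed.

End IrreducibleCharacters.

(** * Unitary representations, symmetric and alternating squares *)

Section ConjugateTranspose.

Variable C : numClosedFieldType.

Lemma ctrM m n p (A : 'M[C]_(m, n)) (B : 'M[C]_(n, p)) : (A *m B) ^t* = B ^t* *m A ^t*.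
Proof. by rewrite trmx_mul map_mxM. Qed.

Lemma ctrK m n (A : 'M[C]_(m, n)) : (A ^t*) ^t* = A.
Proof. by apply/matrixP => i j; rewrite !mxE conjCK. Qed.

Lemma ctr1 n : (1%:M : 'M[C]_n) ^t* = 1%:M.
Proof. by rewrite trmx1 map_mx1. Qed.

Lemma mulmx_ctr_diag m n (A : 'M[C]_(m, n)) i :
  (A *m A ^t*) i i = \sum_j `|A i j| ^+ 2.
Proof. by rewrite mxE; apply: eq_bigr => j _; rewrite !mxE normCK. Qed.

Lemma mulmx_ctr_ge0 m n (A : 'M[C]_(m, n)) i : 0 <= (A *m A ^t*) i i.
Proof. by rewrite mulmx_ctr_diag sumr_ge0 // => j _; rewrite exprn_ge0. Qed.

Lemma mxtrace_ctr_eq0 m n (A : 'M[C]_(m, n)) : \tr (A *m A ^t*) = 0 -> A = 0.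
Proof.
move/psumr_eq0P=> trA; apply/matrixP => i j; rewrite mxE.
have := trA (fun i _ => mulmx_ctr_ge0 A i) i isT; rewrite mulmx_ctr_diag.
move/psumr_eq0P => Ai0; apply/eqP.
by rewrite -normr_eq0 -sqrf_eq0 Ai0 // => k _; rewrite exprn_ge0.
Qed.

Lemma mulmx_ctr_gt0 n (u : 'rV[C]_n) : u != 0 -> 0 < (u *m u ^t*) 0 0.
Proof.
move=> nzu; rewrite lt_def mulmx_ctr_ge0 andbT; apply: contra nzu => /eqP u0.
by apply/eqP/mxtrace_ctr_eq0; rewrite /mxtrace big_ord1.
Qed.

(** By the spectral theorem H = P^* D P with P unitary and D positive diagonal; Q is P^* times the
    square root of D. *)
Lemma gram_decomp n (H : 'M[C]_n) :
    H ^t* = H -> (forall u : 'rV[C]_n, u != 0 -> 0 < (u *m H *m u ^t*) 0 0) ->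
  exists2 Q : 'M[C]_n, Q \in unitmx & H = Q *m Q ^t*.
Proof.
move=> Hherm Hpos; have nH : H \is normalmx by apply/normalmxP; rewrite Hherm.
pose P := spectralmx H; pose D := spectral_diag H.
have Pu : P \is unitarymx by apply: spectral_unitarymx.
have PP : P *m P ^t* = 1%:M by apply/unitarymxP.
have HE : H = P ^t* *m diag_mx D *m P.
  by rewrite -invmx_unitary //; apply/orthomx_spectralP.
have Dpos i : 0 < D 0 i.
  have nzrow : row i P != 0.
    apply/eqP => r0; have := mulmx_ctr_diag P i; rewrite PP mxE eqxx big1.
      by move/eqP; rewrite oner_eq0.
    by move=> j _; have /rowP/(_ j) := r0; rewrite !mxE => ->; rewrite normr0 expr0n.
  have := Hpos _ nzrow; rewrite HE rowE ctrM !mulmxA -(mulmxA _ P) PP mulmx1.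
  rewrite -(mulmxA _ P) PP mulmx1 -rowE trmx_delta map_delta_mx /= -colE !mxE eqxx.
  by rewrite mulr1n.
pose S := diag_mx (\row_i sqrtC (D 0 i)).
have Sherm : S ^t* = S.
  rewrite tr_diag_mx map_diag_mx; congr diag_mx; apply/rowP => i; rewrite !mxE.
  by rewrite /= geC0_conj // sqrtC_ge0 ltW.
have SS : S *m S = diag_mx D.
  rewrite mulmx_diag; congr diag_mx; apply/rowP => i; rewrite !mxE -expr2.
  by rewrite sqrtCK.
exists (P ^t* *m S); last by rewrite ctrM ctrK Sherm !mulmxA -(mulmxA (P ^t* ) S S) SS.
rewrite unitmx_mul unitarymx_unit ?trmxC_unitary //= unitmxE det_diag unitfE.
by apply/prodf_neq0 => i _; rewrite mxE sqrtC_eq0 gt_eqF.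
Qed.

(** The squared Hilbert-Schmidt norm of U - 1 is 2n - tr U - conj (tr U), which is 0 here. *)
Lemma unitary_tr_max n (U : 'M[C]_n) : U \is unitarymx -> \tr U = n%:R -> U = 1%:M.
Proof.
move=> /unitarymxP UU trU; apply/eqP; rewrite -subr_eq0; apply/eqP.
apply: mxtrace_ctr_eq0; rewrite linearB /= map_mxB ctr1 mulmxBl !mulmxBr UU.
rewrite !mul1mx mulmx1 !linearB /= mxtrace1 trU trace_map_mx mxtrace_tr trU.
by rewrite /= conjC_nat !subrr.
Qed.

End ConjugateTranspose.

Section Unitary.

Variables (C : numClosedFieldType) (gT : finGroupType) (G : {group gT}).
Local Notation reprG := (mx_representation C G).

(** The sum H of all r(g) r(g)^* is positive definite and satisfies r(g) H r(g)^* = H; writing H = Q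
    Q^*, conjugation by Q makes r unitary. *)
Lemma unitary_repr n (r : reprG n) :
  exists2 s : reprG n, mx_rsim r s & {in G, forall g, s g \is unitarymx}.
Proof.
pose H := \sum_(g in G) r g *m (r g) ^t*.
have [||Q Qu HE] := @gram_decomp C _ H.
- rewrite /H (linear_sum trmx) /= raddf_sum; apply: eq_bigr => g _.
  by rewrite /= ctrM ctrK.
- move=> u nzu; rewrite /H mulmx_sumr mulmx_suml summxE (bigD1 1%g) //=.
  rewrite repr_mx1 ctr1 !mulmx1 ltr_wpDr ?mulmx_ctr_gt0 // sumr_ge0 // => g _.
  by rewrite mulmxA -mulmxA -ctrM mulmx_ctr_ge0.
have sP : mx_repr G (fun g => invmx Q *m r g *m Q).
  split=> [|g h Gg Gh]; first by rewrite repr_mx1 mulmx1 mulVmx.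
  by rewrite repr_mxM // !mulmxA mulmxK.
exists (MxRepresentation sP).
  exists Q => // [|g Gg]; first by rewrite row_free_unit.
  by rewrite /= !mulmxA mulmxV // mul1mx.
move=> g Gg; apply/unitarymxP => /=.
have rH : r g *m H *m (r g) ^t* = H.
  rewrite /H mulmx_sumr mulmx_suml [RHS](reindex_inj (mulgI g)) /=.
  apply: eq_big => h; first by rewrite groupMl.
  by move=> Gh; rewrite repr_mxM // ctrM !mulmxA.
transitivity (invmx Q *m (r g *m H *m (r g) ^t*) *m (invmx Q) ^t*).
  by rewrite !ctrM HE !mulmxA.
by rewrite rH HE mulmxA mulVmx // mul1mx -ctrM mulVmx // ctr1.
Qed.

Lemma chrV n (r : reprG n) g : g \in G -> chr r g^-1%g = (chr r g)^*.
Proof.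
move=> Gg; have [s sim sU] := unitary_repr r.
rewrite !(chr_rsim sim) ?groupV // /chr repr_mxV // invmx_unitary ?sU //.
by rewrite trace_map_mx mxtrace_tr.
Qed.

Lemma chr_eq_dim n (r : reprG n) g :
  g \in G -> chr r g = n%:R -> r g = 1%:M.
Proof.
move=> Gg; have [s sim sU] := unitary_repr r.
rewrite (chr_rsim sim) // => /(unitary_tr_max (sU g Gg)).
exact: mx_rsim_scalar Gg (mx_rsim_sym sim).
Qed.

Lemma chr_eq_oppdim n (r : reprG n) g :
  g \in G -> chr r g = - n%:R -> r g = - 1%:M.
Proof.
move=> Gg; have [s sim sU] := unitary_repr r.
rewrite (chr_rsim sim) // => trs; rewrite -scaleN1r -mul_scalar_mx mulmx1.
apply: (mx_rsim_scalar Gg (mx_rsim_sym sim)); apply: oppr_inj.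
rewrite -scalemx1 scaleN1r opprK; apply: unitary_tr_max.
  have /unitarymxP sUg := sU g Gg.
  by apply/unitarymxP; rewrite linearN /= map_mxN mulNmx mulmxN opprK.
by rewrite linearN /= -/(chr s g) trs opprK.
Qed.

(** The direct summand cut out by a commuting idempotent, in a basis of its image. The last clause
    carries triviality on the summand back to the ambient matrices. *)
Lemma idem_repr n (r : reprG n) E :
    E *m E = E -> {in G, forall g, E *m r g = r g *m E} ->
  exists k, exists2 s : reprG k, {in G, forall g, chr s g = \tr (r g *m E)} &
    {in G, forall g, s g = 1%:M -> E *m r g = E}.
Proof.
move=> EE Er; move: (mulmx_base E) (mulmx_base_idem EE).
move: (\rank E) (col_base E) (row_base E) => k A B AB BA.
have sP : mx_repr G (fun g => B *m r g *m A).
  split=> [|g h Gg Gh]; first by rewrite repr_mx1 mulmx1.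
  transitivity (B *m r g *m ((A *m B) *m r h *m A)); last by rewrite !mulmxA.
  have EA : E *m A = A by rewrite -AB -mulmxA BA mulmx1.
  by rewrite AB Er // -(mulmxA _ E) EA repr_mxM // !mulmxA.
exists k, (MxRepresentation sP) => g Gg.
  by rewrite /chr /= mxtrace_mulC !mulmxA AB mxtrace_mulC.
move=> /= s1; have: A *m (B *m r g *m A) *m B = E by rewrite s1 mulmx1.
by rewrite !mulmxA AB -mulmxA AB -mulmxA -Er // mulmxA EE.
Qed.

Lemma mulmx_trdelta n (A B : 'M[C]_n) i j k l :
  (A^T *m delta_mx i j *m B) k l = A i k * B j l.
Proof.
rewrite -(mul_delta_mx (0 : 'I_1)) mulmxA -colE -mulmxA -rowE mxE big_ord1.
by rewrite !mxE.
Qed.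

(** The symmetric square for e = false and the alternating square for e = true, realised on matrices
    with M^T = M or M^T = -M under congruence by r(g). In this model, trivial action of g means that
    r(g) preserves every such bilinear form. *)
Lemma square_repr n (r : reprG n) (e : bool) :
  exists k, exists2 s : reprG k,
    {in G, forall g, chr s g = (chr r g ^+ 2 + (-1) ^+ e * chr r (g ^+ 2)%g) / 2} &
    {in G, forall g, s g = 1%:M ->
       forall M, M^T = (-1) ^+ e *: M -> (r g)^T *m M *m r g = M}.
Proof.
pose L g : {linear 'M[C]_n -> 'M[C]_n} := mulmxr (r g) \o mulmx (r g)^T.
pose V g := lin_mx (L g); pose W : 'M[C]_(n * n) := lin_mx trmx.
have mxP (A B : 'M[C]_(n * n)) : (forall M, mxvec M *m A = mxvec M *m B) -> A = B.
  by move=> AB; apply/row_matrixP => i; rewrite !rowE -(vec_mxK (delta_mx 0 i)).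
have mulV g M : mxvec M *m V g = mxvec ((r g)^T *m M *m r g).
  by rewrite mul_rV_lin mxvecK.
have mulW M : mxvec M *m W = mxvec M^T by rewrite mul_rV_lin mxvecK.
have VP : mx_repr G V.
  split=> [|g h Gg Gh]; apply: mxP => M.
    by rewrite mulV repr_mx1 trmx1 mul1mx !mulmx1.
  by rewrite mulmxA !mulV repr_mxM // trmx_mul !mulmxA.
have WV g : W *m V g = V g *m W.
  by apply: mxP => M; rewrite !mulmxA mulW !mulV mulW !trmx_mul trmxK mulmxA.
have WW : W *m W = 1%:M by apply: mxP => M; rewrite mulmxA !mulW trmxK mulmx1.
pose E := 2^-1 *: (1%:M + (-1) ^+ e *: W).
have two : 2^-1 * 2 = 1 :> C by rewrite mulVf // pnatr_eq0.
have EE : E *m E = E.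
  rewrite -scalemxAl -scalemxAr; congr (_ *: _).
  rewrite mulmxDl !mulmxDr !mul1mx mulmx1 -scalemxAl -scalemxAr WW scalerA -expr2 sqrr_sign.
  by rewrite scale1r addrACA [X in _ + X]addrC -mulr2n -scaler_nat scalerA two scale1r.
have EV g : E *m V g = V g *m E.
  by rewrite -scalemxAl -scalemxAr mulmxDl mulmxDr mul1mx mulmx1 -scalemxAl -scalemxAr WV.
have [k [s sE s1]] := @idem_repr _ (MxRepresentation VP) E EE (fun g _ => EV g).
exists k, s => [g Gg|g Gg /(s1 g Gg) /= EVE M Mt]; last first.
  have ME : mxvec M *m E = mxvec M.
    rewrite -scalemxAr mulmxDr mulmx1 -scalemxAr mulW Mt linearZ /= scalerA -expr2.
    by rewrite sqrr_sign scale1r -mulr2n -scaler_nat scalerA two scale1r.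
  by apply: (can_inj mxvecK); rewrite -mulV -{1}ME -mulmxA EVE ME.
rewrite sE //= -scalemxAr linearZ /= mulrC mulmxDr mulmx1 linearD /= -scalemxAr linearZ /=.
congr ((_ + _ * _) * _).
  rewrite mxtrace_lin_mx /chr /mxtrace expr2 big_distrlr /=.
  by apply: eq_bigr => i _; apply: eq_bigr => j _; rewrite mulmx_trdelta.
have -> : V g *m W = lin_mx (trmx \o L g).
  by apply: mxP => M; rewrite mulmxA mulV mulW mul_rV_lin mxvecK.
rewrite mxtrace_lin_mx /chr /mxtrace expgS expg1 repr_mxM //.
apply: eq_bigr => i _; rewrite mxE; apply: eq_bigr => j _.
by rewrite /= mxE mulmx_trdelta.
Qed.

End Unitary.

Section GroupFacts.

Variables (C : numClosedFieldType) (gT : finGroupType) (G : {group gT}).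
Local Notation reprG := (mx_representation C G).
Local Notation irrG := (Irr C G).
Local Notation irrchr i := (chr (irr_repr (i : irrG))).

Lemma chr_prod n1 n2 (r1 : reprG n1) (r2 : reprG n2) g :
  chr (prod_repr r1 r2) g = chr r1 g * chr r2 g.
Proof. exact: mxtrace_prod. Qed.

Lemma irr_degree_gt0 (i : irrG) : (0 < irr_degree i)%N.
Proof. by have /mx_irrP[] := socle_irr i. Qed.

Lemma chr_irr1_neq0 (i : irrG) : irrchr i 1%g != 0.
Proof. by rewrite chr1 pnatr_eq0 -lt0n irr_degree_gt0. Qed.

Lemma chr_inj_mult n1 n2 (r1 : reprG n1) (r2 : reprG n2) :
  {in G, chr r1 =1 chr r2} -> mult r1 =1 mult r2.
Proof.
move=> r12 i; apply/eqP; rewrite -(eqr_nat C) /mult -!cdot_hom.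
by apply/eqP; apply: eq_cdot.
Qed.

Lemma mult_add n1 n2 n3 (r1 : reprG n1) (r2 : reprG n2) (r3 : reprG n3) i :
    {in G, forall g, chr r3 g = chr r1 g + chr r2 g} ->
  mult r3 i = (mult r1 i + mult r2 i)%N.
Proof.
move=> r3E; apply/eqP; rewrite -(eqr_nat C) natrD /mult -!cdot_hom !(cdotC G _ (irrchr i)).
by rewrite -cdotDr; apply/eqP; apply: eq_cdot.
Qed.

Lemma mult_irr (i j : irrG) : mult (irr_repr i) j = (i == j).
Proof. by apply/eqP; rewrite -(eqr_nat C) /mult -cdot_hom cdot_irr. Qed.

Lemma mult_ex n (r : reprG n) : (0 < n)%N -> exists i, (0 < mult r i)%N.
Proof.
move=> n_gt0; apply: contrapT => no; have := chr_mult r (group1 G).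
rewrite big1 => [|i _]; last first.
  by case: (posnP (mult r i)) => [->|gt0]; [rewrite mul0r | case: no; exists i].
by move/eqP; rewrite chr1 pnatr_eq0 -leqn0 leqNgt n_gt0.
Qed.

Lemma hom_row_full n1 n2 (r1 : reprG n1) (r2 : reprG n2) M :
  mx_irreducible r2 -> M \in hom_space r1 r2 -> M != 0 -> row_full M.
Proof.
move=> /mx_irrP[_ irr2] /hom_spaceP homM nzM.
suff: row_full (genmx M) by rewrite /row_full genmxE.
apply: irr2; last by rewrite -mxrank_eq0 genmxE mxrank_eq0.
apply/mxmoduleP => g Gg; rewrite (eqmxMr _ (genmxE M)) genmxE -homM //.
exact: submxMl.
Qed.

Lemma mult_gt0_scalar n (r : reprG n) i g c :
  (0 < mult r i)%N -> g \in G -> r g = c%:M -> irr_repr i g = c%:M.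
Proof.
move=> mri Gg rg; have [M homM nzM] : exists2 M, M \in hom_space r (irr_repr i) & M != 0.
  exists (vpick (hom_space r (irr_repr i))); first exact: memv_pick.
  by rewrite vpick0 -dimv_eq0 -lt0n.
have := hom_row_full (socle_irr i) homM nzM => /row_fullP[N NM].
have /hom_spaceP/(_ g Gg) := homM; rewrite rg mul_scalar_mx => cM.
by rewrite -[LHS]mul1mx -NM -mulmxA -cM -scalemxAr NM scalemx1.
Qed.

Lemma linear_irreducible (r : reprG 1) : mx_irreducible r.
Proof.
apply/mx_irrP; split=> // U _; rewrite -mxrank_eq0 -lt0n /row_full eqn_leq => ->.
by rewrite rank_leq_col.
Qed.

Lemma trivial_mx_repr : mx_repr G (fun _ : gT => 1%:M : 'M[C]_1).
Proof. by split=> // g h _ _; rewrite mulmx1. Qed.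

Lemma trivial_irr : exists i1 : irrG, {in G, forall g, irrchr i1 g = 1}.
Proof.
have [i1 sim] := irr_repr_rsim (linear_irreducible (MxRepresentation trivial_mx_repr)).
by exists i1 => g Gg; rewrite -(chr_rsim sim Gg) /chr mxtrace1.
Qed.

Lemma sum_normC_irr (i : irrG) : \sum_(g in G) `|irrchr i g| ^+ 2 = #|G|%:R.
Proof.
have := cdot_irr i i; rewrite eqxx /cdot => /(congr1 ( *%R #|G|%:R)).
rewrite mulr1 mulrA divff ?cardG_neq0 // mul1r => <-.
by apply: eq_bigr => g Gg; rewrite chrV // normCK mulrC.
Qed.

(** If g <> 1 acted trivially in every irreducible, [sum_irr_chr] would make the sum of the squares
    of the degrees zero. *)
Lemma faithful_of_irr1 n (r : reprG n) :
  {in G, forall g, r g = 1%:M -> forall i : irrG, irr_repr i g = 1%:M} ->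
  {in G, forall g, r g = 1%:M -> g = 1%g}.
Proof.
move=> ker g Gg rg1; apply/eqP; have := sum_irr_chr C Gg.
case: eqP => //= _; rewrite mulr0 => /eqP; rewrite psumr_eq0 => [|i _]; last first.
  by rewrite [chr _ g]/chr (ker g) // chr1 mxtrace1 mulr_ge0 ?ler0n.
move/allP; have [i1 _] := trivial_irr; move/(_ i1); rewrite mem_index_enum => /(_ isT).
by rewrite [chr _ g]/chr (ker g) // mxtrace1 -(chr1 (irr_repr i1)) mulf_eq0 orbb
  (negPf (chr_irr1_neq0 i1)).
Qed.

End GroupFacts.

Section ScalarMatrices.

Variable C : numClosedFieldType.

(** Invariance is tested on J = E_ij + E_ji or E_ij - E_ji, in the form J a = b J with b the inverse
    of a^T. Comparing entries makes a diagonal, then constant on the diagonal, each time with an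
    index outside two given ones; this is where d > 2 enters. Finally b a = 1 on the diagonal gives
    the square 1. *)
Lemma square_invariant_scalar d (a : 'M[C]_d) (e : bool) :
    (2 < d)%N -> a \in unitmx ->
    (forall M, M^T = (-1) ^+ e *: M -> a^T *m M *m a = M) ->
  a = 1%:M \/ a = - 1%:M.
Proof.
move=> d_gt2 ua inv; pose b := invmx a^T.
have utr : a^T \in unitmx by rewrite unitmx_tr.
pose J i j : 'M[C]_d := delta_mx i j + (-1) ^+ e *: delta_mx j i.
have Ja i j : J i j *m a = b *m J i j.
  rewrite -{2}(inv (J i j)) ?mulmxA ?mulVmx ?mul1mx // /J linearD /= linearZ /=.
  by rewrite !trmx_delta scalerDr scalerA -expr2 sqrr_sign scale1r addrC.
have Jl i j k l : (J i j *m a) k l = (k == i)%:R * a j l + (-1) ^+ e * ((k == j)%:R * a i l).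
  rewrite mulmxDl -scalemxAl mxE [X in _ + X]mxE; congr (_ + _ * _).
    by rewrite -(mul_delta_mx (0 : 'I_1)) -mulmxA -rowE mxE big_ord1 !mxE ?eqxx ?andbT.
  by rewrite -(mul_delta_mx (0 : 'I_1)) -mulmxA -rowE mxE big_ord1 !mxE ?eqxx ?andbT.
have Jr i j k l : (b *m J i j) k l = b k i * (j == l)%:R + (-1) ^+ e * (b k j * (i == l)%:R).
  rewrite mulmxDr -scalemxAr mxE [X in _ + X]mxE; congr (_ + _ * _).
    by rewrite -(mul_delta_mx (0 : 'I_1)) mulmxA -colE mxE big_ord1 !mxE ?eqxx /= eq_sym.
  by rewrite -(mul_delta_mx (0 : 'I_1)) mulmxA -colE mxE big_ord1 !mxE ?eqxx /= eq_sym.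
have third i j : exists k : 'I_d, (k != i) && (k != j).
  apply/existsP; apply: contraLR d_gt2; rewrite negb_exists -leqNgt => /forallP all2.
  have sub : [set: 'I_d] \subset [set i; j].
    by apply/fintype.subsetP => k _; have := all2 k; rewrite negb_and !negbK !inE.
  by have := subset_leq_card sub; rewrite cardsT card_ord cards2; case: (_ != _) => /= /leq_trans; apply.
have diag j l : j != l -> a j l = 0.
  move=> jl; have [i /andP[ij il]] := third j l.
  have /matrixP/(_ i l) := Ja i j; rewrite Jl Jr eqxx (negPf ij) (negPf jl) (negPf il).
  by rewrite !(mul0r, mulr0, addr0, mul1r).
have ab i j : i != j -> a j j = b i i.
  move=> ij; have /matrixP/(_ i j) := Ja i j; rewrite Jl Jr !eqxx (negPf ij).
  by rewrite !(mul0r, mulr0, addr0, mul1r, mulr1).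
have abE i : b i i * a i i = 1.
  have /matrixP/(_ i i) := mulVmx utr; rewrite !mxE eqxx (bigD1 i) //= big1 => [|j ji].
    by rewrite addr0 mxE.
  by rewrite mxE diag 1?eq_sym // mulr0.
have aE i j : a i i = a j j.
  by have [k /andP[ki kj]] := third i j; rewrite (ab k) // (ab k).
have d_gt0 : (0 < d)%N by apply: leq_trans d_gt2.
pose i0 := Ordinal d_gt0; have [k /andP[ki _]] := third i0 i0.
have : (a i0 i0) ^+ 2 == 1 by rewrite expr2 {1}(ab k) // (aE i0 k) abE.
rewrite sqrf_eq1 => c1; have aS : a = (a i0 i0)%:M.
  apply/matrixP => i j; rewrite [RHS]mxE; have [<-|ij] := eqVneq i j; first exact: aE.
  by rewrite diag.
case/orP: c1 => /eqP c1; [left | right]; rewrite aS c1 //.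
by rewrite -scaleN1r scalemx1.
Qed.

End ScalarMatrices.

(** * Representations whose McKay graph is a tree *)

Section McKayTree.

Variables (C : numClosedFieldType) (gT : finGroupType) (G : {group gT}).
Variables (d : nat) (rho : mx_representation C G d).
Hypothesis d_gt0 : (0 < d)%N.
Hypothesis tree_rho : is_tree (mckay rho).

Local Notation reprG := (mx_representation C G).
Local Notation irrG := (Irr C G).
Local Notation irrchr i := (chr (irr_repr (i : irrG))).
Local Notation a := (mckay rho).
Local Notation chi := (chr rho).

Lemma mckayE (i j : irrG) : a i j = mult (prod_repr (irr_repr i) rho) j.
Proof. by []. Qed.

Lemma chr_mckay (i : irrG) :
  {in G, forall g, irrchr i g * chi g = \sum_j (a i j)%:R * irrchr j g}.
Proof. by move=> g Gg; rewrite -chr_prod chr_mult. Qed.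

Lemma mckay_nbr (i : irrG) : exists j, (0 < a i j)%N.
Proof. by apply: mult_ex; rewrite muln_gt0 irr_degree_gt0. Qed.

Lemma mckay_eq1 i j : (0 < a i j)%N -> a i j = 1%N.
Proof. by move=> aij; apply/eqP; rewrite eqn_leq aij (tree_simple tree_rho). Qed.

Lemma mckay_leaf (l p : irrG) : (forall w, (0 < a l w)%N -> w = p) ->
  {in G, forall g, irrchr l g * chi g = irrchr p g}.
Proof.
move=> leaf g Gg; rewrite chr_mckay // (bigD1 p) //= big1 ?addr0 => [|j jp].
  have [j alj] := mckay_nbr l.
  by rewrite mckay_eq1 ?mul1r // -(leaf j alj).
have [->|/leaf jp'] := posnP (a l j); first by rewrite mul0r.
by rewrite jp' eqxx in jp.
Qed.

Lemma chr_eq_sign n (r : reprG n) g (b : bool) :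
  g \in G -> chr r g = (-1) ^+ b * n%:R -> r g = ((-1) ^+ b)%:M.
Proof.
case: b => Gg; rewrite ?expr0 ?expr1 ?mul1r ?mulN1r; last exact: chr_eq_dim.
by move/(chr_eq_oppdim Gg) => ->; rewrite -scaleN1r scalemx1.
Qed.

(** Propagation along an edge: with c = false it yields faithfulness of rho, with c = true the sign
    by which z acts at each vertex. *)
Lemma mckay_scalar (i j : irrG) g (b c : bool) : (0 < a i j)%N -> g \in G ->
    irr_repr i g = ((-1) ^+ b)%:M -> rho g = ((-1) ^+ c)%:M ->
  irr_repr j g = ((-1) ^+ (b (+) c))%:M.
Proof.
move=> aij Gg ig rg; apply: (mult_gt0_scalar aij Gg); apply: chr_eq_sign => //.
transitivity (irrchr i g * chi g); first exact: chr_prod.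
by rewrite /chr ig rg !mxtrace_scalar signr_addb natrM mulrACA !mulr_natr.
Qed.

Lemma mckay_faithful : {in G, forall g, rho g = 1%:M -> g = 1%g}.
Proof.
apply: faithful_of_irr1 => g Gg rg1.
have [i1 i1E] := trivial_irr C G.
have i1g : irr_repr i1 g = 1%:M.
  by apply: chr_eq_dim => //; rewrite -(chr1 (irr_repr i1)) !i1E.
move=> i; have [_ conn _] := tree_rho.
have /connectP[p pathp ->] := conn i1 i.
elim: p (i1) i1g pathp => //= j p IHp k kg /andP[akj pathp].
by apply: IHp pathp; apply: (mckay_scalar (b := false) (c := false) akj Gg).
Qed.

Lemma mckay_pendant : exists l p m : irrG,
  [/\ (0 < a l p)%N, forall w, (0 < a l w)%N -> w = p &
    forall w, (0 < a p w)%N -> w != m -> forall u, (0 < a w u)%N -> u = p].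
Proof.
have [i1 _] := trivial_irr C G; have [j ai1j] := mckay_nbr i1.
apply: (@acyclic_pendant _ (fun x y => 0 < a x y)%N) ai1j.
- by move=> x y; rewrite (tree_sym tree_rho).
- by move=> x; rewrite (tree_loop tree_rho).
- exact: tree_acyclic tree_rho.
Qed.

(** A proper submodule would split l rho into two nonzero parts, each containing p, and the edge
    from l to p would be multiple. *)
Lemma mckay_irreducible : mx_irreducible rho.
Proof.
have [l [p [m [alp leaf _]]]] := mckay_pendant.
apply: contrapT => nirr.
have [U [modU nzU nfullU]] : exists U : 'M[C]_d, [/\ mxmodule rho U, U != 0 & ~~ row_full U].
  apply: contrapT => noU; apply: nirr; apply/mx_irrP; split=> // U modU nzU.
  by apply: contraT => nfU; case: noU; exists U.
have ltU : (\rank U < d)%N by rewrite ltn_neqAle rank_leq_row andbT.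
pose r1 := prod_repr (irr_repr l) (submod_repr modU).
pose r2 := prod_repr (irr_repr l) (factmod_repr modU).
have [k1 mk1] : exists i, (0 < mult r1 i)%N.
  by apply: mult_ex; rewrite muln_gt0 irr_degree_gt0 lt0n mxrank_eq0.
have [k2 mk2] : exists i, (0 < mult r2 i)%N.
  by apply: mult_ex; rewrite muln_gt0 irr_degree_gt0 mxrank_coker subn_gt0.
have sumE i : a l i = (mult r1 i + mult r2 i)%N.
  apply: mult_add => g Gg; rewrite !chr_prod -mulrDr; congr (_ * _).
  by rewrite /chr -(mxtrace_sub_fact_mod modU).
have k1p : k1 = p by apply: leaf; rewrite sumE ltn_addr.
have k2p : k2 = p by apply: leaf; rewrite sumE ltn_addl.
have := tree_simple tree_rho l p; rewrite sumE -{1}k1p -k2p leqNgt -addn1.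
by rewrite leq_add.
Qed.

Lemma mckay_self : exists r : irrG, mx_rsim rho (irr_repr r).
Proof. exact: irr_repr_rsim mckay_irreducible. Qed.

(** The trivial vertex has one edge to rho; by symmetry there is one edge back, so rho^2 contains
    the trivial representation once. *)
Lemma mckay_square_sum : \sum_(g in G) chi g ^+ 2 = #|G|%:R.
Proof.
have [r sim] := mckay_self; have [i1 i1E] := trivial_irr C G.
have chiE : {in G, chi =1 irrchr r} := chr_rsim sim.
have ai1 i : a i1 i = (r == i) :> nat.
  rewrite -mult_irr mckayE; apply: chr_inj_mult => g Gg.
  by rewrite chr_prod i1E // mul1r chiE.
have := ai1 r; rewrite eqxx (tree_sym tree_rho) mckayE /mult.
move/(congr1 (fun n => n%:R : C)); rewrite -cdot_hom /cdot => /(congr1 ( *%R #|G|%:R)).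
rewrite mulr1 mulrA divff ?cardG_neq0 // mul1r => <-.
rewrite [RHS](reindex_inj invg_inj) /=; apply: eq_big => g; rewrite ?groupV // => Gg.
by rewrite invgK chr_prod -chiE // i1E ?groupV // mulr1.
Qed.

Lemma mckay_norm_sum : \sum_(g in G) `|chi g| ^+ 2 = #|G|%:R.
Proof.
have [r sim] := mckay_self; rewrite -(sum_normC_irr r).
by apply: eq_bigr => g Gg; rewrite (chr_rsim sim).
Qed.

(** The sum of chi^2 and the sum of |chi|^2 are both |G|, so the sum of |chi - conj chi|^2
    vanishes. *)
Lemma mckay_real : {in G, forall g, (chi g)^* = chi g}.
Proof.
suff : \sum_(g in G) `|chi g - (chi g)^*| ^+ 2 = 0.
  move/psumr_eq0P => z g Gg; apply/eqP; rewrite eq_sym -subr_eq0 -normr_eq0 -sqrf_eq0.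
  by rewrite z // => h _; rewrite exprn_ge0.
transitivity (\sum_(g in G) (`|chi g| ^+ 2 + `|chi g| ^+ 2 - (chi g ^+ 2 + (chi g ^+ 2)^*))).
  apply: eq_bigr => g _; rewrite !normCK rmorphB /= conjCK rmorphXn /=.
  by ring.
rewrite sumrB !big_split /= mckay_norm_sum -rmorph_sum /= mckay_square_sum.
by rewrite conjC_nat subrr.
Qed.

Lemma mckay_minus1 : exists2 z, z \in G & rho z = - 1%:M.
Proof.
have [i1 i1E] := trivial_irr C G.
have [|||c cP] := @acyclic_coloring _ (fun x y : irrG => 0 < a x y)%N.
- by move=> x y; rewrite (tree_sym tree_rho).
- by move=> x; rewrite (tree_loop tree_rho).
- exact: tree_acyclic tree_rho.
(* Degrees with signs alternating along the edges: an eigenvector of the adjacency matrix with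
   eigenvalue -d. *)
pose w (i : irrG) : C := (-1) ^+ (c i) * (irr_degree i)%:R.
pose theta g := \sum_i w i * irrchr i g.
have thetaE : {in G, forall g, theta g * chi g = - d%:R * theta g}.
  move=> g Gg; rewrite /theta mulr_suml mulr_sumr.
  under eq_bigr => i _ do rewrite -mulrA chr_mckay // mulr_sumr.
  rewrite exchange_big; apply: eq_bigr => j _ /=.
  under eq_bigr => i _ do rewrite mulrA.
  rewrite -mulr_suml mulrA; congr (_ * _).
  have := chr_mckay j (group1 G); rewrite !chr1 => /(congr1 ( *%R (- (-1) ^+ (c j)))).
  rewrite mulr_sumr /w => E; transitivity (- (-1) ^+ c j * ((irr_degree j)%:R * d%:R) : C).
    rewrite E; apply: eq_bigr => i _; rewrite chr1 (tree_sym tree_rho i).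
    have [->|aji] := posnP (a j i); first by rewrite mulr0 !mul0r mulr0.
    have := cP _ _ aji; case: (c j) (c i) => [] [] //= _; ring.
  ring.
(* [theta] is not identically zero, since its inner product with the trivial character is the weight
   of the trivial vertex. *)
have [z Gz nz] : exists2 z, z \in G & theta z != 0.
  apply: contrapT => no; have : cdot G (irrchr i1) theta = 0.
    rewrite /cdot big1 ?mulr0 // => g Gg; apply/eqP; rewrite mulf_eq0; apply/orP; right.
    by apply: contraT => nz; case: no; exists g.
  rewrite cdot_sumr (bigD1 i1) //= big1 => [|j ji1].
    rewrite cdot_irr eqxx mulr1 addr0 /w => /eqP; rewrite mulf_eq0 signr_eq0 /=.
    by rewrite pnatr_eq0 -leqn0 leqNgt irr_degree_gt0.
  by rewrite cdot_irr eq_sym (negPf ji1) mulr0.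
exists z => //; apply: chr_eq_oppdim => //; apply: (mulfI nz).
by rewrite thetaE // mulrC.
Qed.

Section MinusOne.

Variable z : gT.
Hypothesis Gz : z \in G.
Hypothesis rho_z : rho z = - 1%:M.

Lemma rho_zE : rho z = ((-1) ^+ true)%:M.
Proof. by rewrite rho_z expr1 -scaleN1r scalemx1. Qed.

Lemma z_neq1 : z != 1%g.
Proof.
apply/eqP => z1; have := rho_z; rewrite z1 repr_mx1 => /(congr1 mxtrace).
rewrite linearN /= mxtrace1 => /eqP; rewrite -addr_eq0 -natrD pnatr_eq0 addn_eq0.
by rewrite andbb -leqn0 leqNgt d_gt0.
Qed.

Lemma zz1 : (z * z = 1)%g.
Proof.
by apply: mckay_faithful; rewrite ?groupM // repr_mxM // rho_z mulNmx mulmxN opprK mulmx1.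
Qed.

Lemma mckay_pm1 g : g \in G -> rho g = 1%:M \/ rho g = - 1%:M -> g = 1%g \/ g = z.
Proof.
move=> Gg [/(mckay_faithful Gg)|rg]; [by left|right].
apply: (mulIg z); rewrite zz1; apply: mckay_faithful; rewrite ?groupM // repr_mxM // rg rho_z.
by rewrite mulNmx mulmxN opprK mulmx1.
Qed.

Lemma irr_sign : exists s : irrG -> bool,
  (forall i, irr_repr i z = ((-1) ^+ (s i))%:M) /\
  (forall i j, (0 < a i j)%N -> s j = ~~ s i).
Proof.
have [i1 i1E] := trivial_irr C G; have [_ conn _] := tree_rho.
have /boolp.choice[s sE] : forall i : irrG, exists b : bool, irr_repr i z = ((-1) ^+ b)%:M.
  move=> i.
  have : irr_repr i1 z = ((-1) ^+ false)%:M.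
    by apply: chr_eq_sign => //; rewrite -(chr1 (irr_repr i1)) !i1E // mul1r.
  have /connectP[p pathp ->] := conn i1 i.
  elim: p (i1) (false) pathp => [|j p IHp] k b /=; first by exists b.
  by case/andP=> akj pathp kz; apply: IHp pathp (mckay_scalar akj Gz kz rho_zE).
exists s; split=> // i j aij; have := mckay_scalar aij Gz (sE i) rho_zE.
rewrite sE addbT => /(congr1 mxtrace)/eqP; rewrite !mxtrace_scalar.
have n_neq0 : (irr_degree j)%:R != 0 :> C by rewrite pnatr_eq0 -lt0n irr_degree_gt0.
rewrite -[X in X == _]mulr_natr -[X in _ == X]mulr_natr (inj_eq (mulIf n_neq0)).
by move/eqP/signr_inj.
Qed.

(** By [sum_irr_chr] at 1 and at z, the squared degrees of the irreducibles having the sign of p add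
    up to |G|/2, which p alone exhausts. *)
Lemma irr_half (s : irrG -> bool) (p : irrG) :
    (forall i, irr_repr i z = ((-1) ^+ (s i))%:M) ->
    (2 * irr_degree p ^ 2)%N = #|G| -> forall i, s i = s p -> i = p.
Proof.
move=> sE pG i sip; apply/eqP; apply: contraT => ip.
have sum1 := sum_irr_chr C (group1 G); have sumz := sum_irr_chr C Gz.
rewrite eqxx mulr1 in sum1; rewrite (negPf z_neq1) mulr0 in sumz.
have pos (j : irrG) : 0 <= (1 + (-1) ^+ (s j (+) s p)) * (irr_degree j)%:R ^+ 2 :> C.
  by apply: mulr_ge0; rewrite ?exprn_ge0 ?ler0n //; case: (_ (+) _); rewrite ?expr1 ?subrr // addr_ge0.
have : \sum_j (1 + (-1) ^+ (s j (+) s p)) * (irr_degree j)%:R ^+ 2 = #|G|%:R :> C.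
  transitivity (\sum_j irrchr j 1%g * irrchr j 1%g
                + (-1) ^+ s p * (\sum_j irrchr j 1%g * irrchr j z)); last first.
    by rewrite sum1 sumz mulr0 addr0.
  rewrite mulr_sumr -big_split /=.
  apply: eq_bigr => j _; have -> : irrchr j z = (-1) ^+ s j * (irr_degree j)%:R.
    by rewrite /chr sE mxtrace_scalar mulr_natr.
  rewrite !chr1 signr_addb.
  by move: (_%:R) (_ ^+ s j) (_ ^+ s p) => x u v; ring.
rewrite (bigD1 p) // (bigD1 i) //= sip addbb expr0 -pG natrM natrX mulr2n.
move/eqP; rewrite -subr_eq0 addrAC subrr add0r paddr_eq0; first last.
- by apply: sumr_ge0 => k _; apply: pos.
- by rewrite mulr_ge0 ?exprn_ge0 ?ler0n // addr_ge0.
rewrite -(mulr2n 1) mulf_eq0 expf_eq0 /= !pnatr_eq0 /= => /andP[].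
by rewrite -leqn0 leqNgt irr_degree_gt0.
Qed.

Lemma pendant_support (l p m : irrG) g : (2 < d)%N ->
    (0 < a l p)%N -> (forall w, (0 < a l w)%N -> w = p) ->
    (forall w, (0 < a p w)%N -> w != m -> forall u, (0 < a w u)%N -> u = p) ->
    g \in G -> irrchr p g != 0 ->
  g = 1%g \/ g = z.
Proof.
move=> d_gt2 alp leafl pend Gg pg; have lE := mckay_leaf leafl.
have lg : irrchr l g != 0 /\ chi g != 0.
  by move: pg; rewrite -lE // mulf_eq0 negb_or => /andP[].
case: lg => lg chig.
(* Where p is nonzero, a constituent w of l s is a leaf at p and takes the value of l, because w chi
   = p = l chi. Dividing by l, the character of s has there the constant value N, the number of
   constituents of l s; and 1 is one of these points. *)
have key k (s : reprG k) :
    (forall w, (mult (prod_repr (irr_repr l) s) w <= a p w)%N) ->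
    mult (prod_repr (irr_repr l) s) m = 0%N -> s g = 1%:M.
  move=> le_s s_m; pose N : C := \sum_w (mult (prod_repr (irr_repr l) s) w)%:R.
  have sN h : h \in G -> irrchr l h != 0 -> chi h != 0 -> chr s h = N.
    move=> Gh lh chih; apply: (mulfI lh); rewrite -chr_prod chr_mult // mulrC mulr_suml.
    apply: eq_bigr => w _.
    have [->|mw] := posnP (mult (prod_repr (irr_repr l) s) w); first by rewrite !mul0r.
    have apw : (0 < a p w)%N := leq_trans mw (le_s w).
    have wm : w != m by apply: contraTneq mw => ->; rewrite s_m.
    have wE := mckay_leaf (pend w apw wm); congr (_ * _).
    by apply: (mulIf chih); rewrite wE // lE.
  apply: chr_eq_dim => //; rewrite sN // -(chr1 s) sN ?chr_irr1_neq0 //.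
  by rewrite chr1 pnatr_eq0 -lt0n.
have [k0 [s0 E0 S0]] := square_repr rho false.
have [k1 [s1 E1 S1]] := square_repr rho true.
have sumE w : a p w = (mult (prod_repr (irr_repr l) s0) w
                       + mult (prod_repr (irr_repr l) s1) w)%N.
  apply: mult_add => h Gh; rewrite !chr_prod E0 // E1 // -lE // expr0 expr1.
  have two : 2 != 0 :> C by rewrite pnatr_eq0.
  by field.
have chi_unit : rho g \in unitmx by apply: repr_mx_unit.
apply: mckay_pm1 => //.
(* The edge from p to m is at most simple, so m occurs in the product of l with at most one of the
   two squares. *)
have [m0|m0] := posnP (mult (prod_repr (irr_repr l) s0) m).
  apply: (square_invariant_scalar d_gt2 chi_unit) (S0 g Gg (key _ s0 _ m0)) => w.
  by rewrite sumE leq_addr.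
have m1 : mult (prod_repr (irr_repr l) s1) m = 0%N.
  have := tree_simple tree_rho p m; rewrite sumE => le1; apply/eqP; rewrite -leqn0.
  by rewrite -ltnS (leq_trans _ le1) // -addn1 addnC leq_add2r.
apply: (square_invariant_scalar d_gt2 chi_unit) (S1 g Gg (key _ s1 _ m1)) => w.
by rewrite sumE leq_addl.
Qed.

Lemma mckay_order : (2 < d)%N -> #|G| = (2 * d ^ 2)%N.
Proof.
move=> d_gt2; have [l [p [m [alp leafl pend]]]] := mckay_pendant.
have lE := mckay_leaf leafl.
have [s [sE sa]] := irr_sign; have [i1 i1E] := trivial_irr C G.
have pG : (2 * irr_degree p ^ 2)%N = #|G|.
  apply/eqP; rewrite -(eqr_nat C) -(sum_normC_irr p) (bigD1 1%g) //= (bigD1 z) /=; last first.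
    by rewrite Gz z_neq1.
  rewrite big1 => [|g /andP[/andP[Gg g1] gz]]; last first.
    have [->|/(pendant_support d_gt2 alp leafl pend Gg)[]] := eqVneq (irrchr p g) 0.
    - by rewrite normr0 expr0n.
    - by move=> gE; rewrite gE eqxx in g1.
    by move=> gE; rewrite gE eqxx in gz.
  have -> : irrchr p z = (-1) ^+ s p * (irr_degree p)%:R.
    by rewrite /chr sE mxtrace_scalar mulr_natr.
  by rewrite addr0 chr1 normrM normr_sign mul1r normr_nat -natrX -natrD mul2n addnn.
have uniq_p := irr_half sE pG.
(* Every vertex other than p has the sign opposite to p, so its neighbours have the sign of p: the
   graph is a star with centre p. The trivial vertex is a leaf of it, whence p(1) = d. *)
have nbr i : i != p -> forall w, (0 < a i w)%N -> w = p.
  move=> ip w aiw; apply: (uniq_p w); rewrite (sa _ _ aiw).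
  by case: (s i =P s p) => [/uniq_p pE|]; [rewrite pE eqxx in ip | case: (s i) (s p) => [] []].
have [i1p|i1p] := eqVneq i1 p.
  have := lE _ (group1 G); rewrite -i1p i1E // !chr1 -natrM => /eqP.
  rewrite pnatr_eq1 muln_eq1 => /andP[_ /eqP d1]; by rewrite d1 in d_gt2.
have [r sim] := mckay_self; have := mckay_leaf (nbr _ i1p) (group1 G).
rewrite i1E // mul1r !chr1 => /eqP; rewrite eqr_nat => /eqP ->.
by rewrite pG.
Qed.

(** The character is real, so it agrees at g and its inverse, and c is its own inverse. *)
Lemma mckay_scalar_pm g c : g \in G -> rho g = c%:M -> g = 1%g \/ g = z.
Proof.
move=> Gg rg; apply: mckay_pm1 => //.
have := mckay_real Gg; rewrite -chrV // /chr repr_mxV // rg invmx_scalar !mxtrace_scalar.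
have d_neq0 : d%:R != 0 :> C by rewrite pnatr_eq0 -lt0n.
rewrite -[X in X = _]mulr_natr -[X in _ = X]mulr_natr => /(mulIf d_neq0) cV.
have c_neq0 : c != 0.
  apply: contraTneq (repr_mx_unit rho Gg) => c0; rewrite rg c0 unitmxE det_scalar expr0n.
  by rewrite -[d == 0%N]negbK -lt0n d_gt0 unitr0.
have : c ^+ 2 == 1 by rewrite expr2 -{1}cV mulVf.
rewrite sqrf_eq1 => /orP[] /eqP->; [by left | right].
by rewrite -scaleN1r scalemx1.
Qed.

Lemma center_mckay : 'Z(G)%g = [set 1%g; z].
Proof.
apply/setP => g; rewrite in_set2; apply/idP/idP.
  case/setIP=> Gg /centP cg.
  have /is_scalar_mxP[c rg] : is_scalar_mx (rho g).
    apply: (irr_cent_scalar mckay_irreducible) => h Gh.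
    by rewrite -!repr_mxM // cg.
  by have [->|->] := mckay_scalar_pm Gg rg; rewrite eqxx ?orbT.
case/orP=> /eqP->; first exact: group1.
apply/setIP; split=> //; apply/centP => h Gh; apply/commgP/eqP.
have Gc : [~ z, h]%g \in G by rewrite groupR.
apply: mckay_faithful => //; have := congr1 rho (commgC z h).
rewrite (repr_mxM rho Gz Gh) (repr_mxM rho (groupM Gh Gz) Gc) (repr_mxM rho Gh Gz) rho_z.
rewrite mulNmx mul1mx mulmxN mulmx1 mulNmx => /oppr_inj hE.
by apply: (can_inj (mulKmx (repr_mx_unit rho Gh))); rewrite -hE mulmx1.
Qed.

Lemma mckay_order1 : d = 1%N -> #|G| = (2 * d ^ 2)%N.
Proof.
move=> d1; have -> : (G : {set gT}) = [set 1%g; z].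
  apply/setP => g; rewrite in_set2; apply/idP/idP => [Gg|].
    have [c rg] : exists c, rho g = c%:M.
      by move: (rho g); rewrite d1 => A; exists (A 0 0); apply: mx11_scalar.
    by have [->|->] := mckay_scalar_pm Gg rg; rewrite eqxx ?orbT.
  by case/orP=> /eqP->.
by rewrite cards2 eq_sym z_neq1 d1.
Qed.

Section ExtraSpecial.

Hypothesis oG : #|G| = (2 * d ^ 2)%N.

(** The squares |chi|^2 sum to |G| = 2 d^2, and 1 and z already contribute 2 d^2. *)
Lemma mckay_support g : g \in G -> chi g != 0 -> g = 1%g \/ g = z.
Proof.
move=> Gg chig; have [->|g1] := eqVneq g 1%g; first by left.
have [->|gz] := eqVneq g z; first by right.
have := mckay_norm_sum; rewrite (bigD1 1%g) //= (bigD1 z) /=; last by rewrite Gz z_neq1.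
rewrite (bigD1 g) /= ?Gg ?g1 //.
have -> : chi z = - d%:R by rewrite /chr rho_z linearN /= mxtrace1.
rewrite chr1 normrN normr_nat -natrX [LHS]addrA -natrD addnn -mul2n oG.
move/eqP; rewrite -subr_eq0 addrAC subrr add0r paddr_eq0 ?exprn_ge0 //; last first.
  by apply: sumr_ge0 => h _; rewrite exprn_ge0.
by rewrite sqrf_eq0 normr_eq0 (negPf chig).
Qed.

(** As chi lives on 1 and z, the multiplicity of k in rho^2 is (d^2 k(1) + d^2 k(z)) / (2 d^2) =
    k(1), and in a tree it is 1. *)
Lemma mckay_nbr_linear (r k : irrG) :
  mx_rsim rho (irr_repr r) -> (0 < a r k)%N -> irr_degree k = 1%N.
Proof.
move=> sim ark; have [s [sE sa]] := irr_sign.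
have chiE : {in G, chi =1 irrchr r} := chr_rsim sim.
have chiz : chi z = - d%:R by rewrite /chr rho_z linearN /= mxtrace1.
have kz : irrchr k z = (irr_degree k)%:R.
  have d_neq0 : d%:R != 0 :> C by rewrite pnatr_eq0 -lt0n.
  have sr : s r = true.
    have := chiE z Gz; rewrite chiz {1}/chr sE mxtrace_scalar -mulr_natr -[irr_degree r](mxrank_rsim sim).
    case: (s r) => //; rewrite expr0 mul1r => /eqP; rewrite eq_sym -addr_eq0 -natrD pnatr_eq0.
    by rewrite addn_eq0 andbb -leqn0 leqNgt d_gt0.
  by rewrite /chr sE (sa _ _ ark) sr mxtrace_scalar.
have : (a r k)%:R = (irr_degree k)%:R :> C.
  rewrite mckayE /mult -cdot_hom /cdot (bigD1 1%g) //= (bigD1 z) /=; last first.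
    by rewrite Gz z_neq1.
  rewrite big1 => [|g /andP[/andP[Gg g1] gz]]; last first.
    have [chi0|/mckay_support[]] := eqVneq (chi g^-1%g) 0.
    - by rewrite chr_prod chi0 mulr0 mul0r.
    - exact: groupVr.
    - by move/(canRL invgK); rewrite invg1 => gE; rewrite gE eqxx in g1.
    move/(canRL invgK) => gE; case/eqP: gz; rewrite gE.
    by apply: (mulgI z); rewrite mulgV zz1.
  have zV : z^-1%g = z by apply: (mulgI z); rewrite mulgV zz1.
  rewrite invg1 zV !chr_prod -!chiE // kz chiz !chr1 oG natrM natrX addr0.
  have d_neq0 : d%:R != 0 :> C by rewrite pnatr_eq0 -lt0n.
  have two : 2 != 0 :> C by rewrite pnatr_eq0.
  by field; rewrite d_neq0.
move/eqP; rewrite eqr_nat mckay_eq1 // => /eqP <-; by [].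
Qed.

(** The constituents of rho^2 have degree 1, so chi^2 has the value d^2 at a commutator, which
    therefore lies in the support of chi. *)
Lemma mckay_commutator g h : g \in G -> h \in G -> [~ g, h]%g \in 'Z(G)%g.
Proof.
move=> Gg Gh; have Gc : [~ g, h]%g \in G by rewrite groupR.
have [r sim] := mckay_self; have chiE : {in G, chi =1 irrchr r} := chr_rsim sim.
have lin n (s : reprG n) : n = 1%N -> s [~ g, h]%g = 1%:M.
  move=> n1; have comm : s g *m s h = s h *m s g.
    move: (s g) (s h); rewrite n1 => A B.
    by rewrite (mx11_scalar A) (mx11_scalar B) -!scalar_mxM mulrC.
  have := congr1 s (commgC g h); rewrite (repr_mxM s Gg Gh).
  rewrite (repr_mxM s (groupM Gh Gg) Gc) (repr_mxM s Gh Gg) comm => sc.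
  have u : s h *m s g \in unitmx by rewrite unitmx_mul !repr_mx_unit.
  by apply: (can_inj (mulKmx u)); rewrite -sc mulmx1.
have /mckay_support : chi [~ g, h]%g != 0.
  have /eqP : chi [~ g, h]%g ^+ 2 = d%:R ^+ 2.
    rewrite !expr2 {1}chiE // chr_mckay // -{1}(chr1 rho) chiE // -(chr1 rho) chr_mckay //.
    apply: eq_bigr => k _; have [->|ark] := posnP (a r k); first by rewrite !mul0r.
    by rewrite chr1 /chr lin ?mxtrace1 // (mckay_nbr_linear sim).
  apply: contraTneq => ->; rewrite expr0n eq_sym expf_eq0 /= pnatr_eq0.
  by rewrite -lt0n.
by rewrite center_mckay in_set2 => /(_ Gc)[] ->; rewrite eqxx ?orbT.
Qed.

End ExtraSpecial.
End MinusOne.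
End McKayTree.

(** * The extra special case *)

Section ExtraSpecialConclusion.

Variables (C : numClosedFieldType) (gT : finGroupType) (G : {group gT}).
Variables (d : nat) (rho : mx_representation C G d).
Hypothesis d_gt0 : (0 < d)%N.
Hypothesis tree_rho : is_tree (mckay rho).

Lemma mckay_extra_special : #|G| = (2 * d ^ 2)%N ->
  exists n : nat, [/\ extra_special_2group G, #|G| = (2 ^ (1 + 2 * n))%N,
    d = (2 ^ n)%N & unique_center_nontrivial_irr rho].
Proof.
move=> oG; have [z Gz rho_z] := mckay_minus1 tree_rho.
have ZE := center_mckay d_gt0 tree_rho Gz rho_z.
have z1 := z_neq1 d_gt0 rho_z.
have oZ : #|'Z(G)%g| = 2 by rewrite ZE cards2 eq_sym z1.
have nZ : normal 'Z(G)%g G by apply: center_normal.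
have abG : (2.-abelem (G / 'Z(G)))%g.
  apply/abelemP => //; split.
    rewrite sub_der1_abelian // gen_subG; apply/fintype.subsetP => _ /imset2P[g h Gg Gh ->].
    exact: (mckay_commutator d_gt0 tree_rho Gz rho_z oG).
  (* The quotient has exponent 2: commutators are central with square 1, so [g^2, h] = [g, h]^2 =
     1. *)
  move=> _ /morphimP[g Ng Gg ->]; rewrite -morphX //; apply: coset_id.
  apply/setIP; split; first by rewrite groupX.
  apply/centP => h Gh; apply/commgP; rewrite commXg.
    have : [~ g, h]%g \in 'Z(G)%g by apply: (mckay_commutator d_gt0 tree_rho Gz rho_z oG).
    rewrite ZE in_set2 => /orP[] /eqP->; rewrite ?expg1n //.
    by rewrite expgS expg1 (zz1 tree_rho Gz rho_z).
  have /setIP[Gc /centP cc] : [~ g, h]%g \in 'Z(G)%g.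
    exact: (mckay_commutator d_gt0 tree_rho Gz rho_z oG).
  by apply/commute_sym/cc.
have oQ : #|(G / 'Z(G))%g| = (d ^ 2)%N.
  by rewrite card_quotient ?normal_norm // -divgS ?center_sub // oZ oG mulKn.
have [N oN] : exists N, (d ^ 2 = 2 ^ N)%N.
  by have := abelem_pgroup abG; rewrite /pgroup oQ => /p_natP[N oN]; exists N.
have /(dvdn_pfactor d N (isT : prime 2))[n _ dE] : (d %| 2 ^ N)%N.
  by rewrite -oN expnS dvdn_mulr.
exists n; split=> //.
- split; last first.
    exists N; rewrite (isog_abelem_card _ abG) oQ oN.
    by rewrite (@mx_Fp_abelem 2 1 N) // cardsT card_mx card_ord mul1n eqxx.
  have cZ : cyclic 'Z(G)%g by rewrite prime_cyclic ?oZ.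
  have cT : cyclic [set: 'Z_2] by rewrite prime_cyclic ?cardsT ?card_ord.
  by rewrite isog_cyclic_card // cT cardsT card_ord oZ.
- by rewrite oG dE -expnM expnD expn1 (mulnC n).
split; first exact: mckay_irreducible.
  exists z; first by rewrite ZE !inE eqxx orbT.
  rewrite rho_z; apply/eqP => /(congr1 mxtrace); rewrite linearN /= mxtrace1 => /eqP.
  by rewrite eq_sym -addr_eq0 -natrD pnatr_eq0 addn_eq0 andbb -leqn0 leqNgt d_gt0.
move=> d' rho' irr' [x]; rewrite ZE in_set2 => /orP[] /eqP-> nt.
  by rewrite repr_mx1 eqxx in nt.
have [r sim] := mckay_self d_gt0 tree_rho.
have [j sim'] := irr_repr_rsim irr'.
have [s [sE _]] := irr_sign tree_rho Gz rho_z.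
have neg k (t : mx_representation C G k) (i : Irr C G) :
    mx_rsim t (irr_repr i) -> t z != 1%:M -> s i = true.
  move=> simt; case si : (s i) => //; case/eqP.
  have := sE i; rewrite si expr0 => iz.
  exact: mx_rsim_scalar Gz (mx_rsim_sym simt) iz.
have rr : rho z != 1%:M.
  rewrite rho_z; apply/eqP => /(congr1 mxtrace); rewrite linearN /= mxtrace1 => /eqP.
  by rewrite eq_sym -addr_eq0 -natrD pnatr_eq0 addn_eq0 andbb -leqn0 leqNgt d_gt0.
(* The irreducibles on which z acts as -1 have squared degrees adding up to |G|/2 = d^2, so rho is
   the only one. *)
have jr : j = r.
  apply: (irr_half d_gt0 Gz rho_z sE); last by rewrite (neg _ _ _ sim' nt) (neg _ _ _ sim rr).
  by rewrite oG -(mxrank_rsim sim).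
by apply: mx_rsim_trans sim' _; rewrite jr; apply: mx_rsim_sym.
Qed.

End ExtraSpecialConclusion.

(** * Klein's count of axes *)

Lemma three_orbits_arith m1 m2 m3 n1 n2 n3 N :
    (m1 * n1 = N)%N -> (m2 * n2 = N)%N -> (m3 * n3 = N)%N ->
    (1 < m1)%N -> (1 < m2)%N -> (1 < m3)%N -> (1 < n1)%N -> (1 < n2)%N -> (1 < n3)%N ->
    (m1 + m2 + m3 = N + 2)%N -> (n1 <= n2)%N -> (n2 <= n3)%N ->
  [\/ m3 = 2%N, [/\ N = 12%N, n1 = 2%N, n2 = 3%N & n3 = 3%N],
      [/\ N = 24%N, n1 = 2%N, n2 = 3%N & n3 = 4%N]
    | [/\ N = 60%N, n1 = 2%N, n2 = 3%N & n3 = 5%N]].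
Proof.
move=> e1 e2 e3 m1g m2g m3g n1g n2g n3g sm n12 n23.
(* The sum condition reads 1/n1 + 1/n2 + 1/n3 = 1 + 2/N > 1, with the solutions (2, 2, n), (2, 3,
   3), (2, 3, 4) and (2, 3, 5). *)
have n1E : n1 = 2%N.
  apply/eqP; rewrite eqn_leq n1g andbT leqNgt; apply/negP => n1_3.
  have : (3 * m1 <= N)%N by nia.
  have : (3 * m2 <= N)%N by nia.
  have : (3 * m3 <= N)%N by nia.
  lia.
have [n2_4|n2_3] := leqP 4 n2.
  have : (4 * m2 <= N)%N by nia.
  have : (4 * m3 <= N)%N by nia.
  nia.
have [n2E|n2E] : n2 = 2%N \/ n2 = 3%N by lia.
  by constructor 1; subst; lia.
have [n3_6|n3_5] := leqP 6 n3.
  have : (6 * m3 <= N)%N by nia.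
  by subst; lia.
have [n3E|[n3E|n3E]] : n3 = 3%N \/ n3 = 4%N \/ n3 = 5%N by lia.
- by constructor 2; subst; split=> //; lia.
- by constructor 3; subst; split=> //; lia.
by constructor 4; subst; split=> //; lia.
Qed.

(** The unordered form. The clauses excluding 4 or 5 from the other two orders record that the axes
    of maximal order form a single orbit; the solution (2, 3, 3) admits no such clause. *)
Lemma three_orbits m1 m2 m3 n1 n2 n3 N :
    (m1 * n1 = N)%N -> (m2 * n2 = N)%N -> (m3 * n3 = N)%N ->
    (1 < m1)%N -> (1 < m2)%N -> (1 < m3)%N -> (1 < n1)%N -> (1 < n2)%N -> (1 < n3)%N ->
    (m1 + m2 + m3 = N + 2)%N ->
  [\/ [\/ m1 = 2%N, m2 = 2%N | m3 = 2%N],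
      N = 12%N /\ [\/ n1 = 3%N, n2 = 3%N | n3 = 3%N],
      N = 24%N /\ [\/ [/\ n1 = 4%N, n2 <> 4%N & n3 <> 4%N],
                       [/\ n2 = 4%N, n1 <> 4%N & n3 <> 4%N]
                     | [/\ n3 = 4%N, n1 <> 4%N & n2 <> 4%N]]
    | N = 60%N /\ [\/ [/\ n1 = 5%N, n2 <> 5%N & n3 <> 5%N],
                       [/\ n2 = 5%N, n1 <> 5%N & n3 <> 5%N]
                     | [/\ n3 = 5%N, n1 <> 5%N & n2 <> 5%N]]].
Proof.
move=> e1 e2 e3 m1g m2g m3g n1g n2g n3g sm.
have main a1 a2 a3 b1 b2 b3 := @three_orbits_arith a1 a2 a3 b1 b2 b3 N.
have [n12|n21] := leqP n1 n2; have [n23|n32] := leqP n2 n3; have [n13|n31] := leqP n1 n3;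
  try (exfalso; lia).
- have [|[-> -> -> ->]|[-> -> -> ->]|[-> -> -> ->]] := main _ _ _ _ _ _ e1 e2 e3 m1g m2g m3g n1g n2g n3g ltac:(lia) ltac:(lia) ltac:(lia).
  + by constructor 1; constructor 3.
  + by constructor 2; split=> //; constructor 3.
  + by constructor 3; split=> //; constructor 3.
  by constructor 4; split=> //; constructor 3.
- have [|[-> -> -> ->]|[-> -> -> ->]|[-> -> -> ->]] := main _ _ _ _ _ _ e1 e3 e2 m1g m3g m2g n1g n3g n2g ltac:(lia) ltac:(lia) ltac:(lia).
  + by constructor 1; constructor 2.
  + by constructor 2; split=> //; constructor 3.
  + by constructor 3; split=> //; constructor 2.
  by constructor 4; split=> //; constructor 2.
- have [|[-> -> -> ->]|[-> -> -> ->]|[-> -> -> ->]] := main _ _ _ _ _ _ e3 e1 e2 m3g m1g m2g n3g n1g n2g ltac:(lia) ltac:(lia) ltac:(lia).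
  + by constructor 1; constructor 2.
  + by constructor 2; split=> //; constructor 2.
  + by constructor 3; split=> //; constructor 2.
  by constructor 4; split=> //; constructor 2.
- have [|[-> -> -> ->]|[-> -> -> ->]|[-> -> -> ->]] := main _ _ _ _ _ _ e2 e1 e3 m2g m1g m3g n2g n1g n3g ltac:(lia) ltac:(lia) ltac:(lia).
  + by constructor 1; constructor 3.
  + by constructor 2; split=> //; constructor 3.
  + by constructor 3; split=> //; constructor 3.
  by constructor 4; split=> //; constructor 3.
- have [|[-> -> -> ->]|[-> -> -> ->]|[-> -> -> ->]] := main _ _ _ _ _ _ e2 e3 e1 m2g m3g m1g n2g n3g n1g ltac:(lia) ltac:(lia) ltac:(lia).
  + by constructor 1; constructor 1.
  + by constructor 2; split=> //; constructor 1.
  + by constructor 3; split=> //; constructor 1.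
  by constructor 4; split=> //; constructor 1.
- have [|[-> -> -> ->]|[-> -> -> ->]|[-> -> -> ->]] := main _ _ _ _ _ _ e3 e2 e1 m3g m2g m1g n3g n2g n1g ltac:(lia) ltac:(lia) ltac:(lia).
  + by constructor 1; constructor 1.
  + by constructor 2; split=> //; constructor 1.
  + by constructor 3; split=> //; constructor 1.
  by constructor 4; split=> //; constructor 1.
Qed.

Section PoleClassEquation.

Variables (gT : finGroupType) (G : {group gT}) (z : gT) (T : eqType) (u : gT -> T).
Local Notation Z := [set 1%g; z].
Local Notation P := (G :\: [set 1%g; z]).
Hypothesis sZG : Z \subset 'Z(G)%g.
Hypothesis z_neq1 : z != 1%g.
Hypothesis zz1 : (z * z = 1)%g.
Hypothesis uJ : {in P & P & G, forall g h x, u g = u h -> u (g ^ x)%g = u (h ^ x)%g}.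
Hypothesis u_comm : {in P & P, forall g h, (h \in 'C[g])%g = (u h == u g) || (u h == u g^-1%g)}.
Hypothesis uV : {in P, forall g, u g != u g^-1%g}.
Hypothesis uI : {in P &, forall g h, u g = u h -> u g^-1%g = u h^-1%g}.
Hypothesis u_fix : {in P & G, forall g x, u (g ^ x)%g = u g -> x \in 'C[g]%g}.
Hypothesis noncentral : {in P, forall g, ~~ (G \subset 'C[g]%g)}.

(** In the application u sends g to its oriented axis. Of the two lifts of a nontrivial rotation
    about that axis, one lies in the ray of g and the other in the ray of its inverse. *)
Definition ray g := [set h in P | u h == u g].

Lemma in_ray g h : (h \in ray g) = (h \in P) && (u h == u g).
Proof. by rewrite finset.in_set. Qed.

Lemma center_in g : g \in Z -> g \in 'Z(G)%g. Proof. exact: (fintype.subsetP sZG). Qed.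

Lemma ZinG g : g \in Z -> g \in G.
Proof. by move/center_in/finset.setIP=> []. Qed.

Lemma PinG g : g \in P -> g \in G. Proof. by case/finset.setDP. Qed.

Lemma ZJ g x : x \in G -> ((g ^ x)%g \in Z) = (g \in Z).
Proof.
have cJ y w : w \in G -> y \in Z -> (y ^ w)%g = y.
  move=> Gw /center_in/finset.setIP[_ /centP/(_ w Gw)/commgP/conjg_fixP].
  by [].
move=> Gx; apply/idP/idP => [gx|gz]; last by rewrite cJ.
by rewrite -(conjgK x g) cJ ?groupV.
Qed.

Lemma PJ g x : x \in G -> ((g ^ x)%g \in P) = (g \in P).
Proof. by move=> Gx; rewrite !finset.in_setD groupJr // ZJ. Qed.

Lemma PV g : (g^-1%g \in P) = (g \in P).
Proof.
have zV : z^-1%g = z by apply: (mulgI z); rewrite mulgV zz1.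
have gz : (g^-1%g == z) = (g == z) by rewrite -{1}zV (inj_eq invg_inj).
by rewrite !finset.in_setD groupV !in_set2 invg_eq1 gz.
Qed.

(** The centraliser of an element is the stabiliser of its axis, and commuting elements have equal
    or opposite axes. *)
Lemma cent_ray g h : g \in P -> h \in P -> (h \in 'C[g])%g -> 'C_G[h]%g = 'C_G[g]%g.
Proof.
have sub x y : x \in P -> y \in P -> (y \in 'C[x])%g -> 'C_G[x]%g \subset 'C_G[y]%g.
  move=> Px Py yx; apply/fintype.subsetP => w /finset.setIP[Gw wx]; rewrite finset.in_setI Gw /=.
  have xw : (x ^ w)%g = x by apply/conjg_fixP/commgP/commute_sym/cent1P.
  apply: u_fix => //; move: yx; rewrite u_comm // => /orP[] /eqP yx.
    by rewrite (uJ _ _ Gw yx) // xw.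
  by rewrite (uJ _ _ Gw yx) ?PV // conjVg xw.
move=> Pg Ph hg; apply/eqP; rewrite finset.eqEsubset !sub //.
by rewrite cent1C.
Qed.

(** The centraliser is the disjoint union of {1, z}, the ray of g and the ray of its inverse;
    inversion exchanges the two rays. *)
Lemma card_cent1_ray g : g \in P -> #|'C_G[g]%g| = (2 * #|ray g|.+1)%N.
Proof.
move=> Pg; have PgV : g^-1%g \in P by rewrite PV.
have dZ (A : {set gT}) : A \subset P -> Z :&: A = finset.set0.
  move=> /fintype.subsetP sA; apply/finset.setP => h; rewrite finset.in_setI finset.in_set0.
  by apply/andP => -[hZ /sA]; rewrite finset.in_setD hZ.
have sP h : ray h \subset P by apply/fintype.subsetP => k /finset.setIdP[].
have -> : 'C_G[g]%g = Z :|: (ray g :|: ray g^-1%g).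
  apply/finset.setP => h; rewrite finset.in_setI (finset.in_setU h Z) (finset.in_setU h (ray g)) !in_ray.
  have [/center_in/finset.setIP[Gh /centP/(_ g (PinG Pg)) hg]|hz] := boolP (h \in Z).
    by rewrite Gh /=; apply/cent1P.
  case Gh: (h \in G); last by rewrite !(finset.in_setD) Gh !andbF.
  have Ph : h \in P by rewrite finset.in_setD hz.
  by rewrite Ph /= u_comm.
have card_raysV : #|ray g^-1%g| = #|ray g|.
  rewrite -(card_imset (ray g) invg_inj); apply: eq_card => h; apply/idP/imsetP.
    case/finset.setIdP=> Ph /eqP hg; exists h^-1%g; last by rewrite invgK.
    by rewrite in_ray PV Ph /= (uI Ph PgV hg) invgK.
  by case=> k /finset.setIdP[Pk /eqP kg] ->; rewrite in_ray PV Pk /= (uI Pk Pg kg).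
rewrite cardsU dZ ?finset.subUset ?sP // cards0 subn0.
have -> : #|ray g :|: ray g^-1%g| = (#|ray g| + #|ray g|)%N.
  rewrite cardsU card_raysV (_ : _ :&: _ = finset.set0) ?cards0 ?subn0 //.
  apply/finset.setP => h; rewrite finset.in_setI finset.in_set0; apply/andP.
  case=> /finset.setIdP[_ /eqP hg] /finset.setIdP[_ /eqP hgV].
  by have := uV Pg; rewrite -hg hgV eqxx.
by rewrite cards2 eq_sym z_neq1 addnn mulnS mul2n.
Qed.

(** Distinct conjugates of a ray are disjoint, so that [block g] can be counted as the ray times the
    index of the centraliser. *)
Lemma ray_normedTI g : g \in P -> normedTI (ray g) G 'C_G[g]%g.
Proof.
move=> Pg; apply/normedTI_P; split.
- by apply/finset.set0Pn; exists g; rewrite in_ray Pg eqxx.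
- apply/fintype.subsetP => x /finset.setIP[Gx xg]; rewrite inE Gx /=.
  rewrite inE; apply/fintype.subsetP => _ /imsetP[h /finset.setIdP[Ph /eqP hg] ->].
  rewrite in_ray PJ // Ph /= (uJ _ _ Gx hg) //.
  by have -> : (g ^ x)%g = g by apply/conjg_fixP/commgP/commute_sym/cent1P.
move=> x Gx /pred0Pn[y /andP[/finset.setIdP[_ /eqP hg] /imsetP[k /finset.setIdP[Pk /eqP kg] hE]]].
have : x \in 'C_G[k]%g by rewrite finset.in_setI Gx u_fix // -hE hg.
by rewrite (cent_ray Pg) // u_comm // kg eqxx.
Qed.

Definition block g := class_support (ray g) G.

Lemma blockP g h : g \in P ->
  reflect (h \in P /\ exists2 x, x \in G & u h = u (g ^ x)%g) (h \in block g).
Proof.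
move=> Pg; apply: (iffP imset2P) => [[k x /finset.setIdP[Pk /eqP kg] Gx ->]|[Ph [x Gx hE]]].
  by rewrite PJ //; split=> //; exists x => //; apply: uJ.
exists (h ^ x^-1)%g x => //; last by rewrite conjgKV.
rewrite in_ray PJ ?groupV // Ph /= (uJ _ _ _ hE) ?PJ ?groupV // conjgK.
by [].
Qed.

Lemma card_block g : g \in P -> (#|block g| + indexg G 'C_G[g]%g = #|G| %/ 2)%N.
Proof.
move=> Pg; rewrite (card_support_normedTI (ray_normedTI Pg)).
rewrite -(Lagrange (subsetIl G 'C[g]%g)) card_cent1_ray // -mulnA mulKn //.
by rewrite mulSn addnC.
Qed.

Lemma block_eq g h : g \in P -> h \in block g -> block h = block g.
Proof.
move=> Pg /(blockP _ Pg)[Ph [x Gx hE]]; apply/finset.setP => k; apply/(blockP _ Ph)/(blockP _ Pg).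
  case=> Pk [y Gy kE]; split=> //; exists (x * y)%g; first by rewrite groupM.
  by rewrite kE conjgM; apply: uJ; rewrite ?PJ.
case=> Pk [y Gy kE]; split=> //; exists (x^-1 * y)%g; first by rewrite groupM ?groupV.
rewrite kE conjgM; apply: uJ; rewrite ?PJ ?groupV //.
by rewrite (uJ _ _ _ hE) ?PJ ?groupV // conjgK.
Qed.

Definition blocks := [set block g | g in P].

Lemma sum_blocks : (\sum_(B in blocks) #|B| + 2 = #|G|)%N.
Proof.
have -> : (\sum_(B in blocks) #|B| = #|P|)%N.
  symmetry; apply: card_partition; apply/and3P; split.
  - apply/eqP/finset.setP => h; apply/bigcupP/idP => [[B /imsetP[g Pg ->] /(blockP _ Pg)[]]//|Ph].
    exists (block h); first exact: imset_f.
    by apply/(blockP _ Ph); split=> //; exists 1%g => //; rewrite conjg1.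
  - apply/finset.trivIsetP => _ _ /imsetP[g Pg ->] /imsetP[h Ph ->]; apply: contraR.
    case/pred0Pn=> k /andP[/= kg kh].
    by rewrite -(block_eq Pg kg) -(block_eq Ph kh).
  apply/imsetP => -[g Pg /finset.setP/(_ g)]; rewrite inE => /esym/(blockP _ Pg)[].
  by split=> //; exists 1%g => //; rewrite conjg1.
have := cardsID Z G; have /finset.setIidPr-> : Z \subset G.
  by apply/fintype.subsetP => g /ZinG.
by rewrite cards2 eq_sym z_neq1 addnC.
Qed.

Definition pole_index g := indexg G 'C_G[g]%g.
(** The order of the group of rotations about the axis: the ray holds one lift of each nontrivial
    rotation, and the successor counts the identity. *)
Definition pole_order g := (#|ray g|).+1.

Lemma pole_order_gt1 g : g \in P -> (1 < pole_order g)%N.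
Proof.
by move=> Pg; rewrite ltnS; apply/card_gt0P; exists g; rewrite in_ray Pg eqxx.
Qed.

Lemma pole_index_order g : g \in P -> (2 * (pole_index g * pole_order g) = #|G|)%N.
Proof.
move=> Pg; rewrite -(Lagrange (subsetIl G 'C[g]%g)) card_cent1_ray //.
by rewrite mulnCA [in RHS]mulnC mulnCA.
Qed.

Lemma pole_index_gt1 g : g \in P -> (1 < pole_index g)%N.
Proof.
move=> Pg; rewrite ltn_neqAle indexg_gt0 andbT eq_sym indexg_eq1 finset.subsetI.
by rewrite (negPf (noncentral Pg)) andbF.
Qed.

Lemma card_block_index g : g \in P ->
  (#|block g| + pole_index g = pole_index g * pole_order g)%N.
Proof. by move=> Pg; rewrite card_block // -(pole_index_order Pg) mulKn. Qed.

Lemma block_self g : g \in P -> g \in block g.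
Proof.
by move=> Pg; apply/(blockP _ Pg); split=> //; exists 1%g => //; rewrite conjg1.
Qed.

Lemma pole_classification g0 : g0 \in P ->
  [\/ exists2 g, g \in P & pole_index g = 2%N,
      exists2 g, g \in P & #|G| = 24%N /\ pole_order g = 3%N,
      exists2 g, g \in P & [/\ #|G| = 48%N, pole_order g = 4%N &
        forall h, h \in P -> pole_order h = 4%N -> h \in block g]
    | exists2 g, g \in P & [/\ #|G| = 120%N, pole_order g = 5%N &
        forall h, h \in P -> pole_order h = 5%N -> h \in block g]].
Proof.
move=> Pg0; pose N := (#|G| %/ 2)%N.
have NE g : g \in P -> (pole_index g * pole_order g)%N = N.
  by move=> Pg; rewrite /N -(pole_index_order Pg) mulKn.
have GE : #|G| = (2 * N)%N by rewrite -(NE _ Pg0) pole_index_order.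
have bnd B : B \in blocks -> (#|B| + 2 <= N)%N /\ (N <= 2 * #|B|)%N.
  case/imsetP=> g Pg ->; have := card_block_index Pg; have := NE _ Pg.
  have := pole_index_gt1 Pg; have := pole_order_gt1 Pg; nia.
have sumB := sum_blocks.
(* A block has at least N/2 and at most N - 2 elements, and the sizes add up to 2N - 2; only three
   blocks are possible. *)
have cardB : #|blocks| = 3%N.
  have le : (\sum_(B in blocks) #|B| + 2 * #|blocks| <= N * #|blocks|)%N.
    rewrite -[X in (_ + X <= _)%N]mulnC -[X in (_ <= X)%N]mulnC -!sum_nat_const -big_split /=.
    by apply: leq_sum => B /bnd[].
  have ge : (N * #|blocks| <= 2 * \sum_(B in blocks) #|B|)%N.
    rewrite mulnC -sum_nat_const big_distrr /=.
    by apply: leq_sum => B /bnd[].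
  have N_gt2 : (3 < N)%N.
    have := NE _ Pg0; have := pole_index_gt1 Pg0; have := pole_order_gt1 Pg0; nia.
  move: sumB le ge; rewrite GE; set b := #|_|; set S := \sum_(B in _) _ => sumB le ge.
  have SE : S = (2 * N - 2)%N by lia.
  rewrite SE in le ge; clear -le ge N_gt2.
  case: b le ge => [|[|[|[|b]]]] le ge //; lia.
have : size (enum blocks) = 3%N by rewrite -cardE.
case blE: (enum blocks) => [|B1 [|B2 [|B3 [|]]]] // _.
have inB B : (B \in blocks) = (B \in [:: B1; B2; B3]) by rewrite -blE mem_enum.
have sum3 : (#|B1| + #|B2| + #|B3| + 2 = 2 * N)%N.
  by rewrite -GE -sumB -big_enum /= blE !big_cons big_nil addn0 addnA.
have /imsetP[g1 P1 E1] : B1 \in blocks by rewrite inB !inE eqxx.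
have /imsetP[g2 P2 E2] : B2 \in blocks by rewrite inB !inE eqxx orbT.
have /imsetP[g3 P3 E3] : B3 \in blocks by rewrite inB !inE eqxx !orbT.
have order_eq g h : g \in P -> h \in P -> block g = block h -> pole_order g = pole_order h.
  move=> Pg Ph gh; have := card_block_index Pg; have := card_block_index Ph.
  rewrite gh; have := NE _ Pg; have := NE _ Ph; have := pole_index_gt1 Pg.
  have := pole_index_gt1 Ph; nia.
have mem3 h k g g' g'' : h \in P -> g \in P -> g' \in P -> g'' \in P ->
    block h \in [:: block g; block g'; block g''] -> pole_order h = k ->
    pole_order g' <> k -> pole_order g'' <> k -> h \in block g.
  move=> Ph Pg Pg' Pg'' bh hk g'k g''k; move: bh; rewrite !inE => /or3P[] /eqP bh.
  - by rewrite -bh block_self.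
  - by case: g'k; rewrite -hk (order_eq _ _ Ph Pg' bh).
  by case: g''k; rewrite -hk (order_eq _ _ Ph Pg'' bh).
have memb h : h \in P -> block h \in [:: block g1; block g2; block g3].
  by move=> Ph; rewrite -E1 -E2 -E3 -inB imset_f.
have sm : (pole_index g1 + pole_index g2 + pole_index g3 = N + 2)%N.
  have := card_block_index P1; have := card_block_index P2; have := card_block_index P3.
  rewrite -E1 -E2 -E3 !NE //; lia.
have c213 h : block h \in [:: block g1; block g2; block g3] ->
    block h \in [:: block g2; block g1; block g3].
  by rewrite !inE orbCA.
have c312 h : block h \in [:: block g1; block g2; block g3] ->
    block h \in [:: block g3; block g1; block g2].
  by rewrite !inE orbA orbC.
case: (three_orbits (NE _ P1) (NE _ P2) (NE _ P3) (pole_index_gt1 P1) (pole_index_gt1 P2)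
  (pole_index_gt1 P3) (pole_order_gt1 P1) (pole_order_gt1 P2) (pole_order_gt1 P3) sm).
- by case=> mE; constructor 1; [exists g1 | exists g2 | exists g3].
- by case=> N12 [] nE; constructor 2; [exists g1 | exists g2 | exists g3]; rewrite ?GE ?N12.
- case=> N24 [] [nE nE' nE'']; constructor 3.
  + by exists g1 => //; split; rewrite ?GE ?N24 // => h Ph hk; apply: (mem3 h _ g1 g2 g3) hk _ _ => //; exact: memb.
  + by exists g2 => //; split; rewrite ?GE ?N24 // => h Ph hk; apply: (mem3 h _ g2 g1 g3) hk _ _ => //; exact/c213/memb.
  by exists g3 => //; split; rewrite ?GE ?N24 // => h Ph hk; apply: (mem3 h _ g3 g1 g2) hk _ _ => //; exact/c312/memb.
case=> N60 [] [nE nE' nE'']; constructor 4.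
+ by exists g1 => //; split; rewrite ?GE ?N60 // => h Ph hk; apply: (mem3 h _ g1 g2 g3) hk _ _ => //; exact: memb.
+ by exists g2 => //; split; rewrite ?GE ?N60 // => h Ph hk; apply: (mem3 h _ g2 g1 g3) hk _ _ => //; exact/c213/memb.
by exists g3 => //; split; rewrite ?GE ?N60 // => h Ph hk; apply: (mem3 h _ g3 g1 g2) hk _ _ => //; exact/c312/memb.
Qed.

End PoleClassEquation.

Local Open Scope complex_scope.

(** * Coordinates in dimensions 2 and 3 *)

Notation o20 := (@Ordinal 2 0 isT).
Notation o21 := (@Ordinal 2 1 isT).
Notation o30 := (@Ordinal 3 0 isT).
Notation o31 := (@Ordinal 3 1 isT).
Notation o32 := (@Ordinal 3 2 isT).

(** Case analysis down to closed ordinals, on which the entries of explicit matrices compute. *)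
Lemma ord2P (P : 'I_2 -> Prop) : P o20 -> P o21 -> forall i, P i.
Proof.
move=> P0 P1 [[|[|//]] lt2]; first by rewrite (bool_irrelevance lt2 isT).
by rewrite (bool_irrelevance lt2 isT).
Qed.

Lemma ord3P (P : 'I_3 -> Prop) : P o30 -> P o31 -> P o32 -> forall i, P i.
Proof.
move=> P0 P1 P2 [[|[|[|//]]] lt3]; first by rewrite (bool_irrelevance lt3 isT).
  by rewrite (bool_irrelevance lt3 isT).
by rewrite (bool_irrelevance lt3 isT).
Qed.

Lemma sum2 (V : nmodType) (F : 'I_2 -> V) : \sum_i F i = F o20 + F o21.
Proof.
by rewrite big_ord_recl big_ord1; congr (F _ + F _); apply: val_inj.
Qed.

Lemma sum3 (V : nmodType) (F : 'I_3 -> V) : \sum_i F i = F o30 + F o31 + F o32.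
Proof.
by rewrite !big_ord_recl big_ord0 addr0 addrA; congr (F _ + F _ + F _); apply: val_inj.
Qed.

Section Mx2.

Variable T : Type.

Definition mx2 (a b c e : T) : 'M[T]_2 :=
  \matrix_(i, j) (if val i is 0%N then (if val j is 0%N then a else b)
                  else (if val j is 0%N then c else e)).

Lemma mx2P (A : 'M[T]_2) : A = mx2 (A o20 o20) (A o20 o21) (A o21 o20) (A o21 o21).
Proof.
by apply/matrixP; apply: ord2P; apply: ord2P; rewrite mxE.
Qed.

Definition cv3 (a b c : T) : 'cV[T]_3 :=
  \col_i (match val i with 0%N => a | 1%N => b | _ => c end).

Lemma cv3P (v : 'cV[T]_3) : v = cv3 (v o30 0) (v o31 0) (v o32 0).
Proof. by apply/matrixP; apply: ord3P => j; rewrite ord1 mxE. Qed.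

End Mx2.

Lemma trmx_mx2 T (a b c e : T) : (mx2 a b c e)^T = mx2 a c b e.
Proof. by apply/matrixP; apply: ord2P; apply: ord2P; rewrite !mxE. Qed.

Lemma mx2M (F : pzSemiRingType) (a b c e a' b' c' e' : F) :
  mx2 a b c e *m mx2 a' b' c' e' =
  mx2 (a * a' + b * c') (a * b' + b * e') (c * a' + e * c') (c * b' + e * e').
Proof. by apply/matrixP; apply: ord2P; apply: ord2P; rewrite !mxE sum2 !mxE. Qed.

Lemma mx2_tr (F : pzSemiRingType) (a b c e : F) : \tr (mx2 a b c e) = a + e.
Proof. by rewrite /mxtrace sum2 !mxE. Qed.

Lemma det_mx2 (F : comPzRingType) (a b c e : F) : \det (mx2 a b c e) = a * e - b * c.
Proof.
rewrite (expand_det_row _ o20) sum2 /cofactor !det_mx11 !mxE /= expr0 expr1.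
by rewrite mul1r mulN1r mulrN.
Qed.

Lemma mx2_inj T (a b c e a' b' c' e' : T) : mx2 a b c e = mx2 a' b' c' e' ->
  [/\ a = a', b = b', c = c' & e = e'].
Proof.
move/matrixP=> E; have := (E o20 o20, E o20 o21, E o21 o20, E o21 o21).
by rewrite !mxE => -[[[]]].
Qed.

(** * Quaternions, rotations and the double cover *)

Section Quaternion.

Variable R : realType.
Implicit Types (a b : R) (u v w : 'cV[R]_3).

Lemma complexM (a b c e : R) : (a +i* b) * (c +i* e) = (a * c - b * e) +i* (a * e + b * c).
Proof. by []. Qed.
Lemma complexD (a b c e : R) : (a +i* b) + (c +i* e) = (a + c) +i* (b + e).
Proof. by []. Qed.
Lemma complexN (a b : R) : - (a +i* b) = (- a) +i* (- b).
Proof. by []. Qed.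
Lemma complex_conj (a b : R) : Num.conj (a +i* b) = a -i* b.
Proof. by []. Qed.
Lemma complex0 : (0 : R[i]) = 0 +i* 0. Proof. by []. Qed.
Lemma complex1 : (1 : R[i]) = 1 +i* 0. Proof. by []. Qed.
Definition complexOp := (complexM, complexD, complexN, complex_conj).

(** This is a + i (v_0 s_0 + v_1 s_1 + v_2 s_2) with s_k the matrix [pauli R k]. In this convention
    the product of two vectors involves minus their cross product. *)
Definition quat a v : 'M[R[i]]_2 :=
  mx2 (a +i* v o32 0) (v o31 0 +i* v o30 0) (- v o31 0 +i* v o30 0) (a -i* v o32 0).

Definition dot u v : R := u o30 0 * v o30 0 + u o31 0 * v o31 0 + u o32 0 * v o32 0.

Definition cross u v : 'cV[R]_3 :=
  cv3 (u o31 0 * v o32 0 - u o32 0 * v o31 0) (u o32 0 * v o30 0 - u o30 0 * v o32 0)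
      (u o30 0 * v o31 0 - u o31 0 * v o30 0).

(* The matrix of w |-> (a^2 - |v|^2) w + 2 (v . w) v - 2 a v x w. *)
Definition rotq a v : 'M[R]_3 :=
  \matrix_(i, j) ((a ^+ 2 - dot v v) * (i == j)%:R + 2 * (v i 0 * v j 0)
                  - 2 * a * cross v (delta_mx j 0) i 0).

Lemma quatM a b u v :
  quat a u *m quat b v = quat (a * b - dot u v) (a *: v + b *: u - cross u v).
Proof.
rewrite /quat mx2M !complexOp /dot !mxE /=.
by congr mx2; congr Complex; ring.
Qed.

Lemma quat_ctr a v : (quat a v) ^t* = quat a (- v).
Proof.
apply/matrixP; apply: ord2P; apply: ord2P; rewrite !mxE /= ?complex_conj ?mxE ?opprK //.
Qed.

Lemma det_quat a v : \det (quat a v) = (a ^+ 2 + dot v v) +i* 0.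
Proof. by rewrite det_mx2 !complexOp /dot; congr Complex; ring. Qed.

Lemma quat_inj a b u v : quat a u = quat b v -> a = b /\ u = v.
Proof.
move=> E; have [[-> u2] [u1 u0] _ _] := mx2_inj E; split=> //.
by rewrite (cv3P u) (cv3P v) u0 u1 u2.
Qed.

Lemma quat_scalar a : quat a 0 = (a%:C)%:M.
Proof.
by apply/matrixP; apply: ord2P; apply: ord2P; rewrite !mxE /= ?oppr0.
Qed.

Lemma quat1 : quat 1 0 = 1%:M.
Proof. by rewrite quat_scalar. Qed.

Lemma quatN a v : - quat a v = quat (- a) (- v).
Proof.
by apply/matrixP; apply: ord2P; apply: ord2P; rewrite !mxE /= complexN ?opprK.
Qed.

Lemma SU2_quatP (U : 'M[R[i]]_2) :
  SU2 U <-> exists a v, U = quat a v /\ a ^+ 2 + dot v v = 1.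
Proof.
split=> [[/unitarymxP UU dU]|[a [v [-> n1]]]]; last first.
  split; last by rewrite det_quat n1.
  apply/unitarymxP; rewrite quat_ctr quatM -quat1; congr quat.
    by rewrite -n1 /dot !mxE; ring.
  by rewrite (cv3P (_ - _)) (cv3P 0) !mxE /=; congr cv3; ring.
have Uu : U \in unitmx by apply: unitarymx_unit; apply/unitarymxP.
(* Conjugate transpose and adjugate are both the inverse of U; comparing their entries gives the
   quaternion shape. *)
have adjE : U ^t* = \adj U.
  apply: (can_inj (mulKmx Uu)); rewrite UU mul_mx_adj dU.
  by [].
move: UU dU adjE; rewrite (mx2P U).
case: (U o20 o20) (U o20 o21) (U o21 o20) (U o21 o21) => a a' [b b'] [c c'] [e e'] _.
rewrite det_mx2 => dU /matrixP adjE.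
have := (adjE o20 o20, adjE o20 o21).
rewrite !mxE /cofactor !det_mx11 !mxE /= ?expr0 ?expr1 ?mul1r ?mulN1r.
rewrite !complex_conj ?complexN => -[[aE a'E] [cE /oppr_inj c'E]].
move: dU; rewrite !complexOp complex1 => -[n1 _].
exists a, (cv3 b' b a'); split; last by rewrite -n1 /dot !mxE /= -aE -a'E cE c'E; ring.
by rewrite /quat !mxE /= -aE -a'E cE c'E.
Qed.

Lemma rotqE a v w :
  rotq a v *m w = (a ^+ 2 - dot v v) *: w + (2 * dot v w) *: v - (2 * a) *: cross v w.
Proof.
rewrite [LHS]cv3P [RHS]cv3P !mxE !sum3 !mxE /= /dot.
by congr cv3; ring.
Qed.

Lemma pauli0 : pauli R o30 = mx2 (0 +i* 0) (1 +i* 0) (1 +i* 0) (0 +i* 0).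
Proof. by apply/matrixP; apply: ord2P; apply: ord2P; rewrite !mxE /= ?addr0 ?add0r. Qed.

Lemma pauli1 : pauli R o31 = mx2 (0 +i* 0) (0 +i* -1) (0 +i* 1) (0 +i* 0).
Proof.
apply/matrixP; apply: ord2P; apply: ord2P; rewrite !mxE /=;
  rewrite ?complex0 ?complex1 !complexOp; by congr Complex; ring.
Qed.

Lemma pauli2 : pauli R o32 = mx2 (1 +i* 0) (0 +i* 0) (0 +i* 0) (-1 +i* 0).
Proof.
apply/matrixP; apply: ord2P; apply: ord2P; rewrite !mxE /=;
  rewrite ?complex0 ?complex1 !complexOp; by congr Complex; ring.
Qed.

Definition pauliE := (pauli0, pauli1, pauli2).

Lemma double_coverE a v : double_cover (quat a v) = rotq a v.
Proof.
have two : 2 != 0 :> R by rewrite pnatr_eq0.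
apply/matrixP; apply: ord3P; apply: ord3P;
  rewrite [LHS]mxE quat_ctr !pauliE /quat !mx2M mx2_tr !complexOp !mxE /= /dot; by field.
Qed.

End Quaternion.

Section Rotations.

Variable R : realType.
Implicit Types (a b : R) (u v w p q : 'cV[R]_3) (A B : 'M[R]_3).

Definition SO3 A := A *m A^T = 1%:M /\ \det A = 1.

Lemma SO3_tr A : SO3 A -> A^T *m A = 1%:M.
Proof. by case=> AA _; apply: mulmx1C. Qed.

Lemma SO3M A B : SO3 A -> SO3 B -> SO3 (A *m B).
Proof.
move=> [AA dA] [BB dB]; split; last by rewrite det_mulmx dA dB mulr1.
by rewrite trmx_mul mulmxA -(mulmxA A) BB mulmx1 AA.
Qed.

Lemma SO3_trmx A : SO3 A -> SO3 A^T.
Proof. by move=> sA; split; rewrite ?trmxK ?SO3_tr // det_tr; case: sA. Qed.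

Lemma dotE u v : dot u v = (u^T *m v) 0 0.
Proof. by rewrite mxE sum3 !mxE. Qed.

Lemma dotC u v : dot u v = dot v u. Proof. by rewrite /dot; ring. Qed.

Lemma dotZl a u v : dot (a *: u) v = a * dot u v.
Proof. by rewrite /dot ?mxE; ring. Qed.

Lemma dotZr a u v : dot u (a *: v) = a * dot u v.
Proof. by rewrite /dot ?mxE; ring. Qed.

Lemma dotDl u v w : dot (u + v) w = dot u w + dot v w.
Proof. by rewrite /dot ?mxE; ring. Qed.

Lemma dotNl u v : dot (- u) v = - dot u v.
Proof. by rewrite /dot ?mxE; ring. Qed.

Lemma dotNr u v : dot u (- v) = - dot u v.
Proof. by rewrite /dot ?mxE; ring. Qed.

Lemma dot_ge0 u : 0 <= dot u u.
Proof. by rewrite /dot -!expr2 !addr_ge0 ?sqr_ge0. Qed.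

Lemma dot_eq0 u : (dot u u == 0) = (u == 0).
Proof.
apply/eqP/eqP => [u0|->]; last by rewrite /dot ?mxE; ring.
move/eqP: u0; rewrite /dot -!expr2 !paddr_eq0 ?addr_ge0 ?sqr_ge0 // !sqrf_eq0.
by case/andP=> /andP[/eqP u0 /eqP u1] /eqP u2; rewrite (cv3P u) (cv3P 0) !mxE u0 u1 u2.
Qed.

Lemma dot_mulmx A u v : A^T *m A = 1%:M -> dot (A *m u) (A *m v) = dot u v.
Proof. by move=> AA; rewrite !dotE trmx_mul mulmxA -(mulmxA u^T) AA mulmx1. Qed.

Lemma det_mx3 A : \det A =
  A o30 o30 * (A o31 o31 * A o32 o32 - A o31 o32 * A o32 o31)
  - A o30 o31 * (A o31 o30 * A o32 o32 - A o31 o32 * A o32 o30)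
  + A o30 o32 * (A o31 o30 * A o32 o31 - A o31 o31 * A o32 o30).
Proof.
have det2 (M : 'M[R]_2) : \det M = M o20 o20 * M o21 o21 - M o20 o21 * M o21 o20.
  by rewrite [in LHS](mx2P M) det_mx2.
have l00 : lift o30 o20 = o31 by apply: val_inj.
have l01 : lift o30 o21 = o32 by apply: val_inj.
have l10 : lift o31 o20 = o30 by apply: val_inj.
have l11 : lift o31 o21 = o32 by apply: val_inj.
have l20 : lift o32 o20 = o30 by apply: val_inj.
have l21 : lift o32 o21 = o31 by apply: val_inj.
rewrite (expand_det_row _ o30) sum3 /cofactor !det2 !mxE !l00 !l01 !l10 !l11 !l20 !l21 /=.
ring.
Qed.

Lemma cross_mulmx_tr A u v : A^T *m cross (A *m u) (A *m v) = \det A *: cross u v.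
Proof.
rewrite [LHS]cv3P [RHS]cv3P det_mx3 !mxE !sum3 !mxE /= !sum3.
by congr cv3; ring.
Qed.

Lemma SO3_cross A u v : SO3 A -> cross (A *m u) (A *m v) = A *m cross u v.
Proof.
move=> sA; have := cross_mulmx_tr A u v; case: sA => AA ->; rewrite scale1r => <-.
by rewrite mulmxA AA mul1mx.
Qed.

Lemma cross_sq u v : dot (cross u v) (cross u v) = dot u u * dot v v - dot u v ^+ 2.
Proof. by rewrite /dot ?mxE /=; ring. Qed.

(* Coordinates of w in the frame u, v, u x v. *)
Lemma frame_decomp u v w : dot (cross u v) (cross u v) *: w =
  (dot v v * dot u w - dot u v * dot v w) *: u +
  (dot u u * dot v w - dot u v * dot u w) *: v + dot (cross u v) w *: cross u v.
Proof.
rewrite [LHS]cv3P [RHS]cv3P !mxE /= /dot ?mxE /=.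
by congr cv3; ring.
Qed.

(** A proper rotation fixing p and q also fixes their cross product, hence a basis. *)
Lemma SO3_fix2 A p q : SO3 A -> cross p q != 0 -> A *m p = p -> A *m q = q -> A = 1%:M.
Proof.
move=> sA pq Ap Aq; have Apq : A *m cross p q = cross p q by rewrite -SO3_cross // Ap Aq.
have Aw w : A *m w = w.
  have nz : dot (cross p q) (cross p q) != 0 by rewrite dot_eq0.
  apply: (scalerI nz); rewrite scalemxAr frame_decomp.
  by rewrite !mulmxDr -!scalemxAr Ap Aq Apq.
by apply/matrixP => i j; have /colP/(_ i) := Aw (delta_mx j 0); rewrite -colE !mxE eqxx andbT.
Qed.

Lemma cross_eq0 u v : v != 0 -> cross u v = 0 -> exists t, u = t *: v.
Proof.
move=> v0 uv; exists (dot u v / dot v v); have nz : dot v v != 0 by rewrite dot_eq0.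
apply: (scalerI nz); rewrite scalerA mulrC divfK //.
(* The two sides differ by v x (u x v), which vanishes with u x v. *)
apply/eqP; rewrite -subr_eq0; apply/eqP; transitivity (cross v (cross u v)).
  by rewrite [LHS]cv3P /cross !mxE /= /dot; congr cv3; ring.
by rewrite uv [RHS]cv3P /cross !mxE /=; congr cv3; ring.
Qed.

Lemma rotqM a b u v : rotq a u *m rotq b v =
  rotq (a * b - dot u v) (a *: v + b *: u - cross u v).
Proof.
apply/matrixP; apply: ord3P; apply: ord3P;
  rewrite !mxE !sum3 !mxE /= /dot ?mxE /=; by ring.
Qed.

Lemma rotq_tr a v : (rotq a v)^T = rotq a (- v).
Proof.
apply/matrixP; apply: ord3P; apply: ord3P;
  rewrite !mxE /= /dot ?mxE /=; by ring.
Qed.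

Lemma rotq_SO3 a v : a ^+ 2 + dot v v = 1 -> SO3 (rotq a v).
Proof.
move=> n1; split.
  rewrite rotq_tr rotqM dotNr scalerN opprK -expr2 n1.
  rewrite (_ : _ - _ = 0); last first.
    by rewrite [LHS]cv3P [RHS]cv3P !mxE /=; congr cv3; ring.
  by apply/matrixP; apply: ord3P; apply: ord3P; rewrite !mxE /= /dot ?mxE /=; ring.
transitivity ((a ^+ 2 + dot v v) ^+ 3); last by rewrite n1 expr1n.
by rewrite det_mx3 /rotq !mxE /= /dot ?mxE /=; ring.
Qed.

Lemma quat_conj a b u w : quat a u *m quat b w *m (quat a u) ^t* =
  quat ((a ^+ 2 + dot u u) * b) (rotq a u *m w).
Proof.
rewrite quat_ctr !quatM rotqE; congr quat; first by rewrite /dot ?mxE /=; ring.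
by rewrite [LHS]cv3P [RHS]cv3P !mxE /= /dot ?mxE /=; congr cv3; ring.
Qed.

Lemma double_coverM (U V : 'M[R[i]]_2) : SU2 U -> SU2 V ->
  double_cover (U *m V) = double_cover U *m double_cover V.
Proof.
move=> /SU2_quatP[a [u [-> _]]] /SU2_quatP[b [v [-> _]]].
by rewrite quatM !double_coverE rotqM.
Qed.

Lemma double_cover_SO3 U : SU2 U -> SO3 (double_cover U).
Proof. by move=> /SU2_quatP[a [u [-> n1]]]; rewrite double_coverE; apply: rotq_SO3. Qed.

Lemma SU2M (U V : 'M[R[i]]_2) : SU2 U -> SU2 V -> SU2 (U *m V).
Proof.
by move=> [uU dU] [uV dV]; split; rewrite ?mul_unitarymx // det_mulmx dU dV mulr1.
Qed.

Lemma SU2_ctr (U : 'M[R[i]]_2) : SU2 U -> SU2 (U ^t*).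
Proof.
move=> [uU dU]; split; first by rewrite trmxC_unitary.
by rewrite det_map_mx det_tr dU rmorph1.
Qed.

Lemma double_cover_ctr (U : 'M[R[i]]_2) : SU2 U -> double_cover (U ^t*) = (double_cover U)^T.
Proof.
by move=> /SU2_quatP[a [u [-> _]]]; rewrite quat_ctr !double_coverE rotq_tr.
Qed.

Lemma double_cover_eq1 (U : 'M[R[i]]_2) :
  SU2 U -> double_cover U = 1%:M -> U = 1%:M \/ U = - 1%:M.
Proof.
move=> /SU2_quatP[a [v [-> n1]]]; rewrite double_coverE => /matrixP D1.
have := (D1 o30 o30, D1 o31 o31, D1 o32 o32); rewrite !mxE /= /dot ?mxE /= => -[[d0 d1] d2].
move: n1; rewrite /dot => n1.
have v0 : v = 0.
  rewrite (cv3P v) (cv3P 0) !mxE; congr cv3; apply/eqP; rewrite -sqrf_eq0; apply/eqP; nra.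
have : a ^+ 2 == 1 by apply/eqP; move: n1; rewrite v0 !mxE; lra.
by rewrite sqrf_eq1 v0 => /orP[] /eqP->; [left | right]; rewrite -quat1 // quatN oppr0.
Qed.

Lemma double_cover_inj (U V : 'M[R[i]]_2) : SU2 U -> SU2 V ->
  double_cover U = double_cover V -> U = V \/ U = - V.
Proof.
move=> sU sV DUV; have sVU := SU2M (SU2_ctr sV) sU.
have [/unitarymxP VV _] := sV; have [] := double_cover_eq1 sVU.
- rewrite (double_coverM (SU2_ctr sV) sU) (double_cover_ctr sV) DUV.
  exact: SO3_tr (double_cover_SO3 sV).
- by move=> E; left; rewrite -[U]mul1mx -VV -mulmxA E mulmx1.
by move=> E; right; rewrite -[U]mul1mx -VV -mulmxA E mulmxN mulmx1.
Qed.

Definition e3 : 'cV[R]_3 := cv3 0 0 1.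

(** The half-turn about the bisector of u and e3, the vector u + e3 of squared length 2 + 2 u_2. For
    u = -e3 this vector is zero, and the half-turn about the first coordinate axis serves. *)
Lemma SU2_to_e3 u : dot u u = 1 -> exists2 U, SU2 U & double_cover U *m u = e3.
Proof.
move=> u1; have [u2|u2] := eqVneq (u o32 0) (-1).
  exists (quat 0 (cv3 1 0 0)); first by apply/SU2_quatP; exists 0, (cv3 1 0 0); rewrite /dot ?mxE /=; split=> //; ring.
  move: u1; rewrite /dot u2 => u1.
  have u0 : u o30 0 = 0 by nra.
  have {}u1 : u o31 0 = 0 by nra.
  rewrite double_coverE rotqE [LHS]cv3P /e3 !mxE /= /dot ?mxE /= u0 u1 u2; congr cv3; ring.
have u2_gt : 0 < 2 + 2 * u o32 0.
  rewrite lt_def; apply/andP; split; last by move: u1; rewrite /dot; nra.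
  by apply: contra u2 => /eqP E; apply/eqP; lra.
pose r := Num.sqrt (2 + 2 * u o32 0).
have rr : r ^+ 2 = 2 + 2 * u o32 0 by rewrite sqr_sqrtr // ltW.
have r0 : r != 0 by rewrite sqrtr_eq0 -ltNge.
pose n := r^-1 *: (u + e3).
have uu : dot (u + e3) (u + e3) = 2 + 2 * u o32 0.
  by move: u1; rewrite /dot /e3 !mxE /=; lra.
have nn : dot n n = 1.
  rewrite /n dotZl dotZr mulrA -expr2 exprVn rr uu mulVf //.
  by rewrite gt_eqF.
exists (quat 0 n); first by apply/SU2_quatP; exists 0, n; rewrite nn expr0n add0r.
rewrite double_coverE rotqE nn mulr0 scale0r subr0 expr0n sub0r scaleN1r.
have -> : 2 * dot n u = r^-1 * (2 + 2 * u o32 0).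
  by rewrite /n dotZl dotDl u1 /dot /e3 !mxE /=; ring.
rewrite /n scalerA mulrAC -expr2 exprVn rr mulVf ?gt_eqF // scale1r.
by rewrite addrA addNr add0r.
Qed.

(** [SU2_to_e3] reduces to rotations fixing e3, which are rotations of the plane and lift by halving
    the angle. *)
Lemma double_cover_surj A : SO3 A -> exists2 U, SU2 U & double_cover U = A.
Proof.
suff fix3 B : SO3 B -> B *m e3 = e3 -> exists2 U, SU2 U & double_cover U = B.
  move=> sA; have [|U1 sU1 U1e] := @SU2_to_e3 (A *m e3).
    by rewrite dot_mulmx ?SO3_tr // /dot /e3 !mxE /=; ring.
  have sD1 := double_cover_SO3 sU1.
  have [||U2 sU2 U2E] := fix3 (double_cover U1 *m A); first exact: SO3M.
    by rewrite -mulmxA.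
  exists (U1 ^t* *m U2); first by apply: SU2M => //; apply: SU2_ctr.
  by rewrite (double_coverM (SU2_ctr sU1) sU2) (double_cover_ctr sU1) U2E mulmxA SO3_tr ?mul1mx.
move=> sB Be; have BTe : B^T *m e3 = e3 by rewrite -{1}Be mulmxA SO3_tr // mul1mx.
have c2 : [/\ B o30 o32 = 0, B o31 o32 = 0 & B o32 o32 = 1].
  have := (congr1 (fun v : 'cV_3 => v o30 0) Be, congr1 (fun v : 'cV_3 => v o31 0) Be,
           congr1 (fun v : 'cV_3 => v o32 0) Be).
  by rewrite /e3 !mxE !sum3 !mxE /= !mulr0 !mulr1 !add0r => -[[]].
have r2 : [/\ B o32 o30 = 0 & B o32 o31 = 0].
  have := (congr1 (fun v : 'cV_3 => v o30 0) BTe, congr1 (fun v : 'cV_3 => v o31 0) BTe).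
  by rewrite /e3 !mxE !sum3 !mxE /= !mulr0 !mulr1 !add0r => -[].
case: c2 r2 => c0 c1 c2 [r0 r1].
have [n00 n11 n01] : [/\ B o30 o30 ^+ 2 + B o30 o31 ^+ 2 = 1,
    B o31 o30 ^+ 2 + B o31 o31 ^+ 2 = 1 & \det B = 1].
  case: sB => /matrixP BB dB; have := (BB o30 o30, BB o31 o31).
  by rewrite !mxE !sum3 !mxE /= c0 c1 !mulr0 !addr0 -!expr2 => -[].
move: n01; rewrite det_mx3 c0 c1 c2 r0 r1 !(mulr0, mul0r, subr0, mulr1, addr0) => dB.
(* The plane block has unit rows and determinant 1, so this sum of squares expands to 1 + 1 - 2. *)
have : (B o31 o31 - B o30 o30) ^+ 2 + (B o30 o31 + B o31 o30) ^+ 2 = 0.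
  by move: n00 n11 dB; rewrite !expr2 => n00 n11 dB; lra.
move/eqP; rewrite paddr_eq0 ?sqr_ge0 // !sqrf_eq0 subr_eq0 addr_eq0.
case/andP=> /eqP e11 /eqP e01.
(* The block is multiplication by a complex number of modulus 1; its square root halves the
   angle. *)
pose w : R[i] := sqrtc (B o30 o30 +i* B o31 o30).
have ww : w ^+ 2 = B o30 o30 +i* B o31 o30 by rewrite sqr_sqrtc.
case: w ww => al be; rewrite expr2 complexM => -[wr wi].
have nw : al ^+ 2 + be ^+ 2 = 1.
  have : (al ^+ 2 + be ^+ 2) ^+ 2 = 1 by rewrite -n11 e11 -wr -wi; ring.
  move/eqP; rewrite sqrf_eq1 => /orP[] /eqP // neg.
  have : 0 <= al ^+ 2 + be ^+ 2 by rewrite addr_ge0 ?sqr_ge0.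
  by rewrite neg oppr_ge0 ler10.
exists (quat al (cv3 0 0 (- be))).
  by apply/SU2_quatP; exists al, (cv3 0 0 (- be)); split=> //; rewrite -nw /dot ?mxE /=; ring.
rewrite double_coverE; apply/matrixP; apply: ord3P; apply: ord3P;
  rewrite !mxE /= /dot ?mxE /= ?c0 ?c1 ?c2 ?r0 ?r1 ?e11 ?e01 -?wr -?wi; try ring.
by rewrite -[RHS]nw; ring.
Qed.

End Rotations.

Local Open Scope classical_set_scope.

(** * Frames, vertices and plane rotations *)

Section Frames.

Variable R : realType.
Implicit Types (u v p q : 'cV[R]_3).

Definition mat3 p1 p2 p3 : 'M[R]_3 :=
  \matrix_(i, j) (match val j with 0%N => p1 | 1%N => p2 | _ => p3 end) i 0.

Lemma mat3_col p1 p2 p3 : [/\ mat3 p1 p2 p3 *m delta_mx o30 0 = p1,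
  mat3 p1 p2 p3 *m delta_mx o31 0 = p2 & mat3 p1 p2 p3 *m delta_mx o32 0 = p3].
Proof. by split; rewrite -colE; apply/colP => i; rewrite !mxE. Qed.

Lemma det_mat3 p1 p2 p3 : \det (mat3 p1 p2 p3) = dot (cross p1 p2) p3.
Proof. by rewrite det_mx3 /mat3 /cross /dot !mxE /=; ring. Qed.

Lemma gram_mat3 p1 p2 p3 : (mat3 p1 p2 p3)^T *m mat3 p1 p2 p3 =
  \matrix_(i, j) dot (match val i with 0%N => p1 | 1%N => p2 | _ => p3 end)
                     (match val j with 0%N => p1 | 1%N => p2 | _ => p3 end).
Proof. by apply/matrixP => i j; rewrite !mxE sum3 !mxE. Qed.

(** Take A = Q P^-1 for the matrices with these columns: equal Gram matrices make A orthogonal, and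
    equal orientations give it determinant 1. *)
Lemma frame_map p1 p2 p3 q1 q2 q3 :
    dot p1 p1 = dot q1 q1 -> dot p2 p2 = dot q2 q2 -> dot p3 p3 = dot q3 q3 ->
    dot p1 p2 = dot q1 q2 -> dot p1 p3 = dot q1 q3 -> dot p2 p3 = dot q2 q3 ->
    0 < dot (cross p1 p2) p3 * dot (cross q1 q2) q3 ->
  exists2 A, SO3 A & [/\ A *m p1 = q1, A *m p2 = q2 & A *m p3 = q3].
Proof.
move=> e11 e22 e33 e12 e13 e23 pos.
pose Pm := mat3 p1 p2 p3; pose Qm := mat3 q1 q2 q3.
have PQ : Pm^T *m Pm = Qm^T *m Qm.
  rewrite !gram_mat3; apply/matrixP; apply: ord3P; apply: ord3P; rewrite !mxE //=.
  - by rewrite dotC e12 dotC.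
  - by rewrite dotC e13 dotC.
  by rewrite dotC e23 dotC.
have dP : \det Pm != 0 by rewrite det_mat3; apply: contraTneq pos => ->; rewrite mul0r ltxx.
have uP : Pm \in unitmx by rewrite unitmxE unitfE.
pose A := Qm *m invmx Pm; have AP : A *m Pm = Qm by rewrite /A mulmxKV.
have uPT : Pm^T \in unitmx by rewrite unitmx_tr.
have AA : A^T *m A = 1%:M.
  apply: (can_inj (mulmxK uP)); apply: (can_inj (mulKmx uPT)).
  by rewrite mul1mx -(mulmxA A^T) AP mulmxA -trmx_mul AP PQ.
have dA : \det A = 1.
  have dA2 : \det A ^+ 2 == 1 by rewrite expr2 -{1}det_tr -det_mulmx AA det1.
  have dAE : \det A * \det Pm = \det Qm by rewrite -det_mulmx AP.
  move: dA2; rewrite sqrf_eq1 => /orP[] /eqP // dA1; move: pos.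
  rewrite -!det_mat3 -/Pm -/Qm -dAE dA1 mulN1r mulrN oppr_gt0 => /lt_geF.
  by rewrite -expr2 sqr_ge0.
have [c1 c2 c3] := mat3_col p1 p2 p3; have [d1 d2 d3] := mat3_col q1 q2 q3.
exists A; first by split=> //; apply: mulmx1C.
by rewrite -[in A *m p1]c1 -[in A *m p2]c2 -[in A *m p3]c3 !mulmxA AP.
Qed.

Lemma triple_swap p1 p2 p3 : dot (cross p1 p3) p2 = - dot (cross p1 p2) p3.
Proof. by rewrite /dot /cross !mxE /=; ring. Qed.

(** The Gram determinant: up to sign, the triple product depends on the inner products only. *)
Lemma triple_sq p1 p2 p3 : dot (cross p1 p2) p3 ^+ 2 =
  dot p1 p1 * (dot p2 p2 * dot p3 p3 - dot p2 p3 ^+ 2)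
  - dot p1 p2 * (dot p1 p2 * dot p3 p3 - dot p2 p3 * dot p1 p3)
  + dot p1 p3 * (dot p1 p2 * dot p2 p3 - dot p2 p2 * dot p1 p3).
Proof. by rewrite /dot /cross !mxE /=; ring. Qed.

Lemma dot_unit_eq u v : dot u u = 1 -> dot v v = 1 -> dot u v = 1 -> u = v.
Proof.
move=> u1 v1 uv; apply/eqP; rewrite -subr_eq0 -dot_eq0; apply/eqP.
transitivity (dot u u + dot v v - 2 * dot u v); first by rewrite /dot !mxE; ring.
by rewrite u1 v1 uv; ring.
Qed.

Lemma dot_sum (I : finType) (Q : pred I) (F : I -> 'cV[R]_3) v :
  dot (\sum_(i | Q i) F i) v = \sum_(i | Q i) dot (F i) v.
Proof.
rewrite dotE linear_sum mulmx_suml summxE.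
by apply: eq_bigr => i _; rewrite -dotE.
Qed.

(** Exchanging q2 and q3 keeps the Gram matrix, since all mutual inner products are m, and reverses
    the orientation; so a proper rotation exists up to this exchange. *)
Lemma equi_frame n m p1 p2 p3 q1 q2 q3 :
    dot p1 p1 = n -> dot p2 p2 = n -> dot p3 p3 = n ->
    dot p1 p2 = m -> dot p1 p3 = m -> dot p2 p3 = m ->
    dot q1 q1 = n -> dot q2 q2 = n -> dot q3 q3 = n ->
    dot q1 q2 = m -> dot q1 q3 = m -> dot q2 q3 = m ->
    dot (cross q1 q2) q3 != 0 ->
  exists2 A, SO3 A & A *m p1 = q1 /\
    ((A *m p2 = q2 /\ A *m p3 = q3) \/ (A *m p2 = q3 /\ A *m p3 = q2)).
Proof.
move=> p11 p22 p33 p12 p13 p23 q11 q22 q33 q12 q13 q23 tq.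
have tpq : dot (cross p1 p2) p3 ^+ 2 = dot (cross q1 q2) q3 ^+ 2.
  by rewrite !triple_sq p11 p22 p33 p12 p13 p23 q11 q22 q33 q12 q13 q23.
have t0 : dot (cross p1 p2) p3 * dot (cross q1 q2) q3 != 0.
  by rewrite mulf_neq0 // -sqrf_eq0 tpq sqrf_eq0.
have [pos|neg|eq0] := ltgtP 0 (dot (cross p1 p2) p3 * dot (cross q1 q2) q3).
- have [|||||||A sA [A1 A2 A3]] := @frame_map p1 p2 p3 q1 q2 q3; rewrite ?p11 ?p22 ?p33 ?p12 ?p13 ?p23 //.
  by exists A => //; split=> //; left.
- have [|||||||A sA [A1 A2 A3]] := @frame_map p1 p2 p3 q1 q3 q2;
    rewrite ?p11 ?p22 ?p33 ?p12 ?p13 ?p23 // ?[dot q3 q2]dotC ?q23 //.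
    by rewrite (triple_swap q1 q2 q3) mulrN oppr_gt0.
  by exists A => //; split=> //; right.
by rewrite -eq0 eqxx in t0.
Qed.

End Frames.

Lemma avoid_two (T : finType) (A : {set T}) a b : (2 < #|A|)%N ->
  exists2 x, x \in A & (x != a) && (x != b).
Proof.
move=> A2; have [x] : exists x, x \in A :\: [set a; b]%SET.
  apply/finset.set0Pn; rewrite -card_gt0 cardsD subn_gt0.
  apply: leq_trans A2; rewrite ltnS; apply: leq_trans (subset_leq_card (subsetIr _ _)) _.
  by rewrite cards2; case: (_ != _).
case/finset.setDP=> Ax; rewrite in_set2 negb_or => xab.
by exists x.
Qed.

Section GoldenRatio.

Variable R : realType.

Lemma dotDr (u v w : 'cV[R]_3) : dot u (v + w) = dot u v + dot u w.
Proof. by rewrite !(dotC u) dotDl. Qed.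

Lemma dot3_inj (q1 q2 q3 v w : 'cV[R]_3) : dot (cross q1 q2) q3 != 0 ->
  dot v q1 = dot w q1 -> dot v q2 = dot w q2 -> dot v q3 = dot w q3 -> v = w.
Proof.
rewrite -det_mat3 -unitfE -unitmxE -unitmx_tr => uQ e1 e2 e3.
apply: (can_inj (mulKmx uQ)); apply/colP; apply: ord3P; rewrite !mxE !sum3 !mxE /=.
- by move: e1; rewrite /dot !(mulrC (q1 _ _)).
- by move: e2; rewrite /dot !(mulrC (q2 _ _)).
by move: e3; rewrite /dot !(mulrC (q3 _ _)).
Qed.

Definition golden : R := (1 + Num.sqrt 5) / 2.

Lemma golden_sq : golden * golden = golden + 1.
Proof.
have := sqr_sqrtr (ler0n R 5); rewrite /golden expr2; move: (Num.sqrt _) => r.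
by move=> E; lra.
Qed.

Lemma golden_gt1 : 1 < golden.
Proof.
have : 1 < Num.sqrt 5 :> R by rewrite -[ltLHS]sqrtr1 ltr_sqrt; lra.
by rewrite /golden; lra.
Qed.

(** A vertex of the icosahedron has squared length a + 2, and inner product a with an adjacent one,
    so e is the cosine between them; and (a + 2)^2 = 5 (a + 1) = 5 a^2. *)
Lemma golden_height (a e : R) : a * a = a + 1 -> 1 < a -> (a + 2) * e = a -> e * e = 5^-1.
Proof.
move=> sq gt1 ae.
have E : (a + 2) * e * ((a + 2) * e) = a * a by rewrite ae.
have sqe := congr1 (fun w => w * (e * e)) sq.
have /eqP : (e * e - 5^-1) * (5 * (a + 1)) = 0 by move: E sq sqe => /= E sq sqe; lra.
by rewrite mulf_eq0 => /orP[|/eqP]; [rewrite subr_eq0 => /eqP | lra].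
Qed.

Definition icosa_vertex (i : 'I_3 * bool * bool) : 'cV[R]_3 :=
  (-1) ^+ i.1.2 *: delta_mx (i.1.1 + 1) 0 + ((-1) ^+ i.2 * golden) *: delta_mx (i.1.1 + 2) 0.

Lemma icosahedronE : @icosahedron R = [set v | exists i, v = icosa_vertex i].
Proof.
apply/seteqP; split=> v /= [j]; first by case=> [s [t ->]]; exists (j, s, t).
by case: j => [[j s] t] ->; exists j, s, t.
Qed.

Lemma icosa_vertex_cv3 s t :
  [/\ icosa_vertex (o30, s, t) = cv3 0 ((-1) ^+ s) ((-1) ^+ t * golden),
      icosa_vertex (o31, s, t) = cv3 ((-1) ^+ t * golden) 0 ((-1) ^+ s)
    & icosa_vertex (o32, s, t) = cv3 ((-1) ^+ s) ((-1) ^+ t * golden) 0].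
Proof.
by split; apply/colP; apply: ord3P; rewrite !mxE /= ?mulr0 ?mulr1 ?addr0 ?add0r.
Qed.

(** [q1], [q2], [q3] are the vertices of one face of the icosahedron. *)
Let q1 : 'cV[R]_3 := cv3 1 golden 0.
Let q2 : 'cV[R]_3 := cv3 0 1 golden.
Let q3 : 'cV[R]_3 := cv3 golden 0 1.

Lemma icosa_triple : dot (cross q1 q2) q3 != 0.
Proof.
rewrite /dot /cross !mxE /= gt_eqF //; have := golden_gt1; have := golden_sq.
by move: golden => a; nra.
Qed.

(** Three inner products determine v. Six of the eight sign patterns are those of the six vertices
    outside the face and its opposite; the two constant patterns give a vector of the wrong
    length. *)
Lemma icosa_vertexP v : dot v v = golden + 2 ->
    (dot v q1 = golden \/ dot v q1 = - golden) ->
    (dot v q2 = golden \/ dot v q2 = - golden) ->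
    (dot v q3 = golden \/ dot v q3 = - golden) ->
  exists i, v = icosa_vertex i.
Proof.
have sq := golden_sq; have gt1 := golden_gt1.
have cube : golden * golden * golden = 2 * golden + 1 by rewrite sq mulrDl sq; ring.
have vE w : dot v q1 = dot w q1 -> dot v q2 = dot w q2 -> dot v q3 = dot w q3 -> v = w.
  exact: dot3_inj icosa_triple.
move=> vv d1 d2 d3.
(* Equal signs put v on the line through the centre of the face, with squared length 3 (golden -
   1)^2 in place of golden + 2. *)
have same e : dot v q1 = e * golden -> dot v q2 = e * golden -> dot v q3 = e * golden -> e ^+ 2 = 1 -> False.
  move=> e1 e2 e3 e4.
  have E : v = (e * (golden - 1)) *: cv3 1 1 1.
    apply: vE; rewrite ?e1 ?e2 ?e3 /dot !mxE /=; move: sq; move: golden => a sq.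
    - by transitivity (e * (a * a - 1)); [rewrite sq; ring | ring].
    - by transitivity (e * (a * a - 1)); [rewrite sq; ring | ring].
    - by transitivity (e * (a * a - 1)); [rewrite sq; ring | ring].
  have : e ^+ 2 * (3 * (golden * golden - 2 * golden + 1)) = golden + 2.
    by rewrite -vv E /dot !mxE /=; ring.
  by rewrite e4 sq; lra.
have vert0 s t : icosa_vertex (o30, s, t) = cv3 0 ((-1) ^+ s) ((-1) ^+ t * golden).
  by case: (icosa_vertex_cv3 s t).
have vert1 s t : icosa_vertex (o31, s, t) = cv3 ((-1) ^+ t * golden) 0 ((-1) ^+ s).
  by case: (icosa_vertex_cv3 s t).
have vert2 s t : icosa_vertex (o32, s, t) = cv3 ((-1) ^+ s) ((-1) ^+ t * golden) 0.
  by case: (icosa_vertex_cv3 s t).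
have fin i : dot v q1 = dot (icosa_vertex i) q1 -> dot v q2 = dot (icosa_vertex i) q2 ->
   dot v q3 = dot (icosa_vertex i) q3 -> exists i, v = icosa_vertex i.
  by move=> f1 f2 f3; exists i; apply: vE.
case: d1 d2 d3 => e1 [] e2 [] e3.
- by case: (same 1); rewrite ?mul1r ?expr1n.
- by apply: (fin (o32, true, false)); rewrite vert2 ?e1 ?e2 ?e3 /dot !mxE /=; lra.
- by apply: (fin (o31, true, false)); rewrite vert1 ?e1 ?e2 ?e3 /dot !mxE /=; lra.
- by apply: (fin (o30, false, true)); rewrite vert0 ?e1 ?e2 ?e3 /dot !mxE /=; lra.
- by apply: (fin (o30, true, false)); rewrite vert0 ?e1 ?e2 ?e3 /dot !mxE /=; lra.
- by apply: (fin (o31, false, true)); rewrite vert1 ?e1 ?e2 ?e3 /dot !mxE /=; lra.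
- by apply: (fin (o32, false, true)); rewrite vert2 ?e1 ?e2 ?e3 /dot !mxE /=; lra.
by case: (same (-1)); rewrite ?mulN1r ?sqrrN ?expr1n.
Qed.

End GoldenRatio.

Section PlaneRotations.

Variable R : realType.
Implicit Types (t : R) (k m n : nat).

Definition cis t : R[i] := cos t +i* sin t.

Lemma cisD t (x : R) : cis (t + x) = cis t * cis x.
Proof. by rewrite /cis cosD sinD complexM; congr Complex; ring. Qed.

Lemma cis0 : cis 0 = 1.
Proof. by rewrite /cis cos0 sin0. Qed.

Lemma cisX t k : cis t ^+ k = cis (k%:R * t).
Proof.
elim: k => [|k IHk]; first by rewrite expr0 mul0r cis0.
by rewrite exprS IHk -cisD -[k.+1%:R]natr1; congr cis; ring.
Qed.

Lemma cis2pi : cis (2 * pi) = 1.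
Proof. by rewrite /cis mulr_natl cos2pi sin2pi. Qed.

Definition angle m k : R := 2 * pi * k%:R / m%:R.

Lemma cis_angle m k : cis (angle m k) = cis (angle m 1) ^+ k.
Proof. by rewrite cisX /angle; congr cis; ring. Qed.

(** For 0 < k < m the half-angle x = pi k / m has sin x > 0, so cos 2x = 1 - 2 (sin x)^2 is not
    1. *)
Lemma cis_prim m : (0 < m)%N -> m.-primitive_root (cis (angle m 1)).
Proof.
move=> m0; have mR : 0 < m%:R :> R by rewrite ltr0n.
apply/andP; split=> //; apply/forallP => i; apply/eqP.
have -> : (i.+1.-unity_root (cis (angle m 1))) = (cis (angle m i.+1) == 1).
  by rewrite unity_rootE (cis_angle m i.+1).
have [->|im] := eqVneq i.+1 m.
  by rewrite /angle mulfK ?lt0r_neq0 // cis2pi eqxx.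
have {im} : (i.+1 < m)%N by rewrite ltn_neqAle im ltn_ord.
rewrite -(ltr_nat R) => im; apply/negP => /eqP[c1 _].
pose x : R := pi * i.+1%:R / m%:R.
have x2 : angle m i.+1 = x *+ 2 by rewrite /angle /x -mulr_natr; ring.
have : 0 < sin x.
  apply: sin_gt0_pi; rewrite /x; apply/andP; split.
    by rewrite divr_gt0 ?mulr_gt0 ?pi_gt0 ?ltr0n.
  by rewrite ltr_pdivrMr // ltr_pM2l ?pi_gt0.
move: c1; rewrite x2 cos_mulr2n cos2sin2; move: (sin x) => y; nra.
Qed.

(** The values of u are |K| distinct roots of X^|K| - 1, hence all of them. *)
Lemma hom_roots (gT : finGroupType) (K : {group gT}) (u : gT -> R[i]) :
    u 1%g = 1 -> {in K &, forall x y, u (x * y)%g = u x * u y} ->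
    {in K &, injective u} ->
  (forall x, x \in K -> exists k, u x = cis (angle #|K| k)) /\
  (forall k, exists2 x, x \in K & u x = cis (angle #|K| k)).
Proof.
move=> u1 uM injU; have K0 := cardG_gt0 K; have prim := cis_prim K0.
have uX x k : x \in K -> u (x ^+ k)%g = u x ^+ k.
  move=> Kx; elim: k => [|k IHk]; first by rewrite expg0 expr0.
  by rewrite expgS exprS uM ?groupX // IHk.
have uN x : x \in K -> u x ^+ #|K| = 1 by move=> Kx; rewrite -uX // expg_cardG.
split=> [x Kx|k].
  by have [j ->] := prim_rootP prim (uN x Kx); exists j; rewrite -cis_angle.
apply: contrapT => no; pose rs := [seq u x | x <- enum K].
have /max_poly_roots : 'X^#|K| - 1 != 0 :> {poly R[i]}.
  by rewrite -size_poly_gt0 size_XnsubC.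
move/(_ (cis (angle #|K| k) :: rs)); rewrite size_XnsubC //= size_map -cardE ltnn.
have nin : cis (angle #|K| k) \notin rs.
  apply/negP => /mapP[x]; rewrite mem_enum => Kx E; apply: no; exists x => //.
rewrite /= nin map_inj_in_uniq ?enum_uniq => [|x y]; last by rewrite !mem_enum; apply: injU.
have rt w : root ('X^#|K| - 1) w = (w ^+ #|K| == 1) :> bool.
  by rewrite /root !hornerE hornerXn subr_eq0.
have -> : root ('X^#|K| - 1) (cis (angle #|K| k)).
  by rewrite rt cis_angle exprAC (prim_expr_order prim) expr1n.
have -> : all (root ('X^#|K| - 1)) rs.
  by apply/allP => w /mapP[x]; rewrite mem_enum => Kx ->; rewrite rt uN.
by move/(_ isT isT).
Qed.

Definition rot2 t : 'M[R]_2 := mx2 (cos t) (- sin t) (sin t) (cos t).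
Definition ref2 t : 'M[R]_2 := mx2 (cos t) (sin t) (sin t) (- cos t).

Lemma angleD m k n : angle m (k + n) = angle m k + angle m n.
Proof. by rewrite /angle natrD; ring. Qed.

Lemma cos_angleDm m k : (0 < m)%N -> cos (angle m (k + m)) = cos (angle m k).
Proof.
move=> m0; rewrite angleD /angle mulfK ?pnatr_eq0 ?lt0n_neq0 // mulr_natl.
exact: cosD2pi.
Qed.

Lemma sin_angleDm m k : (0 < m)%N -> sin (angle m (k + m)) = sin (angle m k).
Proof.
move=> m0; rewrite angleD /angle mulfK ?pnatr_eq0 ?lt0n_neq0 // mulr_natl.
exact: sinD2pi.
Qed.

Definition vertex m k : 'cV[R]_2 := cos (angle m k) *: delta_mx 0 0 + sin (angle m k) *: delta_mx 1 0.

Lemma vertexP m k : vertex m k o20 0 = cos (angle m k) /\ vertex m k o21 0 = sin (angle m k).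
Proof. by rewrite /vertex !mxE /= !mulr1 !mulr0 addr0 add0r. Qed.

Lemma colP2 (v w : 'cV[R]_2) : v o20 0 = w o20 0 -> v o21 0 = w o21 0 -> v = w.
Proof. by move=> e0 e1; apply/colP; apply: ord2P. Qed.

Lemma polygonP m v : (0 < m)%N -> polygon m v <-> exists k, v = vertex m k.
Proof.
move=> m0; split=> [[k _ ->]|[k ->]]; first by exists k.
exists (k %% m)%N; first exact: ltn_pmod.
rewrite {1}(divn_eq k m); elim: (k %/ m)%N => [|j <-]; first by rewrite mul0n add0n.
have -> : (j.+1 * m + k %% m = j * m + k %% m + m)%N by lia.
by rewrite /vertex cos_angleDm // sin_angleDm.
Qed.

Lemma rot2_vertex m j k : rot2 (angle m j) *m vertex m k = vertex m (j + k).
Proof.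
have [v0 v1] := vertexP m k; have [w0 w1] := vertexP m (j + k).
apply: colP2; rewrite ?w0 ?w1 [LHS]mxE sum2 v0 v1 !mxE /= angleD ?cosD ?sinD; ring.
Qed.

Lemma angleNm m k : (0 < m)%N -> (k <= m)%N ->
  cos (angle m (m - k)) = cos (angle m k) /\ sin (angle m (m - k)) = - sin (angle m k).
Proof.
move=> m0 km; have E : angle m (m - k) = - angle m k + pi *+ 2.
  by rewrite /angle natrB // mulrBr mulrBl mulfK ?pnatr_eq0 ?lt0n_neq0 // -mulr_natl; ring.
by rewrite E cosD2pi sinD2pi cosN sinN.
Qed.

Lemma ref2_vertex m j k : (0 < m)%N -> (k <= m)%N ->
  ref2 (angle m j) *m vertex m k = vertex m (j + (m - k)).
Proof.
move=> m0 km; have [v0 v1] := vertexP m k; have [w0 w1] := vertexP m (j + (m - k)).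
have [c1 s1] := angleNm m0 km.
apply: colP2; rewrite ?w0 ?w1 [LHS]mxE sum2 v0 v1 !mxE /= angleD ?cosD ?sinD c1 s1; ring.
Qed.

Lemma mx2_1 (F : pzSemiRingType) : 1%:M = mx2 1 0 0 1 :> 'M[F]_2.
Proof. by apply/matrixP; apply: ord2P; apply: ord2P; rewrite !mxE. Qed.

Lemma rot2_ortho t : rot2 t *m (rot2 t)^T = 1%:M.
Proof.
rewrite /rot2 trmx_mx2 mx2M mx2_1; have := cos2Dsin2 t; rewrite !expr2 => E.
by congr mx2; rewrite -?E; ring.
Qed.

Lemma ref2_ortho t : ref2 t *m (ref2 t)^T = 1%:M.
Proof.
rewrite /ref2 trmx_mx2 mx2M mx2_1; have := cos2Dsin2 t; rewrite !expr2 => E.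
by congr mx2; rewrite -?E; ring.
Qed.

Lemma ref2_inv t : ref2 t *m ref2 t = 1%:M.
Proof. by rewrite -[X in _ *m X](_ : (ref2 t)^T = _) ?ref2_ortho // /ref2 trmx_mx2. Qed.

Lemma vertex_lt m k : (0 < m)%N -> exists2 j, (j < m)%N & vertex m k = vertex m j.
Proof.
move=> m0; have [|j jm E] := proj2 (polygonP (vertex m k) m0); first by exists k.
by exists j.
Qed.

(** A symmetry is determined by the image of vertex 0 and by its determinant. Rotations are listed
    with negative angles to agree with [rotq_blk]; as k runs over all naturals, the set is the
    same. *)
Lemma DihP m A : (0 < m)%N ->
  Dih m A <-> exists k, A = rot2 (- angle m k) \/ A = ref2 (angle m k).
Proof.
move=> m0; have rotN k : (k <= m)%N -> rot2 (- angle m k) = rot2 (angle m (m - k)).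
  by move=> km; have [c1 s1] := angleNm m0 km; rewrite /rot2 cosN sinN c1 s1.
split=> [[AA AV]|[k AE]].
  have [k km Ak] : exists2 k, (k < m)%N & A *m vertex m 0 = vertex m k.
    have : [set A *m v | v in polygon m] (A *m vertex m 0).
      by exists (vertex m 0) => //; apply/(polygonP _ m0); exists 0%N.
    by rewrite AV => /(polygonP _ m0)[k ->]; apply: vertex_lt.
  have [a0 a1] : A o20 o20 = cos (angle m k) /\ A o21 o20 = sin (angle m k).
    have [v0 v1] := vertexP m 0; have [w0 w1] := vertexP m k.
    rewrite -w0 -w1 -Ak !mxE !sum2 v0 v1 /angle mulr0 mul0r cos0 sin0 !mulr1 !mulr0 !addr0.
    by [].
  have /matrixP AA' := mulmx1C AA.
  have := (AA' o20 o21, AA' o21 o21); rewrite !mxE !sum2 !mxE /= a0 a1 => -[e01 e11].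
  have cs := cos2Dsin2 (angle m k).
  have AE : A = mx2 (cos (angle m k)) (A o20 o21) (sin (angle m k)) (A o21 o21).
    by rewrite {1}[A]mx2P a0 a1.
  (* [D] is the determinant of A; by orthogonality the second column is D times the first one turned
     by a right angle. *)
  set D := cos (angle m k) * A o21 o21 - sin (angle m k) * A o20 o21.
  have [eE bE /eqP] : [/\ A o21 o21 = cos (angle m k) * D, A o20 o21 = - sin (angle m k) * D & D ^+ 2 = 1].
    rewrite /D; move: e01 e11 cs; move: (A o20 o21) (A o21 o21) (cos _) (sin _) => b e c y e01 e11 cs.
    split; first by transitivity (e * (c ^+ 2 + y ^+ 2) - y * (c * b + y * e)); [rewrite cs e01 | ]; ring.
      by transitivity (b * (c ^+ 2 + y ^+ 2) - c * (c * b + y * e)); [rewrite cs e01 | ]; ring.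
    transitivity ((c ^+ 2 + y ^+ 2) * (b * b + e * e) - (c * b + y * e) ^+ 2); last by rewrite cs e11 e01; ring.
    by ring.
  rewrite sqrf_eq1 => /orP[] /eqP dE.
    exists (m - k)%N; left; rewrite rotN ?leq_subr // subKn 1?ltnW // /rot2 AE.
    by rewrite eE bE dE !mulr1.
  by exists k; right; rewrite /ref2 AE eE bE dE !mulrN1 opprK.
have {AE} [j jm AE] : exists2 j, (j <= m)%N & A = rot2 (angle m j) \/ A = ref2 (angle m j).
  have [j jm kj] := vertex_lt k m0.
  have [v0 v1] := vertexP m k; have [w0 w1] := vertexP m j; rewrite kj w0 in v0; rewrite kj w1 in v1.
  case: AE => ->; [exists (m - j)%N; first exact: leq_subr | exists j; first exact: ltnW].
    by left; rewrite -rotN 1?ltnW // /rot2 !cosN !sinN v0 v1.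
  by right; rewrite /ref2 v0 v1.
split; first by case: AE => ->; [apply: rot2_ortho | apply: ref2_ortho].
apply/seteqP; split=> [_ [v /(polygonP _ m0)[i ->] <-]|v /(polygonP _ m0)[i ->]];
  have [l lm ->] := vertex_lt i m0; case: AE => ->.
- by rewrite rot2_vertex; apply/(polygonP _ m0); eexists.
- by rewrite (ref2_vertex _ m0 (ltnW lm)); apply/(polygonP _ m0); eexists.
- exists (vertex m (m - j + l)); first by apply/(polygonP _ m0); eexists.
  rewrite rot2_vertex addnA subnKC //.
  by rewrite addnC /vertex cos_angleDm // sin_angleDm.
exists (ref2 (angle m j) *m vertex m l).
  by rewrite (ref2_vertex _ m0 (ltnW lm)); apply/(polygonP _ m0); eexists.
by rewrite mulmxA ref2_inv mul1mx.
Qed.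

End PlaneRotations.

Lemma faithful_inj (F : fieldType) (gT : finGroupType) (G : {group gT}) d
    (s : mx_representation F G d) g h :
    (forall g, g \in G -> s g = 1%:M -> g = 1%g) ->
  g \in G -> h \in G -> s g = s h -> g = h.
Proof.
move=> s_faithful Gg Gh sgh; apply: (mulIg h^-1%g); rewrite mulgV; apply: s_faithful.
  by rewrite groupM ?groupV.
by rewrite repr_mxM ?groupV // sgh -repr_mxM ?groupV // mulgV repr_mx1.
Qed.

Lemma conj_iso (F : fieldType) (gT : finGroupType) (G : {group gT}) d
    (s : mx_representation F G d) (T T' : 'M[F]_d) (H : set 'M[F]_d) :
    T *m T' = 1%:M -> (forall g, g \in G -> s g = 1%:M -> g = 1%g) ->
    (forall x, x \in G -> H (T *m s x *m T')) ->
    (forall A, H A -> exists2 k, k \in G & A = T *m s k *m T') ->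
  iso_linear_group s H.
Proof.
move=> TT s_faithful H1 H2; have TT' := mulmx1C TT.
have phiP : mx_repr G (fun g => T *m s g *m T').
  split=> [|g h Gg Gh]; first by rewrite repr_mx1 mulmx1 TT.
  by rewrite repr_mxM // !mulmxA -(mulmxA _ T' T) TT' mulmx1.
pose phi := MxRepresentation phiP.
have sim : mx_rsim s phi.
  exists T' => // [|g Gg]; first by rewrite row_free_unit; case/mulmx1_unit: TT.
  by rewrite /phi /= !mulmxA TT' mul1mx.
exists phi; split=> //.
  rewrite /mx_faithful; apply/fintype.subsetP => g /finset.setIdP[Gg]; rewrite mul1mx => /eqP pg.
  apply/set1P; apply: s_faithful => //.
  by apply: (mx_rsim_scalar Gg (mx_rsim_sym sim)) pg.
apply/seteqP; split=> [_ [g /= Gg <-]|A HA]; first exact: H1.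
by have [k Gk ->] := H2 _ HA; exists k.
Qed.

Lemma iso_linear_group_rsim (F : fieldType) (gT : finGroupType) (G : {group gT}) d
    (r s : mx_representation F G d) k (H : set 'M[F]_k) :
  mx_rsim r s -> iso_linear_group s H -> iso_linear_group r H.
Proof. by move=> sim [phi [fP HE sP]]; exists phi; split=> //; apply: mx_rsim_trans sP. Qed.

Section DihedralSO3.

Variable R : realType.

Definition blk (A : 'M[R]_2) (e : R) : 'M[R]_3 := (block_mx A 0 0 e%:M : 'M[R]_(2 + 1)).

Lemma blkM A B a b : blk A a *m blk B b = blk (A *m B) (a * b).
Proof.
rewrite /blk [LHS](mulmx_block A 0 0 a%:M B 0 0 b%:M).
by rewrite !mul0mx !mulmx0 !addr0 add0r -scalar_mxM.
Qed.

Lemma blkE a b c e f : blk (mx2 a b c e) f =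
  \matrix_(i, j) (match val i, val j with
    | 0%N, 0%N => a | 0%N, 1%N => b | 1%N, 0%N => c | 1%N, 1%N => e
    | 2%N, 2%N => f | _, _ => 0 end).
Proof.
apply/matrixP; apply: ord3P; apply: ord3P; rewrite [RHS]mxE /=.
all: rewrite !mxE; case: splitP => k /= kE; rewrite !mxE; case: splitP => l /= lE; rewrite !mxE //=.
all: move: kE lE; (try elim/ord2P: k); (try elim/ord2P: l); rewrite ?ord1 //= ?mulr1n //.
Qed.

(** A unit quaternion of angle t rotates by 2t; the minus sign comes from the sign of the cross
    product in [rotq]. *)
Lemma rotq_blk t : rotq (cos t) (sin t *: e3 R) = blk (rot2 (- (t + t))) 1.
Proof.
have cs := cos2Dsin2 t; rewrite /rot2 cosN sinN cosD sinD blkE.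
apply/matrixP; apply: ord3P; apply: ord3P; rewrite !mxE /= /dot /e3 ?mxE /= ?opprK; try ring.
by rewrite -[RHS]cs; ring.
Qed.

Lemma rotq_e1 : rotq 0 (cv3 1 0 0) = blk (mx2 1 0 0 (-1)) (-1).
Proof.
rewrite blkE; apply/matrixP; apply: ord3P; apply: ord3P; rewrite !mxE /= /dot ?mxE /=; ring.
Qed.

Lemma det_ref2 t : \det (ref2 t) = -1 :> R.
Proof. by rewrite det_mx2; have := cos2Dsin2 t; lra. Qed.

Lemma det_rot2 t : \det (rot2 t) = 1 :> R.
Proof. by rewrite det_mx2; have := cos2Dsin2 t; lra. Qed.

Lemma Dih_SO3P n A : (0 < n)%N -> Dih_SO3 n A <->
  exists k, A = blk (rot2 (- angle R n k)) 1 \/ A = blk (ref2 (angle R n k)) (-1).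
Proof.
move=> n0; split=> [[B /(DihP _ n0)[k [->|->]] <-]|[k [->|->]]].
- by exists k; left; rewrite det_rot2.
- by exists k; right; rewrite det_ref2.
- by exists (rot2 (- angle R n k)); [apply/(DihP _ n0); exists k; left | rewrite det_rot2].
by exists (ref2 (angle R n k)); [apply/(DihP _ n0); exists k; right | rewrite det_ref2].
Qed.

End DihedralSO3.

(** * Finite subgroups of SU(2) *)

Section FiniteSU2.

Variables (R : realType) (gT : finGroupType) (G : {group gT}).
Variable s : mx_representation R[i] G 2.
Hypothesis sSU2 : forall g, g \in G -> SU2 (s g).
Hypothesis s_faithful : forall g, g \in G -> s g = 1%:M -> g = 1%g.
Hypothesis s_irr : mx_irreducible s.
Variable z : gT.
Hypothesis Gz : z \in G.
Hypothesis s_z : s z = - 1%:M.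

Local Notation P := (G :\: [set 1%g; z]%SET).

Definition qre (g : gT) : R := complex.Re (s g o20 o20).
Definition qvec (g : gT) : 'cV[R]_3 :=
  cv3 (complex.Im (s g o20 o21)) (complex.Re (s g o20 o21)) (complex.Im (s g o20 o20)).
(** An oriented axis: both z g and the inverse of g have the opposite one. *)
Definition axis (g : gT) : 'cV[R]_3 := (Num.sqrt (dot (qvec g) (qvec g)))^-1 *: qvec g.
Definition rot (g : gT) : 'M[R]_3 := double_cover (s g).

Lemma rotE g : rot g = double_cover (s g). Proof. by []. Qed.

Lemma s_quat g : g \in G -> s g = quat (qre g) (qvec g) /\ qre g ^+ 2 + dot (qvec g) (qvec g) = 1.
Proof.
move=> Gg; have /SU2_quatP[a [v [sE n1]]] := sSU2 Gg.
have -> : qre g = a by rewrite /qre sE mxE.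
have -> : qvec g = v by rewrite [RHS]cv3P /qvec sE !mxE.
by [].
Qed.

Lemma s_inj g h : g \in G -> h \in G -> s g = s h -> g = h.
Proof. exact: faithful_inj. Qed.

Lemma qJ g x : g \in G -> x \in G ->
  qre (g ^ x)%g = qre g /\ qvec (g ^ x)%g = (rot x)^T *m qvec g.
Proof.
move=> Gg Gx; have [sg n1] := s_quat Gg; have [sx n1x] := s_quat Gx.
have Gxg : (g ^ x)%g \in G by rewrite groupJ.
have [sgx _] := s_quat Gxg.
have sV : s x^-1%g = (s x) ^t*.
  by rewrite repr_mxV // invmx_unitary //; case: (sSU2 Gx).
have : s (g ^ x)%g = quat (qre g) ((rot x)^T *m qvec g).
  transitivity (quat (qre x) (- qvec x) *m quat (qre g) (qvec g) *m (quat (qre x) (- qvec x)) ^t*).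
    by rewrite conjgE !repr_mxM ?groupM ?groupV // sV sg sx !quat_ctr opprK mulmxA.
  rewrite quat_conj dotNl dotNr opprK n1x mul1r.
  by rewrite /rot -(double_cover_ctr (sSU2 Gx)) sx quat_ctr double_coverE.
by rewrite sgx => /quat_inj.
Qed.

Lemma rot_SO3 x : x \in G -> SO3 (rot x).
Proof. by move=> Gx; apply/double_cover_SO3/sSU2. Qed.

Lemma rotM x y : x \in G -> y \in G -> rot (x * y)%g = rot x *m rot y.
Proof. by move=> Gx Gy; rewrite /rot repr_mxM // double_coverM //; apply: sSU2. Qed.

Lemma rotV x : x \in G -> rot x^-1%g = (rot x)^T.
Proof.
move=> Gx; rewrite /rot repr_mxV // invmx_unitary ?double_cover_ctr //; first exact: sSU2.
by case: (sSU2 Gx).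
Qed.

Lemma axisJ g x : g \in G -> x \in G -> axis (g ^ x)%g = (rot x)^T *m axis g.
Proof.
move=> Gg Gx; rewrite /axis; have [_ ->] := qJ Gg Gx.
by rewrite -scalemxAr dot_mulmx // trmxK; case: (rot_SO3 Gx).
Qed.

Lemma qvec_eq0 g : g \in G -> qvec g = 0 -> g = 1%g \/ g = z.
Proof.
move=> Gg q0; have [sg n1] := s_quat Gg; rewrite q0 in sg n1.
have : qre g ^+ 2 == 1 by rewrite -[X in _ == X]n1 /dot !mxE !mul0r !addr0.
rewrite sqrf_eq1 => /orP[] /eqP qg; [left | right]; apply: s_inj => //.
  by rewrite sg qg quat1 repr_mx1.
by rewrite sg qg s_z -quat1 quatN oppr0.
Qed.

Lemma P_G g : g \in P -> g \in G. Proof. by case/finset.setDP. Qed.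

Lemma qvec_neq0 g : g \in P -> qvec g != 0.
Proof.
case/finset.setDP=> Gg; rewrite in_set2 negb_or => /andP[g1 gz].
by apply/eqP => /(qvec_eq0 Gg)[] gE; [rewrite gE eqxx in g1 | rewrite gE eqxx in gz].
Qed.

Lemma norm_gt0 g : g \in P -> 0 < Num.sqrt (dot (qvec g) (qvec g)).
Proof. by move=> Pg; rewrite sqrtr_gt0 lt_def dot_ge0 dot_eq0 qvec_neq0. Qed.

Lemma dot_axis g : g \in P -> dot (axis g) (axis g) = 1.
Proof.
move=> Pg; rewrite /axis dotZl dotZr mulrA -expr2 exprVn sqr_sqrtr ?dot_ge0 // mulVf //.
by rewrite dot_eq0 qvec_neq0.
Qed.

Lemma axis_neq0 g : g \in P -> axis g != 0.
Proof. by move=> Pg; rewrite -dot_eq0 dot_axis // oner_eq0. Qed.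

Lemma qvecE g : g \in P -> qvec g = Num.sqrt (dot (qvec g) (qvec g)) *: axis g.
Proof. by move=> Pg; rewrite /axis scalerA divff ?scale1r // gt_eqF ?norm_gt0. Qed.

Lemma axisV g : g \in G -> axis g^-1%g = - axis g.
Proof.
move=> Gg; have [sg n1] := s_quat Gg; have [|sgV _] := @s_quat g^-1%g; first by rewrite groupV.
have : s g^-1%g = quat (qre g) (- qvec g).
  by have [sU _] := sSU2 Gg; rewrite repr_mxV // invmx_unitary // sg quat_ctr.
rewrite sgV => /quat_inj[_ qV]; rewrite /axis qV dotNl dotNr opprK scalerN //.
Qed.

Lemma sZG : [set 1%g; z]%SET \subset 'Z(G)%g.
Proof.
apply/fintype.subsetP => _ /set2P[] ->; first exact: group1.
apply/finset.setIP; split=> //; apply/centP => h Gh; apply: s_inj; rewrite ?groupM //.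
by rewrite !repr_mxM // s_z mulNmx mulmxN mul1mx mulmx1.
Qed.

Lemma sz_neq1 : z != 1%g.
Proof.
apply/eqP => z1; have := s_z; rewrite z1 repr_mx1 => /(congr1 mxtrace)/eqP.
by rewrite linearN /= mxtrace1 -addr_eq0 -natrD pnatr_eq0.
Qed.

Lemma szz1 : (z * z = 1)%g.
Proof.
by apply: s_faithful; rewrite ?groupM // repr_mxM // s_z mulNmx mulmxN opprK mulmx1.
Qed.

Lemma commute_cross g h : g \in G -> h \in G ->
  (h \in 'C[g]%g) = (cross (qvec g) (qvec h) == 0).
Proof.
move=> Gg Gh; have [sg _] := s_quat Gg; have [sh _] := s_quat Gh.
have crossN u v : cross u v = - cross v u :> 'cV[R]_3.
  by rewrite [RHS]cv3P /cross !mxE /=; congr cv3; ring.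
apply/cent1P/eqP => [gh|c0].
  have := congr1 s gh; rewrite !repr_mxM // sg sh !quatM => /quat_inj[_].
  move/eqP; rewrite -subr_eq0 => /eqP E; apply: (@scalerI _ _ 2); first by rewrite pnatr_eq0.
  rewrite scaler0 -{}E [LHS]cv3P [RHS]cv3P !mxE /=; congr cv3; ring.
apply: s_inj; rewrite ?groupM // !repr_mxM // sg sh !quatM.
congr quat; first by rewrite dotC mulrC.
by rewrite (crossN (qvec h)) c0 !oppr0 !addr0 addrC.
Qed.

(** Quaternions commute exactly when their vector parts are parallel, and parallel unit vectors
    agree up to sign. *)
Lemma axis_comm : {in P & P, forall g h,
  (h \in 'C[g]%g) = (axis h == axis g) || (axis h == axis g^-1%g)}.
Proof.
move=> g h Pg Ph; have Gg := P_G Pg; have Gh := P_G Ph.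
rewrite axisV // commute_cross //; apply/eqP/orP => [c0|].
  have [|t qh] := @cross_eq0 _ (qvec g) (qvec h) _ c0; first exact: qvec_neq0.
  have t0 : t != 0.
    by apply: contraNneq (qvec_neq0 Pg) => t0; rewrite qh t0 scale0r.
  rewrite /axis qh dotZl dotZr mulrA -expr2 sqrtrM ?sqr_ge0 // sqrtr_sqr invfM scalerA.
  have [tgt|tlt|t00] := ltgtP 0 t; last by rewrite -t00 eqxx in t0.
    by left; rewrite gtr0_norm // mulrAC mulVf // mul1r.
  by right; rewrite ltr0_norm // mulrAC invrN mulNr mulVf // mulN1r scaleNr opprK.
rewrite (qvecE Pg) (qvecE Ph) => hg.
have cZ (a b : R) u : cross (a *: u) (b *: u) = 0.
  by rewrite [RHS]cv3P /cross !mxE /=; congr cv3; ring.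
by case: hg => /eqP ->; rewrite ?scalerN -?scaleNr cZ.
Qed.

Lemma axis_conj : {in P & P & G, forall g h x, axis g = axis h -> axis (g ^ x)%g = axis (h ^ x)%g}.
Proof. by move=> g h x Pg Ph Gx gh; rewrite (axisJ (P_G Pg) Gx) (axisJ (P_G Ph) Gx) gh. Qed.

Lemma axis_inv : {in P &, forall g h, axis g = axis h -> axis g^-1%g = axis h^-1%g}.
Proof. by move=> g h Pg Ph gh; rewrite (axisV (P_G Pg)) (axisV (P_G Ph)) gh. Qed.

Lemma axis_neqV : {in P, forall g, axis g != axis g^-1%g}.
Proof.
move=> g Pg; rewrite axisV ?P_G // -subr_eq0 opprK -mulr2n -scaler_nat scaler_eq0.
by rewrite pnatr_eq0 (negPf (axis_neq0 Pg)).
Qed.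

(** Conjugation keeps the real part and the length of the vector part, so a conjugate of g with the
    same axis is g. *)
Lemma axis_fix : {in P & G, forall g x, axis (g ^ x)%g = axis g -> x \in 'C[g]%g}.
Proof.
move=> g x Pg Gx gx; have Gg := P_G Pg; have Ggx : (g ^ x)%g \in G by rewrite groupJ.
have [qe qv] := qJ Gg Gx.
have qvE : qvec (g ^ x)%g = qvec g.
  have [N qN] : exists N, qvec g = N *: axis g by eexists; apply: qvecE.
  by rewrite qv qN -scalemxAr -axisJ // gx.
apply/cent1P/esym/commgP/conjg_fixP; apply: s_inj => //.
by rewrite (proj1 (s_quat Ggx)) (proj1 (s_quat Gg)) qe qvE.
Qed.

Lemma axis_noncentral : {in P, forall g, ~~ (G \subset 'C[g]%g)}.
Proof.
move=> g Pg; apply/negP => /fintype.subsetP cG; have Gg := P_G Pg.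
have /is_scalar_mxP[c sc] : is_scalar_mx (s g).
  apply: (irr_cent_scalar s_irr) => h Gh.
  by have /cent1P gh := cG h Gh; rewrite -!repr_mxM // gh.
have [sg _] := s_quat Gg; have := qvec_neq0 Pg; case/eqP.
move: sg; rewrite sc => /matrixP E; have := (E o20 o21, E o20 o20, E o21 o21).
rewrite /quat !mxE /= mulr0n !mulr1n => -[[/esym[q1 q0] ->] [/eqP q2]].
rewrite [LHS](cv3P) [RHS]cv3P !mxE /= q0 q1; congr cv3.
by move: q2; rewrite -subr_eq0 opprK -mulr2n mulrn_eq0 /= => /eqP.
Qed.

Lemma P_nonempty : exists g, g \in P.
Proof.
apply: contrapT => noP; have pm g : g \in G -> is_scalar_mx (s g).
  move=> Gg; have : g \notin P by apply/negP => Pg; apply: noP; exists g.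
  rewrite finset.in_setD Gg andbT negbK => /set2P[] ->.
    by rewrite repr_mx1 scalar_mx_is_scalar.
  by rewrite s_z -scaleN1r scalemx1 scalar_mx_is_scalar.
have /is_scalar_mxP[c /matrixP cE] : is_scalar_mx (delta_mx o20 o20 : 'M[R[i]]_2).
  apply: (irr_cent_scalar s_irr) => g /pm/is_scalar_mxP[c ->].
  exact: scalar_mxC.
have := (cE o20 o20, cE o21 o21); rewrite !mxE /= => -[<-] /eqP.
by rewrite mulr0n mulr1n eq_sym oner_eq0.
Qed.

Local Notation order := (pole_order G z axis).
Local Notation pindex := (pole_index G).

Lemma cent_axis g h : g \in P -> h \in P -> (h \in 'C[g])%g -> 'C_G[h]%g = 'C_G[g]%g.
Proof.
exact: (cent_ray szz1 axis_conj
  axis_comm axis_fix).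
Qed.

Lemma index_order g : g \in P -> (2 * (pindex g * order g))%N = #|G|.
Proof.
exact: (pole_index_order sZG sz_neq1 szz1
  axis_comm axis_neqV
  axis_inv).
Qed.

Lemma card_cent g : g \in P -> #|'C_G[g]%g| = (2 * order g)%N.
Proof.
exact: (card_cent1_ray sZG sz_neq1 szz1
  axis_comm axis_neqV
  axis_inv).
Qed.

Lemma axis_classification :
  [\/ exists2 g, g \in P & pindex g = 2%N,
      exists2 g, g \in P & #|G| = 24%N /\ order g = 3%N,
      exists2 g, g \in P & [/\ #|G| = 48%N, order g = 4%N &
        forall h, h \in P -> order h = 4%N -> h \in block G z axis g]
    | exists2 g, g \in P & [/\ #|G| = 120%N, order g = 5%N &
        forall h, h \in P -> order h = 5%N -> h \in block G z axis g]].
Proof.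
have [g0 Pg0] := P_nonempty.
exact: (pole_classification sZG sz_neq1 szz1
  axis_conj axis_comm
  axis_neqV axis_inv
  axis_fix axis_noncentral Pg0).
Qed.

Lemma mem_P_J g x : g \in P -> x \in G -> (g ^ x)%g \in P.
Proof. by move=> Pg Gx; rewrite (PJ sZG). Qed.

Lemma mem_P_V g : g \in P -> g^-1%g \in P.
Proof. by move=> Pg; rewrite (PV _ szz1). Qed.

(** If g^a and g^b have the same axis, a b^-1 fixes the axis of g and so commutes with g. Hence a
    conjugacy class can stand for its orbit of axes. *)
Lemma axis_inj_class g x y : g \in P -> x \in (g ^: G)%g -> y \in (g ^: G)%g ->
  axis x = axis y -> x = y.
Proof.
move=> Pg /imsetP[a Ga ->] /imsetP[b Gb ->] ab; have Gg := P_G Pg.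
have : axis (g ^ (a * b^-1))%g = axis g.
  have Pga := mem_P_J Pg Ga; have Pgb := mem_P_J Pg Gb; have GbV : b^-1%g \in G by rewrite groupV.
  by rewrite conjgM (axis_conj Pga Pgb GbV ab) conjgK.
move/(axis_fix Pg (groupM Ga (groupVr Gb)))/cent1P => c.
have : (g ^ (a * b^-1) = g)%g by apply/conjg_fixP/commgP/commute_sym.
by rewrite conjgM => /(canRL (conjgKV b)).
Qed.

Lemma card_class_index g : #|(g ^: G)%g| = pindex g.
Proof. by rewrite -index_cent1. Qed.

Lemma class_P g x : g \in P -> x \in (g ^: G)%g -> x \in P.
Proof. by move=> Pg /imsetP[a Ga ->]; apply: mem_P_J. Qed.

Lemma class_J g x y : x \in (g ^: G)%g -> y \in G -> (x ^ y)%g \in (g ^: G)%g.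
Proof.
move=> /imsetP[a Ga ->] Gy; apply/imsetP; exists (a * y)%g; first by rewrite groupM.
by rewrite conjgM.
Qed.

Lemma rot_axis g y : g \in G -> y \in G -> rot y *m axis g = axis (g ^ y^-1)%g.
Proof. by move=> Gg Gy; rewrite axisJ ?groupV // rotV // trmxK. Qed.

Lemma rot_cent g c : g \in P -> c \in 'C_G[g]%g -> rot c *m axis g = axis g.
Proof.
move=> Pg /finset.setIP[Gc /cent1P cg]; rewrite rot_axis ?(P_G Pg) //.
by congr axis; apply/conjg_fixP/commgP/commuteV.
Qed.

(** An element commuting with g and h lies in {1, z}, otherwise g and h would have the same
    centraliser; so a centraliser of order 2n moves h through n positions. *)
Lemma card_cent_orbit g h : g \in P -> h \in P -> h \notin 'C[g]%g ->
  #|(h ^: 'C_G[g])%g| = order g.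
Proof.
move=> Pg Ph hg; have oC : #|'C_('C_G[g])[h]%g| = 2%N; last first.
  by rewrite -index_cent1 -divgS ?subsetIl // card_cent // [X in (_ %/ X)%N]oC mulKn.
have -> : 'C_('C_G[g])[h]%g = [set 1%g; z]%SET.
  apply/finset.setP => x; apply/idP/idP => [/finset.setIP[xg xh]|xz].
    apply: contraT => xNz; have Gx : x \in G by case/finset.setIP: xg.
    have Px : x \in P by rewrite finset.in_setD xNz Gx.
    have xg1 : x \in 'C[g]%g by case/finset.setIP: xg.
    have : h \in 'C_G[h]%g by rewrite finset.in_setI (P_G Ph) cent1id.
    rewrite -(cent_axis Ph Px xh) (cent_axis Pg Px xg1) => /finset.setIP[_].
    by rewrite (negPf hg).
  have /finset.setIP[Gx /centP cx] := fintype.subsetP sZG _ xz.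
  rewrite !finset.in_setI Gx /=; apply/andP; split; apply/cent1P.
    by apply: cx; apply: P_G Pg.
  by apply: cx; apply: P_G Ph.
by rewrite cards2 eq_sym sz_neq1.
Qed.

(** * Recognising the polyhedral groups *)

Lemma conj_image (U0 : 'M[R[i]]_2) (H : set 'M[R]_3) : SU2 U0 ->
    (forall x, x \in G -> H (double_cover U0 *m rot x *m (double_cover U0)^T)) ->
    (forall A, H A -> exists2 k, k \in G &
       A = double_cover U0 *m rot k *m (double_cover U0)^T) ->
  iso_linear_group s (binary_group H).
Proof.
move=> sU0 H1 H2; have [/unitarymxP UU _] := sU0.
have sSU2' g : g \in G -> SU2 (U0 *m s g *m U0 ^t*).
  by move=> Gg; apply: SU2M; [apply: SU2M => //; apply: sSU2 | apply: SU2_ctr].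
have DE g : g \in G ->
    double_cover (U0 *m s g *m U0 ^t*) = double_cover U0 *m rot g *m (double_cover U0)^T.
  move=> Gg; rewrite double_coverM; [|by apply: SU2M => //; apply: sSU2|exact: SU2_ctr].
  by rewrite double_cover_ctr // double_coverM //; apply: sSU2.
apply: (conj_iso UU s_faithful) => [x Gx|U [sU HU]].
  by split; [apply: sSU2' | rewrite DE //; apply: H1].
have [k Gk kE] := H2 _ HU; rewrite -DE // in kE.
(* The two lifts of a rotation differ by a sign, and z supplies the other one. *)
have [UE|UE] := double_cover_inj sU (sSU2' k Gk) kE; first by exists k.
by exists (z * k)%g; rewrite ?groupM // repr_mxM // UE s_z mulNmx mul1mx mulmxN mulNmx.
Qed.

(** c A0 maps the orbit of axes onto the vertices, so G acts by symmetries. Conversely, a rotation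
    of the polyhedron is composed with elements of G until it fixes the axis of g, then, by the last
    hypothesis, also that of h; it is then the identity. *)
Lemma recognition (A0 : 'M[R]_3) (c : R) (I : finType) (f : I -> 'cV[R]_3) g h :
    g \in P -> h \in (g ^: G)%g -> cross (axis g) (axis h) != 0 -> c != 0 -> SO3 A0 ->
    #|I| = #|(g ^: G)%g| ->
    (forall x, x \in (g ^: G)%g -> exists i, c *: (A0 *m axis x) = f i) ->
    (forall x, x \in (g ^: G)%g -> dot (axis x) (axis g) = dot (axis h) (axis g) ->
       x \in (h ^: 'C_G[g])%g) ->
  iso_linear_group s (binary_group (rotation_group [set v | exists i, v = f i])).
Proof.
move=> Pg hcl gh c0 sA cardI inV Htrans; have Gg := P_G Pg.
have Ph := class_P Pg hcl; have Gh := P_G Ph.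
have Gcl x : x \in (g ^: G)%g -> x \in G by move/(class_P Pg)/P_G.
have VE v : (exists i, v = f i) <-> exists2 x, x \in (g ^: G)%g & v = c *: (A0 *m axis x).
  split=> [[i ->]|[x xcl ->]]; last by have [i ->] := inV x xcl; exists i.
  have /boolp.choice[F FE] : forall x, exists i : I, x \in (g ^: G)%g -> c *: (A0 *m axis x) = f i.
    move=> x; case xcl: (x \in _); last by exists i.
    by have [j jE] := inV x xcl; exists j.
  have injF : {in (g ^: G)%g &, injective F}.
    move=> x y xcl ycl Fxy; have := FE x xcl; rewrite Fxy -(FE y ycl).
    move/(scalerI c0)/(can_inj (mulKmx (proj1 (mulmx1_unit (proj1 sA))))).
    exact: (axis_inj_class Pg xcl ycl).
  (* An injection between finite sets of equal size reaches every vertex. *)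
  have : i \in F @: (g ^: G)%g.
    have /eqP-> : F @: (g ^: G)%g == [set: I]%SET.
      by rewrite eqEcard finset.subsetT cardsT cardI card_in_imset ?leqnn.
    by rewrite finset.in_setT.
  by case/imsetP=> x xcl ->; exists x => //; rewrite FE.
have [U0 sU0 U0E] := double_cover_surj sA.
apply: (conj_image sU0); rewrite U0E.
  move=> x Gx; have sx := rot_SO3 Gx.
  have sB : SO3 (A0 *m rot x *m A0^T) by apply: SO3M; [apply: SO3M | apply: SO3_trmx].
  have mv y : y \in (g ^: G)%g ->
      A0 *m rot x *m A0^T *m (c *: (A0 *m axis y)) = c *: (A0 *m axis (y ^ x^-1)%g).
    move=> ycl; rewrite -scalemxAr; congr (_ *: _); rewrite -!mulmxA; congr (_ *m _).
    by rewrite (mulmxA A0^T) SO3_tr // mul1mx rot_axis // Gcl.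
  split; last by case: sB.
  split; first by case: sB.
  apply/seteqP; split=> [_ [v /VE[y ycl ->] <-]|v /VE[y ycl ->]].
    by apply/VE; exists (y ^ x^-1)%g; rewrite ?mv ?class_J ?groupV.
  exists (c *: (A0 *m axis (y ^ x)%g)); last by rewrite mv ?conjgK // class_J.
  by apply/VE; exists (y ^ x)%g => //; rewrite class_J.
move=> A [[AA AV] dA]; pose B := A0^T *m A *m A0.
have sB : SO3 B by apply: SO3M => //; apply: SO3M => //; apply: SO3_trmx.
have ABE : A = A0 *m B *m A0^T.
  by rewrite /B !mulmxA (proj1 sA) mul1mx -mulmxA (proj1 sA) mulmx1.
have Bcl x : x \in (g ^: G)%g -> exists2 y, y \in (g ^: G)%g & B *m axis x = axis y.
  move=> xcl; have : [set A *m v | v in [set v | exists i, v = f i]] (A *m (c *: (A0 *m axis x))).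
    by exists (c *: (A0 *m axis x)) => //; apply/VE; exists x.
  rewrite AV => /VE[y ycl]; rewrite -scalemxAr => /(scalerI c0) E; exists y => //.
  by rewrite /B -!mulmxA E mulmxA SO3_tr // mul1mx.
have [_ /imsetP[a Ga ->] BgE] := Bcl g (class_refl _ _).
have Ba_g : rot a *m B *m axis g = axis g.
  by rewrite -mulmxA BgE rot_axis ?groupJ // conjgK.
have [y ycl BhE] := Bcl h hcl.
have Ba_h : rot a *m B *m axis h = axis (y ^ a^-1)%g.
  by rewrite -mulmxA BhE rot_axis // Gcl.
have sBa : SO3 (rot a *m B) by apply: SO3M => //; apply: rot_SO3.
have : (y ^ a^-1)%g \in (h ^: 'C_G[g])%g.
  apply: Htrans; first by rewrite class_J ?groupV.
  by rewrite -Ba_h -{1}Ba_g dot_mulmx // SO3_tr.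
case/imsetP=> b bC yE; have Gb : b \in G by case/finset.setIP: bC.
have sBb : SO3 (rot b *m (rot a *m B)) by apply: SO3M => //; apply: rot_SO3.
have B1 : rot b *m (rot a *m B) = 1%:M.
  apply: (SO3_fix2 sBb gh); first by rewrite -mulmxA Ba_g (rot_cent Pg).
  by rewrite -mulmxA Ba_h yE rot_axis ?groupJ // conjgK.
exists ((b * a)^-1)%g; first by rewrite groupV groupM.
have BE : B = rot (b * a)^-1%g.
  rewrite rotV ?groupM // rotM // -[LHS]mul1mx; rewrite mulmxA in B1.
  have sba : SO3 (rot b *m rot a) by apply: SO3M; apply: rot_SO3.
  by rewrite -(SO3_tr sba) -mulmxA B1 mulmx1.
by rewrite -BE.
Qed.

Lemma dotJ x y a : x \in G -> y \in G -> a \in G ->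
  dot (axis (x ^ a)%g) (axis (y ^ a)%g) = dot (axis x) (axis y).
Proof.
by move=> Gx Gy Ga; rewrite !axisJ // dot_mulmx // trmxK; case: (rot_SO3 Ga).
Qed.

Lemma commute_axis g h : g \in P -> h \in P ->
  (h \in 'C[g])%g = (axis h == axis g) || (axis h == - axis g).
Proof. by move=> Pg Ph; rewrite (axis_comm Pg Ph) axisV ?(P_G Pg). Qed.

Lemma cross_axis g h : g \in P -> h \in P -> h \notin 'C[g]%g -> cross (axis g) (axis h) != 0.
Proof.
move=> Pg Ph; apply: contraNneq => c0.
have [|t gE] := cross_eq0 _ c0; first exact: (axis_neq0 Ph).
have h1 := dot_axis Ph.
have := dot_axis Pg; rewrite gE dotZl dotZr h1 mulr1 -expr2 => /eqP.
rewrite sqrf_eq1 commute_axis // gE => /orP[] /eqP->.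
  by rewrite scale1r eqxx.
by rewrite scaleN1r opprK eqxx orbT.
Qed.

(** Commuting conjugates have axes on one line, which holds only two unit vectors. *)
Lemma noncommuting_ex g : g \in P -> (2 < pindex g)%N ->
  exists2 h, h \in (g ^: G)%g & h \notin 'C[g]%g.
Proof.
move=> Pg; rewrite -card_class_index => big; apply: contrapT => no.
have gcl : g \in (g ^: G)%g by apply: class_refl.
have all x : x \in (g ^: G)%g -> axis x = axis g \/ axis x = - axis g.
  move=> xcl; have Px := class_P Pg xcl.
  have : (x \in 'C[g])%g by apply: contraT => xg; case: no; exists x.
  by rewrite commute_axis // => /orP[] /eqP; [left | right].
have inj := axis_inj_class Pg.
have [x] : exists x, x \in (g ^: G)%g :\ g.
  apply/finset.set0Pn; rewrite -card_gt0.
  have c1 := cardsD1 g (g ^: G)%g; by rewrite gcl add1n in c1; rewrite c1 ltnS in big; apply: ltnW.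
case/finset.setD1P=> xg xcl.
have [y] : exists y, y \in (g ^: G)%g :\ g :\ x.
  apply/finset.set0Pn; rewrite -card_gt0.
  have c1 := cardsD1 g (g ^: G)%g; have c2 := cardsD1 x ((g ^: G)%g :\ g).
  rewrite gcl add1n in c1; rewrite finset.in_setD1 xg xcl add1n in c2.
  by rewrite c1 c2 !ltnS in big.
case/finset.setD1P=> yx /finset.setD1P[yg ycl].
have xN : axis x = - axis g by case: (all x xcl) => // /(inj _ _ xcl gcl) E; rewrite E eqxx in xg.
have yN : axis y = - axis g by case: (all y ycl) => // /(inj _ _ ycl gcl) E; rewrite E eqxx in yg.
by move: yx; rewrite (inj y x ycl xcl) ?eqxx // xN yN.
Qed.

(** The inner product of the equation with v is the case of equality in the Cauchy-Schwarz
    inequality for v and the vector part of g. *)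
Lemma rot_fix g v : g \in P -> rot g *m v = v -> exists t, v = t *: axis g.
Proof.
move=> Pg; have [sg n1] := s_quat (P_G Pg).
rewrite rotE sg double_coverE rotqE => E.
have nz := qvec_neq0 Pg.
have c0 : cross v (qvec g) = 0.
  apply/eqP; rewrite -dot_eq0 cross_sq; apply/eqP.
  have := congr1 (fun w => dot w v) E; rewrite !(dotDl, dotNl, dotZl).
  have -> : dot (cross (qvec g) v) v = 0 by rewrite /dot /cross !mxE /=; ring.
  move: n1; rewrite (dotC v (qvec g)) => n1; move: (dot v v) (dot (qvec g) v) n1 => a b.
  by move: (dot _ _) (qre g) => n r n1; nra.
have [t vE] := cross_eq0 nz c0.
rewrite vE (qvecE Pg) scalerA.
by eexists.
Qed.

Lemma orbit_sum_fixed (K : {group gT}) h a : K \subset G -> h \in G -> a \in K ->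
  rot a *m (\sum_(x in (h ^: K)%g) axis x) = \sum_(x in (h ^: K)%g) axis x.
Proof.
move=> sKG Gh Ka; have Ga := fintype.subsetP sKG _ Ka.
rewrite mulmx_sumr [RHS](reindex_inj (conjg_inj a^-1%g)) /=; apply: eq_big => x.
  apply/imsetP/imsetP => -[b Kb E].
    by exists (b * a^-1)%g; rewrite ?groupM ?groupV // conjgM E.
  by exists (b * a)%g; rewrite ?groupM // conjgM -E conjgKV.
case/imsetP=> b Kb ->; rewrite rot_axis // groupJ //.
exact: (fintype.subsetP sKG).
Qed.

(** The sum is fixed by the rotation g, hence lies on its axis, and every term has the same
    component along it. *)
Lemma cent_orbit_sum g h : g \in P -> h \in P -> h \notin 'C[g]%g ->
  \sum_(x in (h ^: 'C_G[g])%g) axis x = ((order g)%:R * dot (axis h) (axis g)) *: axis g.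
Proof.
move=> Pg Ph hg; have Gg := P_G Pg; have Gh := P_G Ph.
have gC : g \in 'C_G[g]%g by rewrite finset.in_setI Gg cent1id.
have [t tE] := rot_fix Pg (orbit_sum_fixed (subsetIl G 'C[g]%g) Gh gC).
rewrite tE; congr (_ *: _).
have := congr1 (fun w => dot w (axis g)) tE.
rewrite dotZl (dot_axis Pg) mulr1 => <-.
rewrite dot_sum (eq_bigr (fun=> dot (axis h) (axis g))) => [|x /imsetP[c cC ->]].
  by rewrite sumr_const card_cent_orbit // mulr_natl.
have Gc : c \in G by case/finset.setIP: cC.
have gc : axis (g ^ c)%g = axis g.
  congr axis; apply/conjg_fixP/commgP/commute_sym/cent1P.
  by case/finset.setIP: cC.
by rewrite -{1}gc dotJ.
Qed.

Lemma orbit_noncomm g h x : g \in P -> h \in (g ^: G)%g -> h \notin 'C[g]%g ->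
  x \in (h ^: 'C_G[g])%g -> (x \in (g ^: G)%g) && (x \notin 'C[g]%g).
Proof.
move=> Pg hcl hg /imsetP[c /finset.setIP[Gc cC] ->]; rewrite class_J //=.
have gc : (g ^ c)%g = g by apply/conjg_fixP/commgP/commute_sym/cent1P.
by rewrite -{1}gc cent1J memJ_conjg.
Qed.

Lemma dot_orbit g h x : g \in P -> h \in P -> x \in (h ^: 'C_G[g])%g ->
  dot (axis x) (axis g) = dot (axis h) (axis g).
Proof.
move=> Pg Ph /imsetP[c /finset.setIP[Gc cC] ->].
have gc : (g ^ c)%g = g by apply/conjg_fixP/commgP/commute_sym/cent1P.
by rewrite -{1}gc dotJ ?(P_G Ph) ?(P_G Pg).
Qed.

Lemma tetra_case g : g \in P -> #|G| = 24%N -> order g = 3%N ->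
  iso_linear_group s (binary_group (rotation_group (@tetrahedron R))).
Proof.
move=> Pg oG og; have Gg := P_G Pg.
have ig : pindex g = 4%N by have := index_order Pg; rewrite oG og; lia.
have [h hcl hg] : exists2 h, h \in (g ^: G)%g & h \notin 'C[g]%g.
  by apply: noncommuting_ex; rewrite ?ig.
have Ph := class_P Pg hcl; have Gh := P_G Ph.
have gcl : g \in (g ^: G)%g by apply: class_refl.
have clE : (h ^: 'C_G[g])%g = (g ^: G)%g :\ g.
  apply/eqP; rewrite eqEcard; apply/andP; split.
    apply/fintype.subsetP => x xC; have /andP[xcl xg] := orbit_noncomm Pg hcl hg xC.
    by rewrite finset.in_setD1 xcl andbT; apply: contraNneq xg => ->; apply: cent1id.
  have := cardsD1 g (g ^: G)%g; rewrite gcl add1n card_class_index ig.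
  by rewrite card_cent_orbit // og => -[<-].
have g1 := dot_axis Pg.
have gh := cross_axis Pg Ph hg.
(* The sum of the orbit is fixed by g and by h, whose axes are independent, so it is zero. Its
   component along the axis of g is 1 + 3 cos, which gives the cosine -1/3. *)
pose S0 := \sum_(x in (g ^: G)%g) axis x.
have S0g : S0 = (1 + 3 * dot (axis h) (axis g)) *: axis g.
  rewrite /S0 (big_setD1 g) //= -clE cent_orbit_sum // og scalerDl scale1r.
  by [].
have S0h : exists t, S0 = t *: axis h.
  by apply: rot_fix Ph _; apply: orbit_sum_fixed.
have alpha0 : 1 + 3 * dot (axis h) (axis g) = 0.
  apply/eqP; apply: contraT => nz; case: S0h => t; rewrite S0g => E.
  case/negP: gh; rewrite -[axis g]scale1r -(mulVf nz) -scalerA E scalerA.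
  by apply/eqP; rewrite [LHS]cv3P [RHS]cv3P /cross !mxE /=; congr cv3; ring.
have alpha : dot (axis h) (axis g) = - 3^-1 by move: alpha0; lra.
have dotg x : x \in (g ^: G)%g -> x != g -> dot (axis x) (axis g) = - 3^-1.
  move=> xcl xg; rewrite -alpha; apply: (dot_orbit Pg Ph).
  by rewrite clE finset.in_setD1 xg xcl.
have dotc x y : x \in (g ^: G)%g -> y \in (g ^: G)%g -> x != y ->
    dot (axis x) (axis y) = - 3^-1.
  move=> xcl ycl; have Gx := P_G (class_P Pg xcl).
  case/imsetP: ycl => a Ga -> xa.
  rewrite -(conjgKV a x) dotJ ?groupJ ?groupV //; apply: dotg.
    by rewrite class_J ?groupV.
  by apply: contraNneq xa => <-; rewrite conjgKV.
have hg' : h != g by apply: contraNneq hg => ->; apply: cent1id.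
have [k] : exists k, k \in (g ^: G)%g :\ g :\ h.
  apply/finset.set0Pn; rewrite -card_gt0.
  have c1 := cardsD1 g (g ^: G)%g; have c2 := cardsD1 h ((g ^: G)%g :\ g).
  rewrite gcl add1n in c1; rewrite finset.in_setD1 hg' hcl add1n in c2.
  by have := card_class_index g; rewrite c1 c2 ig => -[->].
case/finset.setD1P=> kh /finset.setD1P[kg kcl].
have Pk := class_P Pg kcl.
(* The vertices of the tetrahedron have length sqrt 3 and mutual inner products -1, in accordance
   with the cosine -1/3. *)
pose c := Num.sqrt 3 : R.
have c2 : c * c = 3 by rewrite -expr2 sqr_sqrtr ?ler0n.
have c0 : c != 0 by apply: contraPneq c2 => ->; rewrite mul0r => /eqP; rewrite eq_sym pnatr_eq0.
have h1 := dot_axis Ph.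
have k1 := dot_axis Pk.
have [|||||||||||||A sA [Ag Ahk]] := @equi_frame R 3 (-1) (c *: axis g) (c *: axis h) (c *: axis k)
    (cv3 1 1 1) (cv3 1 (-1) (-1)) (cv3 (-1) 1 (-1)).
- by rewrite dotZl dotZr g1 mulr1.
- by rewrite dotZl dotZr h1 mulr1.
- by rewrite dotZl dotZr k1 mulr1.
- by rewrite dotZl dotZr mulrA c2 dotC alpha; lra.
- by rewrite dotZl dotZr mulrA c2 dotC dotg //; lra.
- by rewrite dotZl dotZr mulrA c2 dotC dotc //; lra.
- by rewrite /dot !mxE /=; ring.
- by rewrite /dot !mxE /=; ring.
- by rewrite /dot !mxE /=; ring.
- by rewrite /dot !mxE /=; ring.
- by rewrite /dot !mxE /=; ring.
- by rewrite /dot !mxE /=; ring.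
- rewrite /dot /cross !mxE /= gt_eqF //; lra.
pose f (i : bool * bool) : 'cV[R]_3 :=
  cv3 ((-1) ^+ i.1) ((-1) ^+ i.2) ((-1) ^+ (i.1 (+) i.2)).
have prod3 (v : 'cV[R]_3) : \prod_i v i 0 = v o30 0 * (v o31 0 * v o32 0).
  rewrite !big_ord_recl big_ord0 mulr1.
  by congr (v _ 0 * (v _ 0 * v _ 0)); apply: val_inj.
have -> : @tetrahedron R = [set v | exists i, v = f i].
  apply/seteqP; split=> v /= => [[v1]|[[b1 b2] ->]]; last first.
    split; first by apply: ord3P; rewrite !mxE /=; case: b1 b2 => [] []; rewrite ?expr0 ?expr1; [right|right|left|left|right|left|right|left|left|right|right|left].
    by rewrite prod3 !mxE /=; case: b1 b2 => [] [] /=; ring.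
  have vE a b c' : v o30 0 = a -> v o31 0 = b -> v o32 0 = c' -> v = cv3 a b c'.
    by move=> <- <- <-; apply: cv3P.
  rewrite prod3 => pv; have n1 : 1 != -1 :> R by rewrite gt_eqF //; lra.
  have e2 : v o32 0 = v o30 0 * v o31 0.
    have sq i : v i 0 * v i 0 = 1 by case: (v1 i) => ->; ring.
    have sq01 : v o30 0 * v o31 0 * (v o30 0 * v o31 0) = 1 by rewrite mulrACA !sq mulr1.
    by rewrite -[LHS]mul1r -sq01 -[RHS]mulr1 -pv; ring.
  have [e0|e0] := v1 o30; have [e1|e1] := v1 o31;
    rewrite e0 e1 ?mulrN1 ?opprK ?mulr1 ?mulN1r in e2.
  - by exists (false, false); rewrite /f /= !expr0; apply: vE.
  - by exists (false, true); rewrite /f /= !expr0 !expr1; apply: vE.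
  - by exists (true, false); rewrite /f /= !expr0 !expr1; apply: vE.
  by exists (true, true); rewrite /f /= !expr0 !expr1; apply: vE.
(* The four axes add up to zero, so the last one follows from the three already placed. *)
have Sx x : x \in (g ^: G)%g -> x != g -> x != h -> x != k ->
    axis x = - (axis g + axis h + axis k).
  move=> xcl xg xh xk; pose K := (g ^: G)%g :\ g :\ h :\ k.
  have xK : x \in K by rewrite !finset.in_setD1 xk xh xg xcl.
  have /eqP/cards1P[y KE] : #|K| = 1%N.
    have c1 := cardsD1 g (g ^: G)%g; have c2' := cardsD1 h ((g ^: G)%g :\ g).
    have c3 := cardsD1 k ((g ^: G)%g :\ g :\ h).
    rewrite gcl add1n in c1; rewrite finset.in_setD1 hg' hcl add1n in c2'.
    rewrite !finset.in_setD1 kh kg kcl add1n in c3.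
    by have := card_class_index g; rewrite c1 c2' c3 ig => -[].
  have : S0 = 0 by rewrite S0g alpha0 scale0r.
  rewrite /S0 (big_setD1 g) //= (big_setD1 h) ?finset.in_setD1 ?hg' //=.
  rewrite (big_setD1 k) ?finset.in_setD1 ?kh ?kg //= -/K KE big_set1.
  have -> : y = x by move: xK; rewrite KE => /set1P.
  by move=> E; apply/eqP; rewrite -addr_eq0 addrC -!addrA E.
apply: (recognition Pg hcl gh c0 sA) => [||x xcl dx].
- by rewrite card_prod card_bool card_class_index ig.
- move=> x xcl.
  have img y : c *: (A *m axis y) = A *m (c *: axis y) by rewrite scalemxAr.
  have [->|xg] := eqVneq x g; first by exists (false, false); rewrite img Ag.
  have [->|xh] := eqVneq x h.
    rewrite img; case: Ahk => -[-> _]; [exists (false, true) | exists (true, false)]; rewrite /f /=; congr cv3.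
  have [->|xk] := eqVneq x k.
    rewrite img; case: Ahk => -[_ ->]; [exists (true, false) | exists (false, true)]; rewrite /f /=; congr cv3.
  exists (true, true); rewrite img (Sx x xcl xg xh xk) scalerN !scalerDr mulmxN !mulmxDr Ag.
  case: Ahk => -[-> ->]; rewrite [LHS]cv3P /f !mxE /=; congr cv3; ring.
rewrite clE finset.in_setD1 xcl andbT; apply: contraPneq dx => ->.
by rewrite g1 alpha => /eqP; apply/negP; rewrite gt_eqF //; lra.
Qed.

(** The inverse of g has the opposite axis and the same order, so uniqueness of the orbit of that
    order puts the opposite axis in the orbit of g. *)
Lemma antipode g : g \in P -> (forall h, h \in P -> order h = order g -> h \in block G z axis g) ->
  forall x, x \in (g ^: G)%g -> exists2 x', x' \in (g ^: G)%g & axis x' = - axis x.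
Proof.
move=> Pg og; have Gg := P_G Pg.
have [g' g'cl g'E] : exists2 x', x' \in (g ^: G)%g & axis x' = - axis g.
  have PgV := mem_P_V Pg.
  have gVg : g^-1%g \in 'C[g]%g by rewrite groupV cent1id.
  have : g^-1%g \in block G z axis g.
    apply: og => //; have := card_cent PgV.
    rewrite (cent_axis Pg PgV gVg) (card_cent Pg).
    by move/eqP; rewrite eqn_pmul2l // => /eqP.
  case/(blockP sZG axis_conj _ Pg) => _ [x Gx E].
  by exists (g ^ x)%g; [apply: imset_f | rewrite -E axisV].
move=> _ /imsetP[a Ga ->]; exists (g' ^ a)%g; first exact: class_J.
have Gg' := P_G (class_P Pg g'cl).
by rewrite !axisJ // g'E mulmxN.
Qed.

Lemma dot_classJ g (S : R -> Prop) :
    g \in P ->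
    (forall x, x \in (g ^: G)%g -> axis x != axis g -> axis x != - axis g ->
       S (dot (axis x) (axis g))) ->
  forall x y, x \in (g ^: G)%g -> y \in (g ^: G)%g -> axis x != axis y -> axis x != - axis y ->
    S (dot (axis x) (axis y)).
Proof.
move=> Pg Sg x y xcl /imsetP[a Ga ->] xy xNy.
have Gx := P_G (class_P Pg xcl); have Gg := P_G Pg; have GaV : a^-1%g \in G by rewrite groupV.
have xE : axis x = (rot a)^T *m axis (x ^ a^-1)%g by rewrite -axisJ ?groupJ // conjgKV.
have gE : axis (g ^ a)%g = (rot a)^T *m axis g by rewrite axisJ.
have -> : dot (axis x) (axis (g ^ a)%g) = dot (axis (x ^ a^-1)%g) (axis g).
  by rewrite -{1}(conjgKV a x) dotJ ?groupJ.
apply: Sg; first by rewrite class_J.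
  by apply: contraNneq xy => E; rewrite xE gE E.
by apply: contraNneq xNy => E; rewrite xE gE E mulmxN.
Qed.

Lemma axis_pm_commute g x : g \in P -> x \in P -> x \notin 'C[g]%g ->
  axis x != axis g /\ axis x != - axis g.
Proof.
by move=> Pg Px; rewrite commute_axis // negb_or => /andP[].
Qed.

Lemma octa_case g : g \in P -> #|G| = 48%N -> order g = 4%N ->
    (forall h, h \in P -> order h = 4%N -> h \in block G z axis g) ->
  iso_linear_group s (binary_group (rotation_group (@octahedron R))).
Proof.
move=> Pg oG og; rewrite -og => uniq_g; have Gg := P_G Pg.
have ig : pindex g = 6%N by have := index_order Pg; rewrite oG og; lia.
have anti := antipode Pg uniq_g.
have inj := axis_inj_class Pg.
have [h hcl hg] : exists2 h, h \in (g ^: G)%g & h \notin 'C[g]%g.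
  by apply: noncommuting_ex; rewrite ?ig.
have Ph := class_P Pg hcl; have Gh := P_G Ph.
have gcl : g \in (g ^: G)%g by apply: class_refl.
have [g' g'cl g'E] := anti g gcl.
have g1 := dot_axis Pg; have h1 := dot_axis Ph.
have nzN w : w \in P -> axis w != - axis w.
  by move=> Pw; rewrite -(axisV (P_G Pw)); apply: axis_neqV.
have g'g : g' != g by apply: contraNneq (nzN g Pg) => gg; rewrite -g'E gg.
have clE : (h ^: 'C_G[g])%g = (g ^: G)%g :\ g :\ g'.
  apply/eqP; rewrite eqEcard; apply/andP; split.
    apply/fintype.subsetP => x xC.
    have /andP[xcl xg] := orbit_noncomm Pg hcl hg xC.
    have [xg1 xg2] := axis_pm_commute Pg (class_P Pg xcl) xg.
    rewrite !finset.in_setD1 xcl andbT; apply/andP; split.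
      by apply: contraNneq xg2 => ->; rewrite g'E.
    by apply: contraNneq xg1 => ->.
  have c1 := cardsD1 g (g ^: G)%g; have c2 := cardsD1 g' ((g ^: G)%g :\ g).
  rewrite gcl add1n in c1; rewrite finset.in_setD1 g'g g'cl add1n in c2.
  have := card_class_index g; rewrite c1 c2 ig card_cent_orbit // og.
  by move=> -[->].
have in_orb x : x \in (g ^: G)%g -> axis x != axis g -> axis x != - axis g ->
    x \in (h ^: 'C_G[g])%g.
  move=> xcl xg xNg; rewrite clE !finset.in_setD1 xcl andbT; apply/andP; split.
    by apply: contraNneq xNg => ->; rewrite g'E.
  by apply: contraNneq xg => ->.
have [hg1 hg2] := axis_pm_commute Pg Ph hg.
(* The four axes off the line of g form one orbit of its centraliser, so they have the same height
   over g; antipodes make this height its own negative. *)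
have dot_h : dot (axis h) (axis g) = 0.
  have [h' h'cl h'E] := anti h hcl.
  have : h' \in (h ^: 'C_G[g])%g.
    apply: in_orb => //; rewrite h'E; last by rewrite (inj_eq oppr_inj).
    by rewrite eqr_oppLR.
  by move/(dot_orbit Pg Ph); rewrite h'E dotNl; lra.
have dotg x : x \in (g ^: G)%g -> axis x != axis g -> axis x != - axis g ->
    dot (axis x) (axis g) = 0.
  by move=> xcl xg xNg; rewrite (dot_orbit Pg Ph) // in_orb.
have dotc := dot_classJ (S := fun r => r = 0) Pg dotg.
have [h' h'cl h'E] := anti h hcl.
have [k /finset.setD1P[kg' /finset.setD1P[kg kcl]] /andP[kh kh']] :
    exists2 k, k \in (g ^: G)%g :\ g :\ g' & (k != h) && (k != h').
  by apply: avoid_two; rewrite -clE card_cent_orbit // og.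
have Pk := class_P Pg kcl; have k1 := dot_axis Pk.
have kg1 : axis k != axis g by apply: contraNneq kg => /(inj _ _ kcl gcl)->.
have kg2 : axis k != - axis g by rewrite -g'E; apply: contraNneq kg' => /(inj _ _ kcl g'cl)->.
have kh1 : axis k != axis h by apply: contraNneq kh => /(inj _ _ kcl hcl)->.
have kh2 : axis k != - axis h by rewrite -h'E; apply: contraNneq kh' => /(inj _ _ kcl h'cl)->.
have gh := cross_axis Pg Ph hg.
have [|||||||||||||A sA [Ag Ahk]] := @equi_frame R 1 0 (axis g) (axis h) (axis k)
    (cv3 1 0 0) (cv3 0 1 0) (cv3 0 0 1).
- by [].
- by [].
- by [].
- by rewrite dotC.
- by rewrite dotC dotg.
- by rewrite dotC dotc.
- by rewrite /dot !mxE /=; ring.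
- by rewrite /dot !mxE /=; ring.
- by rewrite /dot !mxE /=; ring.
- by rewrite /dot !mxE /=; ring.
- by rewrite /dot !mxE /=; ring.
- by rewrite /dot !mxE /=; ring.
- by rewrite /dot /cross !mxE /= gt_eqF //; lra.
pose f (i : 'I_3 * bool) : 'cV[R]_3 := (-1) ^+ i.2 *: delta_mx i.1 0.
have -> : @octahedron R = [set v | exists i, v = f i].
  apply/seteqP; split=> v /= => [[i [->|->]]|[[i b] ->]].
  - by exists (i, false); rewrite /f expr0 scale1r.
  - by exists (i, true); rewrite /f expr1 scaleN1r.
  by exists i; rewrite /f; case: b; rewrite ?expr0 ?expr1 ?scale1r ?scaleN1r; [right | left].
have e30 : delta_mx o30 0 = cv3 1 0 0 :> 'cV[R]_3.
  by apply/colP; apply: ord3P; rewrite !mxE.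
have e31 : delta_mx o31 0 = cv3 0 1 0 :> 'cV[R]_3.
  by apply/colP; apply: ord3P; rewrite !mxE.
have e32 : delta_mx o32 0 = cv3 0 0 1 :> 'cV[R]_3.
  by apply/colP; apply: ord3P; rewrite !mxE.
have fpm x y i : axis x = axis y \/ axis x = - axis y -> A *m axis y = delta_mx i 0 ->
    exists j, 1 *: (A *m axis x) = f j.
  move=> [->|->] Ay; rewrite scale1r ?mulmxN Ay.
    by exists (i, false); rewrite /f expr0 scale1r.
  by exists (i, true); rewrite /f expr1 scaleN1r.
apply: (recognition Pg hcl gh (oner_neq0 R) sA) => [||x xcl dx].
- by rewrite card_prod card_bool card_ord card_class_index ig.
- move=> x xcl.
  have pm y : y \in (g ^: G)%g -> (axis x = axis y \/ axis x = - axis y) \/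
      dot (axis x) (axis y) = 0.
    move=> ycl; have [->|xy] := eqVneq (axis x) (axis y); first by left; left.
    by have [->|xNy] := eqVneq (axis x) (- axis y); [left; right | right; apply: dotc].
  have [pg|xg] := pm g gcl; first by apply: (fpm x g o30 pg); rewrite e30.
  have [ph|xh] := pm h hcl.
    by case: Ahk => -[Ah _]; [apply: (fpm x h o31 ph) | apply: (fpm x h o32 ph)]; rewrite ?e31 ?e32.
  have [pk|xk] := pm k kcl.
    by case: Ahk => -[_ Ak]; [apply: (fpm x k o32 pk) | apply: (fpm x k o31 pk)]; rewrite ?e31 ?e32.
  (* A further axis would be orthogonal to all three coordinate vectors. *)
  have x1 := dot_axis (class_P Pg xcl); have tA := SO3_tr sA.
  move: x1 xg xh xk; rewrite -!(dot_mulmx (axis x) _ tA) Ag.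
  case: Ahk => -[-> ->]; rewrite /dot !mxE /= => x1 x0 x1' x2; exfalso.
    move: x0 x1' x2; rewrite !(mulr0, mulr1, addr0, add0r) => x0 x1' x2.
    by move/eqP: x1; rewrite x0 x1' x2 !mulr0 !addr0 eq_sym oner_eq0.
  move: x0 x1' x2; rewrite !(mulr0, mulr1, addr0, add0r) => x0 x1' x2.
  by move/eqP: x1; rewrite x0 x1' x2 !mulr0 !addr0 eq_sym oner_eq0.
rewrite dot_h in dx; apply: in_orb => //.
  by apply: contraPneq dx => ->; rewrite g1 => /eqP; rewrite oner_eq0.
by apply: contraPneq dx => ->; rewrite dotNl g1 => /eqP; rewrite oppr_eq0 oner_eq0.
Qed.

(** * The icosahedral orbit of twelve axes *)

Section Vertex.

Variable g : gT.
Hypothesis Pg : g \in P.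
Hypothesis oG : #|G| = 120%N.
Hypothesis og : order g = 5%N.
Hypothesis uniq_g : forall h, h \in P -> order h = 5%N -> h \in block G z axis g.

Let Gg := P_G Pg.

Let anti x : x \in (g ^: G)%g -> exists2 x', x' \in (g ^: G)%g & axis x' = - axis x.
Proof.
apply: (antipode Pg) => h Ph.
by rewrite og; apply: uniq_g.
Qed.

Let inj x y : x \in (g ^: G)%g -> y \in (g ^: G)%g -> axis x = axis y -> x = y.
Proof. exact: (axis_inj_class Pg). Qed.

Let gcl : g \in (g ^: G)%g. Proof. exact: class_refl. Qed.

Let card_cl : #|(g ^: G)%g| = 12%N.
Proof.
by have := index_order Pg; rewrite card_class_index oG og; lia.
Qed.

Let comm x : x \in (g ^: G)%g -> (x \in 'C[g]%g) = (axis x == axis g) || (axis x == - axis g).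
Proof. by move=> xcl; rewrite commute_axis // (class_P Pg xcl). Qed.

(** Removing g and its antipode leaves ten axes, which the centraliser of g permutes in two orbits
    of five. *)
Lemma orbit_cover h x y : h \in (g ^: G)%g -> x \in (g ^: G)%g -> y \in (g ^: G)%g ->
    h \notin 'C[g]%g -> x \notin 'C[g]%g -> y \notin 'C[g]%g ->
    x \notin (h ^: 'C_G[g])%g ->
  y \in (h ^: 'C_G[g])%g \/ y \in (x ^: 'C_G[g])%g.
Proof.
move=> hcl xcl ycl hg xg yg xh.
have [g' g'cl g'E] := anti gcl.
have nzN : axis g != - axis g.
  by rewrite -(axisV Gg); apply: axis_neqV.
have g'g : g' != g by apply: contraNneq nzN => gg; rewrite -g'E gg.
have sub w : w \in (g ^: G)%g -> w \notin 'C[g]%g ->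
    (w ^: 'C_G[g])%g \subset (g ^: G)%g :\ g :\ g'.
  move=> wcl wg; apply/fintype.subsetP => v vC.
  have /andP[vcl] := orbit_noncomm Pg wcl wg vC.
  rewrite comm // negb_or !finset.in_setD1 vcl andbT => /andP[v1 v2].
  apply/andP; split; first by apply: contraNneq v2 => ->; rewrite g'E.
  by apply: contraNneq v1 => ->.
have dis : [disjoint (h ^: 'C_G[g])%g & (x ^: 'C_G[g])%g]%bool.
  rewrite -finset.setI_eq0; apply: contraR xh => /finset.set0Pn[w /finset.setIP[]].
  by move=> /class_eqP <- /class_eqP ->; apply: class_refl.
have cov : (h ^: 'C_G[g])%g :|: (x ^: 'C_G[g])%g = (g ^: G)%g :\ g :\ g'.
  apply/eqP; rewrite eqEcard finset.subUset !sub //=.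
  have -> : #|(h ^: 'C_G[g])%g :|: (x ^: 'C_G[g])%g| = 10%N.
    have := leq_card_setU (h ^: 'C_G[g])%g (x ^: 'C_G[g])%g; rewrite dis => -[_ /eqP->].
    by rewrite !card_cent_orbit ?og // (class_P Pg).
  have := cardsD1 g (g ^: G)%g; have := cardsD1 g' ((g ^: G)%g :\ g).
  by rewrite finset.in_setD1 g'g g'cl gcl card_cl => -> -[->].
suff : y \in (h ^: 'C_G[g])%g :|: (x ^: 'C_G[g])%g by case/finset.setUP; [left | right].
rewrite cov; apply: (fintype.subsetP (sub y ycl yg)); apply: class_refl.
Qed.

Lemma noncomm_antipode x x' : x \in (g ^: G)%g -> x' \in (g ^: G)%g -> axis x' = - axis x ->
  x \notin 'C[g]%g -> x' \notin 'C[g]%g.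
Proof. by move=> xcl x'cl E; rewrite !comm // E eqr_oppLR (inj_eq oppr_inj) orbC. Qed.

(** Let a and b be the heights of the two orbits. Antipodes put -a and -b into {a, b}, so b = -a or
    both are 0. *)
Lemma height_sq h x : h \in (g ^: G)%g -> x \in (g ^: G)%g ->
  h \notin 'C[g]%g -> x \notin 'C[g]%g ->
  dot (axis x) (axis g) ^+ 2 = dot (axis h) (axis g) ^+ 2.
Proof.
move=> hcl xcl hg xg; have Ph := class_P Pg hcl; have Px := class_P Pg xcl.
have [xh|xh] := boolP (x \in (h ^: 'C_G[g])%g); first by rewrite (dot_orbit Pg Ph xh).
have two w w' : w \in (g ^: G)%g -> w \notin 'C[g]%g -> w' \in (g ^: G)%g -> axis w' = - axis w ->
    - dot (axis w) (axis g) = dot (axis h) (axis g) \/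
    - dot (axis w) (axis g) = dot (axis x) (axis g).
  move=> wcl wg w'cl w'E; rewrite -dotNl -w'E.
  have w'g := noncomm_antipode wcl w'cl w'E wg.
  have [w'h|w'x] := orbit_cover hcl xcl w'cl hg xg w'g xh.
    by left; apply: (dot_orbit Pg Ph).
  by right; apply: (dot_orbit Pg Px).
have [h' h'cl h'E] := anti hcl; have [x' x'cl x'E] := anti xcl.
have := two h h' hcl hg h'cl h'E; have := two x x' xcl xg x'cl x'E.
move: (dot _ _) (dot _ _) => a b [E1|E1] [E2|E2]; nra.
Qed.

(** In the plane of g and h only two unit vectors have the height of h over g, whereas its orbit
    under the centraliser has five. *)
Lemma out_of_plane h : h \in (g ^: G)%g -> h \notin 'C[g]%g ->
  exists2 r, r \in (g ^: G)%g & dot (cross (axis g) (axis h)) (axis r) != 0.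
Proof.
move=> hcl hg; have Ph := class_P Pg hcl.
(* The element of the class, if any, whose axis mirrors that of h in the line of g. *)
pose y := odflt g [pick y in (g ^: G)%g | axis y == (2 * dot (axis h) (axis g)) *: axis g - axis h].
have [x xC /andP[xh xy]] : exists2 x, x \in (h ^: 'C_G[g])%g & (x != h) && (x != y).
  by apply: avoid_two; rewrite card_cent_orbit // og.
have /andP[xcl xg] := orbit_noncomm Pg hcl hg xC.
exists x => //; apply/eqP => pl.
have g1 := dot_axis Pg; have h1 := dot_axis Ph; have x1 := dot_axis (class_P Pg xcl).
have xgE := dot_orbit Pg Ph xC.
have tr0 : dot (axis x) (axis g) = dot (axis h) (axis g) by [].
have gram := triple_sq (axis g) (axis h) (axis x).
rewrite pl g1 h1 x1 (dotC (axis g)) (dotC (axis g)) xgE (dotC (axis h) (axis x)) in gram.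
(* In a plane the Gram determinant vanishes, and here it factors: the angle between h and x is 0 or
   twice the angle between g and h. *)
have : (dot (axis x) (axis h) - 1) *
    (dot (axis x) (axis h) - (2 * dot (axis h) (axis g) ^+ 2 - 1)) = 0.
  by move: gram; move: (dot _ _) (dot _ _) => a b; nra.
move/eqP; rewrite mulf_eq0 => /orP[]; rewrite subr_eq0 => /eqP d.
  by case/negP: xh; apply/eqP/inj => //; apply: dot_unit_eq d.
have xE : axis x = (2 * dot (axis h) (axis g)) *: axis g - axis h.
  apply: dot_unit_eq => //.
    move: g1 h1; move: (axis g) (axis h) => u v u1 v1.
    rewrite dotDl !dotDr ?dotZl ?dotZr ?dotNl ?dotNr ?dotZl ?dotZr u1 v1 (dotC u v).
    by move: (dot _ _) => a; ring.
  rewrite dotDr dotZr dotNr xgE d; move: (dot _ _) => a; ring.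
case/negP: xy; apply/eqP/inj => //; rewrite /y; case: pickP => [w /andP[wcl /eqP wE]|] //=.
  by rewrite xE wE.
by move/(_ x); rewrite xcl xE eqxx.
Qed.

(* The second moment of the orbit of axes is a scalar matrix; its trace gives the height. *)
Lemma height_eq h : h \in (g ^: G)%g -> h \notin 'C[g]%g -> dot (axis h) (axis g) ^+ 2 = 5^-1.
Proof.
move=> hcl hg; have Ph := class_P Pg hcl.
set a := dot (axis h) (axis g).
pose M : 'M[R]_3 := \sum_(x in (g ^: G)%g) axis x *m (axis x)^T.
have ME v : M *m v = \sum_(x in (g ^: G)%g) dot (axis x) v *: axis x.
  rewrite /M mulmx_suml; apply: eq_bigr => x _.
  by rewrite -mulmxA [_^T *m v]mx11_scalar -dotE mul_mx_scalar.
have sq x y : x \in (g ^: G)%g -> y \in (g ^: G)%g -> axis x != axis y -> axis x != - axis y ->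
    dot (axis x) (axis y) ^+ 2 = a ^+ 2.
  apply: (dot_classJ (S := fun r => r ^+ 2 = a ^+ 2) Pg).
  move=> w wcl wg wNg; apply: height_sq => //.
  by rewrite comm // negb_or wg.
(* y and its antipode contribute 1 each, the other ten axes a^2 each. *)
have sumsq y : y \in (g ^: G)%g ->
    \sum_(x in (g ^: G)%g) dot (axis x) (axis y) ^+ 2 = 2 + 10 * a ^+ 2.
  move=> ycl; have [y' y'cl y'E] := anti ycl; have y1 := dot_axis (class_P Pg ycl).
  have nzN : axis y != - axis y.
    by rewrite -(axisV (P_G (class_P Pg ycl))); apply: (axis_neqV (class_P Pg ycl)).
  have y'y : y' != y by apply: contraNneq nzN => yy; rewrite -y'E yy.
  have c1 := cardsD1 y (g ^: G)%g; have c2 := cardsD1 y' ((g ^: G)%g :\ y).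
  rewrite ycl card_cl in c1; rewrite finset.in_setD1 y'y y'cl in c2.
  rewrite (big_setD1 y) //= (big_setD1 y') ?finset.in_setD1 ?y'y //=.
  rewrite (eq_bigr (fun=> a ^+ 2)) => [|x /finset.setD1P[xy' /finset.setD1P[xy xcl]]].
    rewrite sumr_const.
    have -> : #|(g ^: G)%g :\ y :\ y'| = 10%N by move: c1; rewrite c2 !add1n => -[].
    rewrite y'E dotNl y1; move: (a ^+ 2) => b; ring.
  apply: sq => //; first by apply: contraNneq xy => /(inj xcl ycl)->.
  by rewrite -y'E; apply: contraNneq xy' => /(inj xcl y'cl)->.
have MJ x (v : 'cV[R]_3) : x \in G -> rot x *m (M *m v) = M *m (rot x *m v).
  move=> Gx; have sx := rot_SO3 Gx; rewrite !ME mulmx_sumr.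
  rewrite (reindex_inj (conjg_inj x)) /=; apply: eq_big => y.
    apply/idP/idP => [ycl|ycl]; last exact: (class_J ycl Gx).
    by rewrite -(conjgK x y) class_J ?groupV.
  move=> ycl; have Gy : y \in G.
    by rewrite -(conjgK x y) groupJ ?groupV // (P_G (class_P Pg ycl)).
  rewrite -scalemxAr (axisJ Gy Gx) mulmxA (proj1 sx) mul1mx; congr (_ *: _).
  by rewrite -(dot_mulmx _ v (SO3_tr sx)) mulmxA (proj1 sx) mul1mx.
(* M commutes with G, so it sends the axis of y to a vector fixed by the rotation y, a multiple of
   that axis. *)
have Meig y : y \in (g ^: G)%g -> M *m axis y = (2 + 10 * a ^+ 2) *: axis y.
  move=> ycl; have Py := class_P Pg ycl; have Gy := P_G Py.
  have [|t tE] := rot_fix Py (v := M *m axis y).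
    by rewrite MJ // rot_axis // conjgE mulgV mulg1 invgK.
  rewrite tE; congr (_ *: _).
  have := congr1 (fun w => dot w (axis y)) tE; rewrite dotZl (dot_axis Py) mulr1 => <-.
  rewrite ME dot_sum -(sumsq _ ycl).
  by apply: eq_bigr => x _; rewrite dotZl expr2.
have [r rcl tr] := out_of_plane hcl hg.
have uQ : mat3 (axis g) (axis h) (axis r) \in unitmx by rewrite unitmxE unitfE det_mat3.
have MS : M = (2 + 10 * a ^+ 2)%:M.
  apply: (can_inj (mulmxK uQ)); rewrite mul_scalar_mx; set Q := mat3 _ _ _.
  have [c1 c2 c3] := mat3_col (axis g) (axis h) (axis r).
  have eigQ : forall j, M *m (Q *m (delta_mx j 0 : 'cV[R]_3)) = (2 + 10 * a ^+ 2) *: (Q *m delta_mx j 0).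
    by apply: ord3P; rewrite ?c1 ?c2 ?c3; apply: Meig.
  apply/matrixP => i j; have := eigQ j.
  by rewrite mulmxA scalemxAl -!colE => /colP/(_ i); rewrite mxE [X in _ = X]mxE.
(* Each of the twelve unit vectors contributes 1 to the trace: 12 = 3 (2 + 10 a^2). *)
have := congr1 mxtrace MS; rewrite mxtrace_scalar.
rewrite /M raddf_sum /= (eq_bigr (fun=> 1)) => [|x xcl].
  by rewrite sumr_const card_cl -mulr_natl; lra.
by rewrite mxtrace_mulC [_ *m _]mx11_scalar -dotE mxtrace_scalar dot_axis // (class_P Pg).
Qed.

End Vertex.

Lemma icos_case g : g \in P -> #|G| = 120%N -> order g = 5%N ->
    (forall h, h \in P -> order h = 5%N -> h \in block G z axis g) ->
  iso_linear_group s (binary_group (rotation_group (@icosahedron R))).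
Proof.
move=> Pg oG og uniq_g; have Gg := P_G Pg.
have ig : pindex g = 12%N by have := index_order Pg; rewrite oG og; lia.
have anti : forall x, x \in (g ^: G)%g -> exists2 x', x' \in (g ^: G)%g & axis x' = - axis x.
  by apply: (antipode Pg); rewrite og.
have inj := axis_inj_class Pg.
have gcl : g \in (g ^: G)%g by apply: class_refl.
have sq := golden_sq R; have gt1 := golden_gt1 R.
(* The cosine between adjacent vertices of the icosahedron, which is 1 / sqrt 5. *)
pose eta : R := golden R / (golden R + 2).
have n0 : golden R + 2 != 0 by rewrite gt_eqF //; lra.
have etaE : (golden R + 2) * eta = golden R by rewrite mulrC divfK.
have eta2 : eta * eta = 5^-1.
  exact: golden_height sq gt1 etaE.
have eta_pos : 0 < eta by apply: divr_gt0; lra.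
have [h0 h0cl h0g] : exists2 h, h \in (g ^: G)%g & h \notin 'C[g]%g.
  by apply: noncommuting_ex; rewrite ?ig.
have heights x : x \in (g ^: G)%g -> x \notin 'C[g]%g ->
    dot (axis x) (axis g) = eta \/ dot (axis x) (axis g) = - eta.
  move=> xcl xg; have := height_eq Pg oG og uniq_g xcl xg; rewrite -eta2 -expr2 => /eqP.
  by rewrite eqf_sqr => /orP[] /eqP; [left | right].
have [h [hcl hg hE]] : exists h, [/\ h \in (g ^: G)%g, h \notin 'C[g]%g & dot (axis h) (axis g) = eta].
  have [E|E] := heights _ h0cl h0g; first by exists h0.
  have [h' h'cl h'E] := anti _ h0cl; exists h'; split=> //; last by rewrite h'E dotNl E opprK.
  exact: (noncomm_antipode Pg h0cl h'cl h'E h0g).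
have Ph := class_P Pg hcl; have Gh := P_G Ph.
have dotc := dot_classJ (S := fun r => r = eta \/ r = - eta) Pg.
have {}dotc x y : x \in (g ^: G)%g -> y \in (g ^: G)%g -> axis x != axis y -> axis x != - axis y ->
    dot (axis x) (axis y) = eta \/ dot (axis x) (axis y) = - eta.
  apply: dotc => w wcl wg wNg; apply: heights => //.
  by rewrite (commute_axis Pg (class_P Pg wcl)) negb_or wg.
(* Two orbits at height eta would cover all axes off the line of g, among them the antipode of h at
   height -eta. *)
have Htrans x : x \in (g ^: G)%g -> dot (axis x) (axis g) = eta -> x \in (h ^: 'C_G[g])%g.
  move=> xcl xE; apply: contraT => xh; have Px := class_P Pg xcl; have g1 := dot_axis Pg.
  have xg : x \notin 'C[g]%g.
    rewrite (commute_axis Pg Px); apply/negP => /orP[] /eqP E.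
      by move: xE; rewrite E g1 => E1; move: eta2; rewrite -E1; lra.
    by move: xE; rewrite E dotNl g1; lra.
  have [h' h'cl h'E] := anti _ hcl.
  have h'g := noncomm_antipode Pg hcl h'cl h'E hg.
  have h'eta : dot (axis h') (axis g) = - eta by rewrite h'E dotNl hE.
  have [H|H] := orbit_cover Pg oG og uniq_g hcl xcl h'cl hg xg h'g xh.
    by have := dot_orbit Pg Ph H; lra.
  by have := dot_orbit Pg Px H; lra.
have h1 := dot_axis Ph; have g1 := dot_axis Pg.
(* Otherwise the inner products of h with its orbit would add up to 1 - 4 eta, while
   [cent_orbit_sum] gives 5 eta^2 = 1. *)
have [r rC rh] : exists2 r, r \in (h ^: 'C_G[g])%g & dot (axis r) (axis h) = eta.
  apply: contrapT => no.
  have := congr1 (fun w => dot w (axis h)) (cent_orbit_sum Pg Ph hg).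
  rewrite dot_sum dotZl og hE (dotC (axis g)) hE.
  have hC : h \in (h ^: 'C_G[g])%g by apply: class_refl.
  rewrite (big_setD1 h) //= h1 (eq_bigr (fun=> - eta)) => [|x /finset.setD1P[xh xC]].
    have c1 := cardsD1 h (h ^: 'C_G[g])%g.
    rewrite card_cent_orbit // og hC add1n in c1.
    rewrite sumr_const; case: c1 => <-.
    rewrite -mulrA eta2 -mulr_natl; lra.
  have /andP[xcl _] := orbit_noncomm Pg hcl hg xC.
  have [||E|//] := dotc x h xcl hcl; last by case: no; exists x.
    by apply: contraNneq xh => /(inj _ _ xcl hcl)->.
  by apply/eqP => E; have := dot_orbit Pg Ph xC; rewrite E dotNl hE; lra.
have /andP[rcl rg] := orbit_noncomm Pg hcl hg rC.
have rE := dot_orbit Pg Ph rC; rewrite hE in rE.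
have r1 := dot_axis (class_P Pg rcl).
have gh := cross_axis Pg Ph hg.
pose c := Num.sqrt (golden R + 2).
have c2 : c * c = golden R + 2 by rewrite -expr2 sqr_sqrtr //; lra.
have c0 : c != 0 by apply: contraNneq n0 => c0; rewrite -c2 c0 mul0r.
have [|||||||||||||A sA [Ag Ahr]] := @equi_frame R (golden R + 2) (golden R)
    (c *: axis g) (c *: axis h) (c *: axis r)
    (cv3 1 (golden R) 0) (cv3 0 1 (golden R)) (cv3 (golden R) 0 1).
- by rewrite dotZl dotZr g1 mulr1.
- by rewrite dotZl dotZr h1 mulr1.
- by rewrite dotZl dotZr r1 mulr1.
- by rewrite dotZl dotZr mulrA c2 dotC hE etaE.
- by rewrite dotZl dotZr mulrA c2 dotC rE etaE.
- by rewrite dotZl dotZr mulrA c2 dotC rh etaE.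
- by rewrite /dot !mxE /=; lra.
- by rewrite /dot !mxE /=; lra.
- by rewrite /dot !mxE /=; lra.
- by rewrite /dot !mxE /=; lra.
- by rewrite /dot !mxE /=; lra.
- by rewrite /dot !mxE /=; lra.
- exact: icosa_triple.
rewrite icosahedronE.
apply: (recognition Pg hcl gh c0 sA) => [||x xcl dx].
- by rewrite !card_prod card_bool card_ord card_class_index ig.
- move=> x xcl; rewrite scalemxAr.
  have pm y : y \in (g ^: G)%g ->
      (exists e, axis x = (-1) ^+ (e : bool) *: axis y) \/
      dot (A *m (c *: axis x)) (A *m (c *: axis y)) = golden R \/
      dot (A *m (c *: axis x)) (A *m (c *: axis y)) = - golden R.
    move=> ycl; rewrite (dot_mulmx _ _ (SO3_tr sA)) dotZl dotZr mulrA c2.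
    have [->|xy] := eqVneq (axis x) (axis y); first by left; exists false; rewrite expr0 scale1r.
    have [->|xNy] := eqVneq (axis x) (- axis y); first by left; exists true; rewrite expr1 scaleN1r.
    by right; case: (dotc x y xcl ycl xy xNy) => ->; [left | right]; rewrite ?mulrN etaE.
  have vert (e : bool) :
    [/\ (-1) ^+ e *: cv3 1 (golden R) 0 = icosa_vertex R (o32, e, e),
        (-1) ^+ e *: cv3 0 1 (golden R) = icosa_vertex R (o30, e, e)
      & (-1) ^+ e *: cv3 (golden R) 0 1 = icosa_vertex R (o31, e, e)].
    have [-> -> ->] := icosa_vertex_cv3 R e e.
    by split; apply/colP; apply: ord3P; rewrite !mxE /= ?mulr0 ?mulr1.
  have pmv y e : axis x = (-1) ^+ (e : bool) *: axis y ->
      A *m (c *: axis x) = (-1) ^+ e *: (A *m (c *: axis y)).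
    by move: (axis x) (axis y) => u w ->; rewrite -!scalemxAr !scalerA mulrC.
  have vv : dot (A *m (c *: axis x)) (A *m (c *: axis x)) = golden R + 2.
    by rewrite (dot_mulmx _ _ (SO3_tr sA)) dotZl dotZr mulrA c2 (dot_axis (class_P Pg xcl)) mulr1.
  have [[e /pmv->]|dg] := pm g gcl.
    by rewrite Ag; case: (vert e) => -> _ _; eexists.
  have [[e /pmv->]|dh] := pm h hcl.
    by case: Ahr => -[-> _]; case: (vert e) => _ E1 E2; rewrite ?E1 ?E2; eexists.
  have [[e /pmv->]|dr] := pm r rcl.
    by case: Ahr => -[_ ->]; case: (vert e) => _ E1 E2; rewrite ?E1 ?E2; eexists.
  rewrite Ag in dg; apply: icosa_vertexP vv dg _ _.
    by case: Ahr => -[E1 E2]; rewrite E1 in dh; rewrite E2 in dr.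
  by case: Ahr => -[E1 E2]; rewrite E1 in dh; rewrite E2 in dr.
by apply: Htrans => //; rewrite dx.
Qed.

(** The centraliser of g has index 2. In a suitable frame it acts by rotations about the third
    coordinate axis, and an element outside it by the half-turn about the first. *)
Lemma dicyclic_case g : g \in P -> pindex g = 2%N ->
  exists2 n, (2 <= n)%N & iso_linear_group s (binary_group (@Dih_SO3 R n)).
Proof.
move=> Pg ig; have Gg := P_G Pg; pose K := 'C_G[g]%G.
have sKG : K \subset G by apply: subsetIl.
have GK x : x \in K -> x \in G by apply: (fintype.subsetP sKG).
have cK : #|K| = (2 * order g)%N by apply: card_cent.
have iK : indexg G K = 2%N by rewrite -ig.
have nK : normal K G by apply: index2_normal.
have KP x : x \in G -> (x \in K) = (x \in 'C[g]%g) by move=> Gx; rewrite finset.in_setI Gx.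
have flip y : y \in G -> y \notin K -> axis (g ^ y)%g = - axis g.
  move=> Gy yK; have gK : g \in K by rewrite KP // cent1id.
  have gyK : (g ^ y)%g \in K by rewrite memJ_norm // (fintype.subsetP (normal_norm nK)).
  have Pgy := mem_P_J Pg Gy.
  move: gyK; rewrite (KP _ (P_G Pgy)) (commute_axis Pg Pgy).
  case/orP=> /eqP // E; case/negP: yK; rewrite KP //.
  exact: (axis_fix Pg Gy E).
have outK x y : x \in G -> y \in G -> x \notin K -> y \notin K -> (x * y^-1)%g \in K.
  move=> Gx Gy xK yK; have Gxy : (x * y^-1)%g \in G by rewrite groupM ?groupV.
  rewrite KP //; apply: (axis_fix Pg Gxy).
  rewrite conjgM; have GyV : y^-1%g \in G by rewrite groupV.
  have Pgy := mem_P_J Pg Gy; have Pgx := mem_P_J Pg Gx.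
  have E : axis (g ^ x)%g = axis (g ^ y)%g by rewrite !flip.
  by rewrite (axis_conj Pgx Pgy GyV E) conjgK.
have [y Gy yK] : exists2 y, y \in G & y \notin K.
  have : ~~ (G \subset K) by rewrite -indexg_eq1 iK.
  by case/fintype.subsetPn => y Gy yK; exists y.
have g1 := dot_axis Pg.
have [sy ny] := s_quat Gy.
(* y reverses the axis of g. Along this axis the equation says that the squares of [qre y] and of
   the component of [qvec y] add up to 0: y is a half-turn about a perpendicular axis. *)
have [qy0 qyg] : qre y = 0 /\ dot (qvec y) (axis g) = 0.
  have yVK : y^-1%g \notin K by rewrite groupV.
  have := flip y^-1%g (groupVr Gy) yVK; rewrite -rot_axis // rotE sy double_coverE rotqE.
  move: (axis g) g1 => p p1 /(congr1 (fun w => dot w p)); rewrite !(dotDl, dotNl, dotZl) p1.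
  have -> : dot (cross (qvec y) p) p = 0 by rewrite /dot /cross !mxE /=; ring.
  move: ny; move: (dot (qvec y) (qvec y)) (dot (qvec y) p) (qre y) => a b c ny E.
  by split; nra.
have vy1 : dot (qvec y) (qvec y) = 1 by move: ny; rewrite qy0 expr0n add0r.
have [|||||||A sA [Ag Ay _]] := @frame_map R (axis g) (qvec y) (cross (axis g) (qvec y))
    (e3 R) (cv3 1 0 0) (cross (e3 R) (cv3 1 0 0)).
- by rewrite g1 /dot /e3 !mxE /=; ring.
- by rewrite vy1 /dot !mxE /=; ring.
- by rewrite cross_sq g1 vy1 (dotC (axis g)) qyg /dot /cross /e3 !mxE /=; ring.
- by rewrite (dotC (axis g)) qyg /dot /e3 !mxE /=; ring.
- transitivity (0 : R); first by rewrite /dot /cross !mxE /=; ring.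
  by rewrite /dot /cross /e3 !mxE /=; ring.
- transitivity (0 : R); first by rewrite /dot /cross !mxE /=; ring.
  by rewrite /dot /cross /e3 !mxE /=; ring.
- rewrite cross_sq g1 vy1 (dotC (axis g)) qyg /dot /cross /e3 !mxE /=; lra.
have [U sU UA] := double_cover_surj sA.
have [a [v [UE nU]]] := proj1 (SU2_quatP U) sU.
have AE : rotq a v = A by rewrite -double_coverE -UE.
pose S x := U *m s x *m U ^t*.
have SE x : x \in G -> S x = quat (qre x) (A *m qvec x).
  by move=> Gx; have [sx _] := s_quat Gx; rewrite /S sx UE quat_conj nU mul1r AE.
have sU' : U ^t* *m U = 1%:M by case: sU => /unitarymxP/mulmx1C.
have SM x w : x \in G -> w \in G -> S (x * w)%g = S x *m S w.
  by move=> Gx Gw; rewrite /S repr_mxM // !mulmxA -(mulmxA _ (U ^t*) U) sU' mulmx1.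
have sS x : x \in G -> SU2 (S x).
  by move=> Gx; apply: SU2M; [apply: SU2M => //; apply: sSU2 | apply: SU2_ctr].
have DS x : x \in G -> double_cover U *m rot x *m (double_cover U)^T = double_cover (S x).
  move=> Gx; rewrite /S double_coverM; [|by apply: SU2M => //; apply: sSU2|exact: SU2_ctr].
  by rewrite double_cover_ctr // double_coverM //; apply: sSU2.
(* In the new frame K consists of quaternions on the circle through 1 and e3, which u identifies
   with the complex unit circle. *)
pose u x : R[i] := qre x +i* (A *m qvec x) o32 0.
have SK x : x \in K -> S x = quat (complex.Re (u x)) (complex.Im (u x) *: e3 R).
  move=> Kx; have Gx := GK x Kx; rewrite SE // /u /=; congr quat.
  have : (g \in 'C[x])%g.
    by rewrite cent1C -KP.
  rewrite commute_cross // => /eqP c0.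
  have [|t ->] := cross_eq0 _ c0; first exact: (qvec_neq0 Pg).
  rewrite (qvecE Pg) scalerA -scalemxAr Ag.
  by apply/colP; apply: ord3P; rewrite /e3 !mxE /= ?mulr0 ?mulr1.
have [|||roots1 roots2] := @hom_roots R _ K u.
- rewrite /u; have := SE 1%g (group1 G); rewrite /S repr_mx1 mulmx1.
  have [/unitarymxP -> _] := sU; rewrite -quat1 => /quat_inj[<- <-].
  by rewrite mxE.
- move=> x w Kx Kw; have := SM x w (GK x Kx) (GK w Kw).
  rewrite (SK _ (groupM Kx Kw)) !SK // quatM => /quat_inj[e1 e2].
  move: e1 (congr1 (fun q : 'cV[R]_3 => q o32 0) e2).
  case: (u (x * w)%g) (u x) (u w) => p q [p1 q1'] [p2 q2].
  rewrite complexM /dot /cross /e3 !mxE /= => -> E.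
  by congr Complex; move: E; rewrite ?mulr0 ?mulr1; lra.
- move=> x w Kx Kw uxw; apply: s_inj; rewrite ?GK //.
  have : S x = S w by rewrite !SK // uxw.
  rewrite /S; move/(congr1 (fun M => U ^t* *m M *m U)).
  by rewrite !mulmxA sU' !mul1mx -!mulmxA sU' !mulmx1.
have n2 : (2 <= order g)%N.
  have : (2 < #|K|)%N; last by rewrite cK; case: (order g) => [|[|]].
  have gN : g \notin [set 1%g; z]%SET by case/finset.setDP: Pg.
  have sub : g |: [set 1%g; z]%SET \subset K.
    apply/fintype.subsetP => x /finset.setU1P[->|xz]; first by rewrite KP // cent1id.
    have /finset.setIP[Gx /centP cx] := fintype.subsetP sZG _ xz.
    by rewrite KP //; apply/cent1P/cx.
  apply: leq_trans (subset_leq_card sub).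
  by rewrite cardsU1 gN cards2 eq_sym sz_neq1.
have n0 : (0 < order g)%N by apply: ltnW.
(* |K| is twice [order g], and a quaternion rotates by twice its angle, so the factors 2 cancel. *)
have DK x k : x \in K -> u x = cis (angle R #|K| k) ->
    double_cover (S x) = blk (rot2 (- angle R (order g) k)) 1.
  move=> Kx uk; rewrite SK // uk /= double_coverE rotq_blk; congr (blk (rot2 (- _)) _).
  rewrite cK /angle natrM; have : (order g)%:R != 0 :> R by rewrite pnatr_eq0 -lt0n.
  by move: (order g)%:R k%:R pi => b c p b0; field.
have Dy : double_cover (S y) = blk (mx2 1 0 0 (-1)) (-1).
  by rewrite SE // qy0 Ay double_coverE rotq_e1.
have Dyx x k : x \in K -> u x = cis (angle R #|K| k) ->
    double_cover (S (y * x)%g) = blk (ref2 (angle R (order g) k)) (-1).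
  move=> Kx uk; have Gx := GK x Kx; rewrite (SM y x Gy Gx) (double_coverM (sS y Gy) (sS x Gx)) Dy (DK x k Kx uk).
  rewrite blkM mulr1 /rot2 /ref2 mx2M cosN sinN; congr (blk _ _); congr mx2; ring.
exists (order g) => //; apply: (conj_image sU).
  move=> x Gx; rewrite DS //; apply/(Dih_SO3P _ n0).
  have [Kx|xK] := boolP (x \in K).
    by have [k uk] := roots1 x Kx; exists k; left; apply: DK.
  have Kyx : (y^-1 * x)%g \in K.
    by rewrite -groupV invMg invgK -[y]invgK outK ?groupV.
  have [k uk] := roots1 _ Kyx; exists k; right.
  by rewrite -[x](mulKVg y); apply: Dyx.
move=> B /(Dih_SO3P _ n0)[k BE]; have [x Kx uk] := roots2 k; have Gx := GK x Kx.
case: BE => ->; [exists x | exists (y * x)%g] => //.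
- by rewrite DS // (DK x k).
- exact: groupM.
by rewrite DS ?groupM // (Dyx x k).
Qed.

Lemma SU2_classification :
  exists2 B : set 'M[R[i]]_2, binary_polyhedral_DE B & iso_linear_group s B.
Proof.
have [[g Pg ig]|[g Pg [oG og]]|[g Pg [oG og uniq_g]]|[g Pg [oG og uniq_g]]] :=
  axis_classification .
- have [n n2 iso] := dicyclic_case Pg ig.
  by exists (binary_group (@Dih_SO3 R n)) => //; constructor 1; exists n.
- exists (binary_group (rotation_group (@tetrahedron R))); first by constructor 2.
  exact: (tetra_case Pg oG og).
- exists (binary_group (rotation_group (@octahedron R))); first by constructor 3.
  exact: (octa_case Pg oG og uniq_g).
exists (binary_group (rotation_group (@icosahedron R))); first by constructor 4.
exact: (icos_case Pg oG og uniq_g).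
Qed.

End FiniteSU2.

(** * Invariant bilinear forms in degree 2 *)

Section DihedralPlane.

Variables (R : realType) (gT : finGroupType) (G : {group gT}).
Variable s : mx_representation R[i] G 2.
Hypothesis s_faithful : forall g, g \in G -> s g = 1%:M -> g = 1%g.
Hypothesis s_irr : mx_irreducible s.
Variable z : gT.
Hypothesis Gz : z \in G.
Hypothesis s_z : s z = - 1%:M.
Hypothesis s_mono : forall g, g \in G ->
  (exists2 a, a != 0 & s g = mx2 a 0 0 a^-1) \/ (exists2 b, b != 0 & s g = mx2 0 b b^-1 0).

Definition diag_part := [set g in G | s g o20 o21 == 0]%SET.

Lemma diag_partP g : reflect (g \in G /\ exists2 a, a != 0 & s g = mx2 a 0 0 a^-1) (g \in diag_part).
Proof.
rewrite finset.in_set; apply: (iffP andP) => -[Gg].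
  move=> /eqP sg; split=> //; case: (s_mono Gg) => [//|[b b0 sE]].
  by move: sg; rewrite sE mxE /= => b00; rewrite b00 eqxx in b0.
by move=> [a _ sE]; split=> //; rewrite sE mxE.
Qed.

Lemma diag_part_group : group_set diag_part.
Proof.
apply/group_setP; split=> [|x y /diag_partP[Gx [a a0 sx]] /diag_partP[Gy [b b0 sy]]].
  by apply/diag_partP; split=> //; exists 1; rewrite ?oner_eq0 // repr_mx1 mx2_1 invr1.
apply/diag_partP; split; first by rewrite groupM.
exists (a * b); first by rewrite mulf_neq0.
by rewrite repr_mxM // sx sy mx2M !(mulr0, mul0r, addr0, add0r) invfM.
Qed.

Definition diag_group : {group gT} := Group diag_part_group.

(** A group of diagonal matrices would commute with diag(1, 0), against Schur's lemma. *)
Lemma antidiag_ex : exists2 y, y \in G & y \notin diag_group.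
Proof.
apply: contrapT => no.
have /is_scalar_mxP[c /matrixP cE] : is_scalar_mx (mx2 1 0 0 0 : 'M[R[i]]_2).
  apply: (irr_cent_scalar s_irr) => g Gg.
  have /diag_partP[_ [a a0 ->]] : g \in diag_group.
    by apply: contraT => gN; case: no; exists g.
  by rewrite !mx2M !(mulr0, mul0r, mul1r, mulr1, addr0, add0r).
have := (cE o20 o20, cE o21 o21); rewrite !mxE /= => -[<-] /eqP.
by rewrite eq_sym oner_eq0.
Qed.

Let m := #|diag_group|.

(** z is a diagonal element of order 2; this is the origin of the divisibility by 4 of the order
    2m. *)
Let m_even : (2 %| m)%N.
Proof.
have z1 : z != 1%g.
  apply/eqP => z1; have := s_z; rewrite z1 repr_mx1 => /(congr1 mxtrace)/eqP.
  by rewrite linearN /= mxtrace1 -addr_eq0 -natrD pnatr_eq0.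
have zz : (z ^+ 2 = 1)%g.
  by apply: s_faithful; rewrite ?groupX // expgS expg1 repr_mxM // s_z mulNmx mulmxN opprK mulmx1.
have <- : #[z]%g = 2%N.
  by apply/eqP; rewrite eqn_leq dvdn_leq ?order_dvdn ?zz //= order_gt1 z1.
apply: order_dvdG; apply/finset.setIdP; split=> //.
by rewrite s_z !mxE /= mulr0n oppr0.
Qed.

Let m_gt0 : (0 < m)%N. Proof. exact: cardG_gt0. Qed.

Lemma dihedral_case :
  exists m, [/\ (2 <= m)%N, (4 %| 2 * m)%N & iso_linear_group s (@Dih_complexified R m)].
Proof.
exists m; split; first exact: dvdn_leq m_even.
  by rewrite (@dvdn_pmul2l 2 2).
have [y Gy yN] := antidiag_ex.
have [b b0 sy] : exists2 b, b != 0 & s y = mx2 0 b b^-1 0.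
  case: (s_mono Gy) => // -[a a0 sE]; case/negP: yN; apply/diag_partP; split=> //.
  by exists a.
have yy : (y * y = 1)%g.
  apply: s_faithful; rewrite ?groupM // repr_mxM // sy mx2M mx2_1.
  by rewrite !(mulr0, mul0r, addr0, add0r) divff // mulVf.
pose u x := s x o20 o20.
have sK x : x \in diag_group -> s x = mx2 (u x) 0 0 (u x)^-1.
  by move=> /diag_partP[_ [a _ sE]]; rewrite /u sE mxE.
have GK x : x \in diag_group -> x \in G by case/diag_partP.
have [|||roots1 roots2] := @hom_roots R _ diag_group u.
- by rewrite /u repr_mx1 mxE.
- move=> x w Kx Kw; have := sK _ (groupM Kx Kw); rewrite repr_mxM ?GK //.
  rewrite (sK _ Kx) (sK _ Kw) mx2M => E; have [<- _ _ _] := mx2_inj E.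
  by rewrite mul0r addr0.
- by move=> x w Kx Kw uxw; apply: (faithful_inj s_faithful); rewrite ?GK // !sK // uxw.
(* The right factor rescales so that y becomes the exchange of the two coordinates; the left one
   passes from the isotropic basis to a real orthonormal one, where y is a reflection and diagonal
   elements are rotations. *)
pose T : 'M[R[i]]_2 := mx2 1 1 (0 +i* 1) (0 +i* -1) *m mx2 b^-1 0 0 1.
pose T' : 'M[R[i]]_2 := mx2 b 0 0 1 *m mx2 ((1/2) +i* 0) (0 +i* (-1/2)) ((1/2) +i* 0) (0 +i* (1/2)).
have half : 1/2 + 1/2 = 1 :> R by lra.
have TT : T *m T' = 1%:M.
  rewrite /T /T' !mulmxA -(mulmxA _ (mx2 b^-1 0 0 1)) [X in _ *m X *m _]mx2M.
  rewrite !(mulr0, mul0r, addr0, add0r, mulr1) mulVf // !mx2M mx2_1 complex0 complex1 !complexOp.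
  by congr mx2; congr Complex; lra.
have Tdiag t : T *m mx2 (cis t) 0 0 (cis t)^-1 *m T' = map_mx (real_complex R) (rot2 (- t)).
  have -> : (cis t)^-1 = cis (- t).
    have tN : cis t * cis (- t) = 1 by rewrite -cisD subrr cis0.
    have t0 : cis t != 0 by apply: contraPneq tN => ->; rewrite mul0r => /eqP; rewrite eq_sym oner_eq0.
    by apply: (mulfI t0); rewrite divff // tN.
  rewrite /T /T' !mulmxA -(mulmxA _ (mx2 b^-1 0 0 1)) [X in _ *m X *m _ *m _]mx2M.
  rewrite -(mulmxA _ _ (mx2 b 0 0 1)) [X in _ *m X *m _]mx2M.
  rewrite !(mulr0, mul0r, addr0, add0r, mul1r, mulr1) mulrAC mulVf // mul1r !mx2M.
  rewrite /cis /rot2 !complex0 !complexOp; apply/matrixP; apply: ord2P; apply: ord2P;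
    rewrite !mxE /= ?cosN ?sinN; congr Complex; lra.
have Ty : T *m s y *m T' = map_mx (real_complex R) (mx2 1 0 0 (-1)).
  rewrite sy /T /T' !mulmxA -(mulmxA _ (mx2 b^-1 0 0 1)) [X in _ *m X *m _ *m _]mx2M.
  rewrite -(mulmxA _ _ (mx2 b 0 0 1)) [X in _ *m X *m _]mx2M.
  rewrite !(mulr0, mul0r, addr0, add0r, mul1r, mulr1) mulVf // !mx2M.
  rewrite !complex0 !complex1 !complexOp; apply/matrixP; apply: ord2P; apply: ord2P;
    rewrite !mxE /=; congr Complex; lra.
clearbody T T'.
have Tref x t : x \in G -> s (y * x)%g = mx2 (cis t) 0 0 (cis t)^-1 ->
    T *m s x *m T' = map_mx (real_complex R) (ref2 t).
  move=> Gx E; have -> : s x = s y *m s (y * x)%g by rewrite -repr_mxM ?groupM // mulgA yy mul1g.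
  transitivity (T *m s y *m T' *m (T *m s (y * x)%g *m T')).
    by rewrite !mulmxA -(mulmxA _ T' T) (mulmx1C TT) mulmx1.
  rewrite Ty E Tdiag -map_mxM /ref2 /rot2 mx2M cosN sinN; congr (map_mx _ _).
  by congr mx2; ring.
apply: (conj_iso TT s_faithful) => [x Gx|_ [A AD <-]].
  have [Kx|Kx] := boolP (x \in diag_group).
    have [k uk] := roots1 x Kx; exists (rot2 (- angle R m k)); last by rewrite sK // uk Tdiag.
    by apply/(DihP _ m_gt0); exists k; left.
  have Kyx : (y * x)%g \in diag_group.
    apply/diag_partP; split; first by rewrite groupM.
    have [c c0 sx] : exists2 c, c != 0 & s x = mx2 0 c c^-1 0.
      case: (s_mono Gx) => // -[a a0 sE]; case/negP: Kx; apply/diag_partP; split=> //.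
      by exists a.
    exists (b / c); first by rewrite mulf_neq0 ?invr_neq0.
    by rewrite repr_mxM // sy sx mx2M !(mulr0, mul0r, addr0, add0r) invfM invrK.
  have [k uk] := roots1 _ Kyx; exists (ref2 (angle R m k)); last by rewrite (@Tref _ (angle R m k)) // sK // uk.
  by apply/(DihP _ m_gt0); exists k; right.
have /(DihP _ m_gt0)[k [->|->]] := AD; have [x Kx uk] := roots2 k.
  by exists x; [apply: GK | rewrite sK // uk Tdiag].
have Gx := GK x Kx; exists (y * x)%g; first exact: groupM.
by rewrite (@Tref _ (angle R m k)) ?groupM // mulgA yy mul1g sK // uk.
Qed.

End DihedralPlane.

(** The rows of P are isotropic vectors, found from the two roots of p x^2 + 2 q x + r and scaled to
    have product 1; when p = 0 the first is (1, 0). *)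
Lemma hyperbolic_basis (C : numClosedFieldType) (S : 'M[C]_2) : S^T = S -> \det S != 0 ->
  exists P, P *m S *m P^T = mx2 0 1 1 0.
Proof.
have two : 2 != 0 :> C by rewrite pnatr_eq0.
rewrite [S]mx2P trmx_mx2 => E; have [_ _ -> _] := mx2_inj E; move: (S o20 o20) (S o21 o20) (S o21 o21) => p q r.
rewrite det_mx2; have [-> dS|p0 dS] := eqVneq p 0.
  have q0 : q != 0 by apply: contraNneq dS => ->; rewrite !mul0r subr0.
  exists (mx2 1 0 (- r / (2 * q) / q) q^-1); rewrite trmx_mx2 !mx2M.
  by congr mx2; field; rewrite ?q0 ?two.
pose e := sqrtC (q ^+ 2 - p * r).
have e2 : e * e = q ^+ 2 - p * r by rewrite -expr2 sqrtCK.
have e0 : e != 0.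
  by apply: contraNneq dS => e0; move: e2; rewrite e0 mul0r => E2; rewrite -oppr_eq0 opprB -expr2 -E2.
have rE : r = (q * q - e * e) / p by rewrite e2 -expr2 opprB addrC subrK mulrC mulKf.
exists (mx2 ((- q + e) / p) 1 (- (- q - e) / (2 * e * e)) (- p / (2 * e * e))).
rewrite trmx_mx2 !mx2M rE; congr mx2; field; rewrite ?p0 ?e0 ?two //.
Qed.

Section InvariantForm.

Variables (R : realType) (gT : finGroupType) (G : {group gT}).
Variable rho : mx_representation R[i] G 2.
Hypothesis rho_irr : mx_irreducible rho.
Hypothesis rho_sq : \sum_(g in G) chr rho g ^+ 2 = #|G|%:R.

(** Invariant forms are the intertwiners from rho to its dual; their space has dimension the mean of
    chi(g^-1)^2, which is 1. *)
Lemma invariant_form : exists2 M : 'M[R[i]]_2, M != 0 &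
  forall g, g \in G -> rho g *m M *m (rho g)^T = M.
Proof.
have dualP : mx_repr G (fun g => (rho g^-1%g)^T).
  split=> [|g h Gg Gh]; first by rewrite invg1 repr_mx1 trmx1.
  by rewrite invMg repr_mxM ?groupV // trmx_mul.
pose dual := MxRepresentation dualP.
have /eqP : cdot G (chr rho) (chr dual) = 1.
  rewrite /cdot (eq_bigr (fun g => chr rho g^-1%g ^+ 2)) => [|g Gg]; last first.
    by rewrite expr2 /chr /= mxtrace_tr.
  rewrite (reindex_inj invg_inj) /= (eq_big (fun g => g \in G) (fun g => chr rho g ^+ 2)).
  - by rewrite rho_sq mulVf // cardG_neq0.
  - by move=> g; rewrite groupV.
  by move=> g _; rewrite invgK.
rewrite cdot_hom pnatr_eq1 => /eqP dim1.
have : hom_space rho dual != 0%VS by rewrite -dimv_eq0 dim1.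
rewrite -vpick0 => nz; exists (vpick (hom_space rho dual)) => // g Gg.
have /hom_spaceP/(_ g Gg) -> := memv_pick (hom_space rho dual).
by rewrite -mulmxA -trmx_mul -repr_mxM ?groupV // mulgV repr_mx1 trmx1 mulmx1.
Qed.

(** The radical of an invariant form is a submodule. *)
Lemma invariant_form_unit M : M != 0 ->
  (forall g, g \in G -> rho g *m M *m (rho g)^T = M) -> \det M != 0.
Proof.
move=> nzM inv; rewrite -unitfE -unitmxE -row_free_unit -kermx_eq0.
apply: contraT => nzK; have /mx_irrP[_ irr] := rho_irr.
have: row_full (kermx M).
  apply: irr nzK; apply/mxmoduleP => g Gg; apply/sub_kermxP.
  have uT : (rho g)^T \in unitmx by rewrite unitmx_tr repr_mx_unit.
  apply: (can_inj (mulmxK uT)); rewrite mul0mx -(mulmxA _ M) -(mulmxA (kermx M)) (mulmxA (rho g)) (inv g Gg).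
  exact: mulmx_ker.
rewrite -sub1mx => /sub_kermxP; rewrite mul1mx => M0.
by rewrite M0 eqxx in nzM.
Qed.

Lemma mx2_skew (A M : 'M[R[i]]_2) : M^T = - M -> A *m M *m A^T = (\det A) *: M.
Proof.
move=> /matrixP MT; have m00 : M o20 o20 = 0 /\ M o21 o21 = 0.
  have := (MT o20 o20, MT o21 o21); rewrite !mxE => -[/eqP e0 /eqP e1].
  by split; apply/eqP; [move: e0 | move: e1]; rewrite -subr_eq0 opprK -mulr2n mulrn_eq0.
have m10 : M o21 o20 = - M o20 o21 by have := MT o20 o21; rewrite !mxE.
rewrite [M]mx2P (proj1 m00) (proj2 m00) m10; move: (M o20 o21) => m.
rewrite [A]mx2P; move: (A o20 o20) (A o20 o21) (A o21 o20) (A o21 o21) => a b c e.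
rewrite det_mx2; apply/matrixP; apply: ord2P; apply: ord2P;
  rewrite !(mxE, sum2) /=; ring.
Qed.

(** A skew form is multiplied by the determinant, which is therefore 1, and unitary coordinates then
    lie in SU(2). Otherwise M + M^T is a nonzero invariant symmetric form, and a matrix with rows
    (a, b), (c, e) preserving its hyperbolic shape satisfies a b = c e = 0 and a e + b c = 1. *)
Lemma form_dichotomy :
  (exists2 s : mx_representation R[i] G 2, mx_rsim rho s & forall g, g \in G -> SU2 (s g)) \/
  (exists2 s : mx_representation R[i] G 2, mx_rsim rho s & forall g, g \in G ->
    (exists2 a, a != 0 & s g = mx2 a 0 0 a^-1) \/ (exists2 b, b != 0 & s g = mx2 0 b b^-1 0)).
Proof.
have [M nzM inv] := invariant_form.
have [skew|nskew] := eqVneq (M + M^T) 0.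
  left; have MT : M^T = - M by apply/eqP; rewrite -addr_eq0 addrC skew.
  have [s sim uni] := unitary_repr rho; exists s => // g Gg; split; first exact: uni.
  have <- : \det (rho g) = \det (s g).
    case: sim => B _ freeB /(_ g Gg) /(congr1 determinant); rewrite !det_mulmx mulrC.
    apply: mulfI; by rewrite -unitfE -unitmxE -row_free_unit.
  have /eqP := inv g Gg; rewrite mx2_skew // -subr_eq0 -{2}[M]scale1r -scalerBl scaler_eq0.
  by rewrite (negPf nzM) orbF subr_eq0 => /eqP.
right; have invS g : g \in G -> rho g *m (M + M^T) *m (rho g)^T = M + M^T.
  move=> Gg; rewrite mulmxDr mulmxDl inv //; congr (_ + _).
  by rewrite -{2}(inv g Gg) !trmx_mul trmxK mulmxA.
have ST : (M + M^T)^T = M + M^T by rewrite linearD /= trmxK addrC.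
have [P PE] := hyperbolic_basis ST (invariant_form_unit nskew invS).
have uP : P \in unitmx.
  have := congr1 determinant PE; rewrite !det_mulmx det_mx2 unitmxE unitfE => E.
  apply: contraPneq E => ->; rewrite !mul0r mulr1 sub0r => /eqP.
  by rewrite eq_sym oppr_eq0 oner_eq0.
have sP : mx_repr G (fun g => P *m rho g *m invmx P).
  split=> [|g h Gg Gh]; first by rewrite repr_mx1 mulmx1 mulmxV.
  by rewrite repr_mxM // !mulmxA -(mulmxA _ (invmx P) P) mulVmx // mulmx1.
exists (MxRepresentation sP).
  exists (invmx P) => // [|g Gg]; first by rewrite row_free_unit unitmx_inv.
  by rewrite /= !mulmxA mulVmx // mul1mx.
move=> g Gg /=; set A := P *m rho g *m invmx P.
have : A *m mx2 0 1 1 0 *m A^T = mx2 0 1 1 0.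
  rewrite -PE /A !trmx_mul !mulmxA -(mulmxA _ (invmx P) P) mulVmx // mulmx1.
  rewrite -(mulmxA _ P^T) -trmx_mul mulVmx // trmx1 mulmx1.
  by rewrite -!(mulmxA P) !mulmxA -(mulmxA P) -(mulmxA P) invS.
rewrite [A]mx2P; move: (A o20 o20) (A o20 o21) (A o21 o20) (A o21 o21) => a b c e.
rewrite trmx_mx2 !mx2M => E; move: (mx2_inj E) => {E}[]; rewrite !(mulr0, mulr1, addr0, add0r) => e1 e2 _ e3.
have two : 2 != 0 :> R[i] by rewrite pnatr_eq0.
have {e1} /eqP : a * b = 0 by apply: (mulfI two); rewrite mulr0 -[RHS]e1; ring.
have {e3} /eqP : c * e = 0 by apply: (mulfI two); rewrite mulr0 -[RHS]e3; ring.
have [a0|a0] := eqVneq a 0.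
  move=> ce _; right; move: e2; rewrite a0 mul0r addr0 => bc.
  have b0 : b != 0 by apply: contraPneq bc => ->; rewrite mul0r => /eqP; rewrite eq_sym oner_eq0.
  have c0 : c != 0 by apply: contraPneq bc => ->; rewrite mulr0 => /eqP; rewrite eq_sym oner_eq0.
  exists b => //; have -> : c = b^-1 by apply: (mulfI b0); rewrite divff.
  by move: ce; rewrite mulf_eq0 (negPf c0) => /eqP->.
move=> ce; rewrite mulf_eq0 (negPf a0) => /eqP b0; left; exists a => //.
move: e2; rewrite b0 mul0r add0r => ae.
have e0 : e != 0 by apply: contraPneq ae => ->; rewrite mulr0 => /eqP; rewrite eq_sym oner_eq0.
have -> : e = a^-1 by apply: (mulfI a0); rewrite divff.
by move: ce; rewrite mulf_eq0 (negPf e0) orbF => /eqP->.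
Qed.

End InvariantForm.

Theorem theorem2 (R : realType) (gT : finGroupType) (G : {group gT}) (d : nat)
    (rho : mx_representation R[i]%C G d) :
  (0 < d)%N ->
  is_tree (mckay rho) ->
  [\/ exists m : nat,
        [/\ (2 <= m)%N, (4 %| 2 * m)%N
          & iso_linear_group rho (@Dih_complexified R m)],
      exists2 B : set 'M[R[i]%C]_2,
        binary_polyhedral_DE B & iso_linear_group rho B
    | exists n : nat,
        [/\ extra_special_2group G, #|G| = (2 ^ (1 + 2 * n))%N, d = (2 ^ n)%N
          & unique_center_nontrivial_irr rho]].
Proof.
move=> d_gt0 tree; have [z Gz rho_z] := mckay_minus1 tree.
have [d_lt2|d_gt2|d2] := ltngtP d 2.
- constructor 3; apply: mckay_extra_special => //; apply: (mckay_order1 d_gt0 tree Gz rho_z).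
  by apply/eqP; rewrite eqn_leq d_gt0 -ltnS d_lt2.
- by constructor 3; apply: mckay_extra_special => //; apply: (mckay_order d_gt0 tree Gz rho_z).
subst d; have irr := mckay_irreducible d_gt0 tree.
have transport (s : mx_representation R[i]%C G 2) : mx_rsim rho s ->
    [/\ forall g, g \in G -> s g = 1%:M -> g = 1%g, mx_irreducible s & s z = - 1%:M].
  move=> sim; split; last first.
  - rewrite -scaleN1r scalemx1; apply: (mx_rsim_scalar Gz sim).
    by rewrite rho_z -scaleN1r scalemx1.
  - exact: mx_rsim_irr sim irr.
  move=> g Gg sg; apply: (mckay_faithful tree Gg).
  by apply: (mx_rsim_scalar Gg (mx_rsim_sym sim)) sg.
have [[s sim sSU2]|[s sim mono]] := form_dichotomy irr (mckay_square_sum d_gt0 tree).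
  have [faith irr_s sz] := transport s sim.
  have [B BDE iso] := SU2_classification sSU2 faith irr_s Gz sz.
  by constructor 2; exists B => //; apply: iso_linear_group_rsim iso.
have [faith irr_s sz] := transport s sim.
have [m [m2 m4 iso]] := dihedral_case faith irr_s Gz sz mono.
by constructor 1; exists m; split=> //; apply: iso_linear_group_rsim iso.
Qed.
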